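(* Let $k \geq 1$ and let $A, B \subset \mathbb{R}^k$ be bounded Borel sets such that $\lambda(A) = \lambda(B) > 0$, $\Delta(\partial A) < k$, and $\Delta(\partial B) < k$. Then $A$ and $B$ are equidecomposable by translations using Borel pieces.
   Context: $\lambda$ denotes Lebesgue measure on $\mathbb{R}^k$. For $X \subset \mathbb{R}^k$, $\partial X = \mathrm{cl}(X) \setminus \mathrm{int}(X)$ is its boundary, and $\Delta(X)$ denotes the upper Minkowski (box-counting) dimension of $X$. Two sets $A, B \subset \mathbb{R}^k$ are equidecomposable by translations using Borel pieces if there exist a partition $\{A_1, \ldots, A_n\}$ of $A$ into Borel sets and vectors $t_1, \ldots, t_n \in \mathbb{R}^k$ such that the translates $t_1 + A_1, \ldots, t_n + A_n$ form a partition of $B$. *)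

(* Defs.v *)
From HB Require Import structures.
From mathcomp Require Import all_boot all_order all_algebra.
From mathcomp Require Import all_classical all_reals all_analysis.

Set Implicit Arguments.
Unset Strict Implicit.
Unset Printing Implicit Defensive.

Import Order.TTheory GRing.Theory Num.Theory.
Import numFieldNormedType.Exports.

Local Open Scope classical_set_scope.
Local Open Scope ring_scope.

(* R^k is 'rV[R]_k; its library norm is the sup norm, whose topology and bounded
   sets are the Euclidean ones. *)

Definition borel (R : realType) (k : nat) (A : set 'rV[R]_k) : Prop :=
  <<s @open 'rV[R]_k >> A.

Definition box (R : realType) (k : nat) (a b : 'rV[R]_k) : set 'rV[R]_k :=
  [set x | forall i, a 0 i <= x 0 i < b 0 i].

(* The truncation at 0 gives volume 0 to the empty boxes with b 0 i < a 0 i for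
   some i. *)
Definition box_volume (R : realType) (k : nat) (a b : 'rV[R]_k) : R :=
  \prod_(i < k) Num.max 0 (b 0 i - a 0 i).

(* Lebesgue outer measure: the infimum of the total volume of countable covers
   by boxes. Its restriction to the Borel sets is Lebesgue measure; it should
   not be read as a measure on arbitrary sets. *)
Definition lebesgue (R : realType) (k : nat) (X : set 'rV[R]_k) : \bar R :=
  ereal_inf [set (\sum_(0 <= n <oo) (box_volume (ab n).1 (ab n).2)%:E)%E |
    ab in [set ab : nat -> 'rV[R]_k * 'rV[R]_k |
      X `<=` \bigcup_n box (ab n).1 (ab n).2]].

Definition boundary (T : topologicalType) (X : set T) : set T :=
  closure X `\` X°.

Definition grid_cube (R : realType) (k : nat) (e : R) (z : 'rV[int]_k) :
    set 'rV[R]_k :=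
  [set x | forall i, (z 0 i)%:~R * e <= x 0 i < ((z 0 i)%:~R + 1) * e].

Definition box_count (R : realType) (k : nat) (e : R) (X : set 'rV[R]_k) :
    \bar R :=
  counting [set z : 'rV[int]_k | grid_cube e z `&` X !=set0].

(* limsup of log N_e(X) / log (1 / e) as e tends to 0 from the right. It is -oo
   for the empty set and +oo for an unbounded set. *)
Definition upper_minkowski_dim (R : realType) (k : nat) (X : set 'rV[R]_k) :
    \bar R :=
  limf_esup (fun e : R => (lne (box_count e X) * ((ln e^-1)^-1)%:E)%E) 0^'+.

(* [partition D F X] (classical_sets) also requires the pieces to be nonempty. *)
Definition equidecomposable_borel (R : realType) (k : nat)
    (A B : set 'rV[R]_k) : Prop :=
  exists (n : nat) (P : 'I_n -> set 'rV[R]_k) (t : 'I_n -> 'rV[R]_k),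
    [/\ forall i, borel (P i),
        partition [set: 'I_n] P A
      & partition [set: 'I_n] (fun i => [set t i + x | x in P i]) B].

(* Main.v *)
Require Import Defs.
From HB Require Import structures.
From mathcomp Require Import all_boot all_order all_algebra.
From mathcomp Require Import all_classical all_reals all_analysis.
From mathcomp Require Import measurable_realfun ring_quotient generic_quotient.
From mathcomp Require Import zify ring lra.

Set Implicit Arguments.
Unset Strict Implicit.
Unset Printing Implicit Defensive.
Import Order.TTheory GRing.Theory Num.Theory.
Import numFieldNormedType.Exports.
Local Open Scope classical_set_scope.
Local Open Scope ring_scope.
Local Open Scope quotient_scope.

(* Following Marks and Unger. Choose a lattice L Z^k with a fundamental cube containing A
   and B, and d translations of R^k, giving an action of Z^d modulo the lattice in which
   every cube of side 2^j in an orbit visits A and B with relative error O(4^-j). A random choice of rational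
   translations with a large prime denominator works up to any given scale, by a second
   moment computation in which the grid cells meeting a boundary are few because its upper
   Minkowski dimension is less than k; a cluster point works at all scales. Averaging
   1_A - 1_B over cubes of doubling side gives a bounded Borel real flow on the orbit graph
   with divergence 1_A - 1_B. It is rounded to an integer flow: on increasing hyperfinite
   subrelations the flow modulo 1 is a boundary, and the corresponding chains can be chosen
   to stabilise because the rank d is greater than 2, so that the differences of two
   choices are themselves boundaries. Finally, orbits are tiled by large sets, in which
   A and B have more points than the integer flow across the boundary of the tile; moving
   as many points between tiles as the flow requires and matching inside the tiles gives a
   bijection that moves each point by one of finitely many translations. *)

(** * Boxes in the lattice Z^d and countable measurable choices *)

(** No point can be chosen in each orbit in a Borel way, so the equidistribution has to hold from
    every starting point, and later choices have to be explicit formulas or searches in bounded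
    windows. The rate [4^-j] is dictated by the flow: evening out averages of size [c] over the
    distance [2^j] costs a flow of size about [c * 2^j], and these costs must be summable. Cells of
    side [2^-(s j)] meeting a boundary contribute an error of this order once [s] is large compared
    with the inverse of the codimension. The price is about [2^(s k j)] cells whose frequencies must
    all be right. It is paid by raising [d]: under a random linear map over a prime field the visits
    to a cell are uncorrelated except for linearly dependent pairs, so their variance over a cube of
    side [N] is at most [N^(d+1)], against a mean of order [N^d]. Starting points cost nothing
    extra, since moving the start translates the cell indices up to an error of two. *)

Section Lattice.
Variable d : nat.
Implicit Types (m n v : 'rV[int]_d) (w N : nat).

Definition nrm n : nat := (\max_(i < d) `|n 0%R i|)%N.

Lemma rvD m n i : (m + n) 0 i = m 0 i + n 0 i. Proof. by rewrite mxE. Qed.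
Lemma rvB m n i : (m - n) 0 i = m 0 i - n 0 i. Proof. by rewrite !mxE. Qed.
Lemma rv0 i : (0 : 'rV[int]_d) 0 i = 0. Proof. by rewrite mxE. Qed.

Lemma rvE (F : 'I_d -> int) i : (\row_j F j) 0 i = F i. Proof. by rewrite mxE. Qed.

Lemma nrm_leP n w : reflect (forall i, (`|n 0%R i| <= w)%N) (nrm n <= w)%N.
Proof.
by apply: (iffP (bigmax_leqP _ _ _)) => [h i|h i _]; apply: h.
Qed.

Lemma nrm_coord n i : (`|n 0%R i| <= nrm n)%N.
Proof. by have /nrm_leP := leqnn (nrm n). Qed.

Lemma nrmD m n : (nrm (m + n)%R <= nrm m + nrm n)%N.
Proof.
apply/nrm_leP => i; rewrite rvD.
by have := nrm_coord m i; have := nrm_coord n i; lia.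
Qed.

Lemma nrmN n : nrm (- n) = nrm n.
Proof. by rewrite /nrm; apply: eq_bigr => i _; rewrite mxE abszN. Qed.

Lemma nrmB m n : (nrm (m - n)%R <= nrm m + nrm n)%N.
Proof. by rewrite -(nrmN n) nrmD. Qed.

Lemma nrm0 : nrm 0 = 0%N.
Proof. by apply/eqP; rewrite -leqn0; apply/nrm_leP => i; rewrite rv0. Qed.

Definition unitv (i : 'I_d) : 'rV[int]_d := delta_mx 0 i.

Lemma unitvE (i j : 'I_d) : unitv i 0 j = (i == j)%:Z.
Proof. by rewrite mxE eqxx eq_sym; case: (i == j). Qed.

Lemma nrm_unitv i : (nrm (unitv i) <= 1)%N.
Proof. by apply/nrm_leP => j; rewrite unitvE; case: (i == j). Qed.

Definition boxs w : seq 'rV[int]_d :=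
  [seq \row_i ((f i : nat)%:Z - w%:Z) | f : {ffun 'I_d -> 'I_(2 * w).+1}].

Lemma boxs_uniq w : uniq (boxs w).
Proof.
rewrite map_inj_uniq ?enum_uniq // => f g /rowP h; apply/ffunP => i.
by apply: val_inj; have := h i; rewrite !mxE /=; lia.
Qed.

Lemma mem_boxs w n : (n \in boxs w) = (nrm n <= w)%N.
Proof.
apply/idP/nrm_leP => [/mapP[f _ ->] i|h].
  by rewrite rvE; case: (f i) => k /= hk; lia.
apply/mapP; exists [ffun i => inord (absz (n 0 i + w%:Z))]; first by rewrite mem_enum.
apply/rowP => i; rewrite rvE ffunE; move: (n 0 i) (h i) => a ha; rewrite inordK; lia.
Qed.

Lemma size_boxs w : size (boxs w) = ((2 * w).+1 ^ d)%N.
Proof. by rewrite size_map -cardE card_ffun !card_ord. Qed.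

Definition boxL (s : seq 'I_d) (L : 'I_d -> nat) : seq 'rV[int]_d :=
  foldr (fun i t => [seq unitv i *+ l + v | l <- iota 0 (L i), v <- t]) [:: 0] s.

Lemma unitvMn (i j : 'I_d) l : (unitv i *+ l) 0 j = ((i == j) * l)%:Z.
Proof. by rewrite mulmxnE unitvE; case: (i == j); rewrite ?mul0rn // mul1n natz. Qed.

Lemma mem_boxL s L v : uniq s ->
  reflect (forall i, if i \in s then 0 <= v 0 i < (L i)%:Z else v 0 i == 0)
    (v \in boxL s L).
Proof.
elim: s v => [|i s IH] v /=.
  move=> _; rewrite inE; apply: (iffP eqP) => [->|h]; first by move=> i; rewrite rv0.
  by apply/rowP => i; rewrite rv0; apply/eqP/h.
case/andP => nis us; apply: (iffP allpairsP) => [[[l u] /= [hl hu ->]] j|h].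
  move: hu => /(IH _ us)/(_ j); rewrite inE rvD unitvMn eq_sym.
  case: (eqVneq i j) => [<-|_] /=; last by case: ifP; lia.
  by rewrite (negbTE nis); move: hl; rewrite mem_iota; lia.
have hi := h i; rewrite inE eqxx /= in hi.
exists (absz (v 0 i), v - unitv i *+ absz (v 0 i)) => /=; split.
- by rewrite mem_iota; lia.
- apply/(IH _ us) => j; have := h j; rewrite inE rvB unitvMn eq_sym.
  case: (eqVneq i j) => [<-|_] /=; last by case: ifP; lia.
  by rewrite (negbTE nis); lia.
- by rewrite addrC subrK.
Qed.

Lemma boxL_uniq s L : uniq s -> uniq (boxL s L).
Proof.
elim: s => [|i s IH] //= /andP[nis us]; apply: allpairs_uniq; rewrite ?iota_uniq ?IH //.
move=> [l u] [l' u'] /allpairsP[[a b] /= [_ hb [-> ->]]].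
case/allpairsP => [[a' b'] /= [_ hb' [-> ->]]] /rowP h.
have /(mem_boxL _ _ us)/(_ i) := hb; have /(mem_boxL _ _ us)/(_ i) := hb'.
rewrite (negbTE nis) => /eqP h1 /eqP h2.
have := h i; rewrite !rvD !unitvMn eqxx h1 h2 => e.
have e1 : a = a' by lia.
by rewrite e1; congr pair; apply/rowP => j; have := h j; rewrite !rvD e1; lia.
Qed.

Definition cube N := boxL (enum 'I_d) (fun=> N).

Lemma mem_cube N v : reflect (forall i, 0 <= v 0 i < N%:Z) (v \in cube N).
Proof.
apply: (iffP (mem_boxL _ _ (enum_uniq _))) => h i; have := h i; by rewrite mem_enum.
Qed.

Lemma cube_uniq N : uniq (cube N).
Proof. exact/boxL_uniq/enum_uniq. Qed.

Lemma size_cube N : size (cube N) = (N ^ d)%N.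
Proof.
have h s : size (boxL s (fun=> N)) = (N ^ size s)%N.
  by elim: s => //= i s IH; rewrite size_allpairs size_iota IH expnS.
by rewrite h size_enum_ord.
Qed.

Lemma cube_sub_boxs N : {subset cube N <= boxs N}.
Proof.
move=> v /mem_cube h; rewrite mem_boxs; apply/nrm_leP => i; have := h i; lia.
Qed.

Lemma big_boxL_double (V : nmodType) (g : 'rV[int]_d -> V) s L L' i :
    uniq s -> i \in s -> L' i = (2 * L i)%N -> (forall j, j != i -> L' j = L j) ->
  \sum_(v <- boxL s L') g v =
  \sum_(v <- boxL s L) (g v + g (v + unitv i *+ L i)).
Proof.
elim: s g => [|j s IH] g //= /andP[njs us]; rewrite inE => hi h2 hL.
rewrite !big_allpairs_dep /=.
have [ij|nij] := eqVneq i j.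
  rewrite -ij in njs *; have -> : boxL s L' = boxL s L.
    elim: s njs {IH us hi} => [|k s IHs] //=; rewrite inE negb_or => /andP[ik nis].
    by rewrite IHs // hL // eq_sym.
  have -> : iota 0 (L' i) = iota 0 (L i) ++ [seq (L i + l)%N | l <- iota 0 (L i)].
    by rewrite h2 mul2n -addnn iotaD -iotaDl addn0.
  rewrite big_cat /= big_map -big_split /=.
  apply: eq_bigr => l _; rewrite -big_split /=; apply: eq_bigr => v _; congr (_ + g _).
  by rewrite mulrnDr -addrA addrC -addrA.
rewrite (negbTE nij) /= in hi.
rewrite hL 1?eq_sym //; apply: eq_bigr => l _.
by rewrite (IH (fun v => g (unitv j *+ l + v))) //; apply: eq_bigr => v _; rewrite addrA.
Qed.

End Lattice.

(** * Measurable selections with countably many values *)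

Section CountableMeasurable.
Context {disp} {X : measurableType disp}.

(** For countable [Y] this is measurability for the discrete sigma-algebra; the formulation by
    fibres needs no structure on [Y]. *)
Definition cmeas (Y : Type) (g : X -> Y) := forall y, measurable [set x | g x = y].

Lemma bigcupT_meas (Y : countType) (F : Y -> set X) :
  (forall y, measurable (F y)) -> measurable (\bigcup_y F y).
Proof. exact/countable_bigcupT_measurable/countableP. Qed.

Lemma meas_const (P : Prop) : measurable [set _ : X | P].
Proof.
have [p|np] := pselect P.
  by have -> : [set _ | P] = [set: X] by apply/seteqP; split.
by have -> : [set _ | P] = @set0 X by apply/seteqP; split.
Qed.

Lemma meas_and (P Q : X -> Prop) : measurable [set x | P x] ->
  measurable [set x | Q x] -> measurable [set x | P x /\ Q x].
Proof. by move=> mP mQ; apply: measurableI. Qed.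

Lemma meas_or (P Q : X -> Prop) : measurable [set x | P x] ->
  measurable [set x | Q x] -> measurable [set x | P x \/ Q x].
Proof. by move=> mP mQ; apply: measurableU. Qed.

Lemma meas_not (P : X -> Prop) : measurable [set x | P x] ->
  measurable [set x | ~ P x].
Proof. by move=> mP; apply: measurableC. Qed.

Lemma meas_imply (P Q : X -> Prop) : measurable [set x | P x] ->
  measurable [set x | Q x] -> measurable [set x | P x -> Q x].
Proof.
move=> mP mQ; have -> : [set x | P x -> Q x] = [set x | ~ P x \/ Q x].
  apply/seteqP; split => x /=; last by case.
  by have [p h|np] := pselect (P x); [right; apply: h|left].
by apply: meas_or => //; apply: meas_not.
Qed.

Lemma meas_exists (Y : countType) (P : Y -> X -> Prop) :
  (forall y, measurable [set x | P y x]) -> measurable [set x | exists y, P y x].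
Proof.
move=> mP; have -> : [set x | exists y, P y x] = \bigcup_y [set x | P y x].
  by apply/seteqP; split => x /= [y]; [exists y|move=> _; exists y].
exact: bigcupT_meas.
Qed.

Lemma meas_forall (Y : countType) (P : Y -> X -> Prop) :
  (forall y, measurable [set x | P y x]) -> measurable [set x | forall y, P y x].
Proof.
move=> mP.
have -> : [set x | forall y, P y x] = [set x | ~ exists y, ~ P y x].
  apply/seteqP; split => x /=; first by move=> h [y]; apply.
  by move=> /forallNP h y; apply: contrapT; apply: h.
by apply: meas_not; apply: meas_exists => y; apply: meas_not.
Qed.

Lemma cmeas_const Y (y : Y) : cmeas (fun=> y).
Proof. by move=> z; apply: meas_const. Qed.

(** A countably valued choice cuts the space into countably many measurable parts, on each of which
    the parameter is constant. Nearly all later measurability claims reduce to this. *)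
Lemma cmeas_bind (Y : countType) Z (g : X -> Y) (h : Y -> X -> Z) :
  cmeas g -> (forall y, cmeas (h y)) -> cmeas (fun x => h (g x) x).
Proof.
move=> mg mh z.
have -> : [set x | h (g x) x = z] = [set x | exists y, g x = y /\ h y x = z].
  apply/seteqP; split => x /=; first by exists (g x).
  by case=> y [->].
by apply: meas_exists => y; apply: meas_and; [apply: mg|apply: mh].
Qed.

Lemma cmeas_comp (Y : countType) Z (h : Y -> Z) (g : X -> Y) :
  cmeas g -> cmeas (h \o g).
Proof.
by move=> mg; apply: (@cmeas_bind Y Z g (fun y _ => h y)) => // y; apply: cmeas_const.
Qed.

Lemma cmeas_comp2 (Y1 Y2 : countType) Z (h : Y1 -> Y2 -> Z) g1 g2 :
  cmeas g1 -> cmeas g2 -> cmeas (fun x => h (g1 x) (g2 x)).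
Proof.
move=> m1 m2; apply: (@cmeas_bind Y1 Z g1 (fun y x => h y (g2 x))) => // y.
exact: (@cmeas_comp Y2 Z (h y) g2).
Qed.

Lemma meas_cpre (Y : countType) (g : X -> Y) (P : Y -> X -> Prop) :
  cmeas g -> (forall y, measurable [set x | P y x]) ->
  measurable [set x | P (g x) x].
Proof.
move=> mg mP; have := @cmeas_bind Y Prop g P mg.
have -> : [set x | P (g x) x] = [set x | exists y, g x = y /\ P y x].
  by apply/seteqP; split => x /=; [exists (g x)|case=> y [->]].
by move=> _; apply: meas_exists => y; apply: meas_and; [apply: mg|apply: mP].
Qed.

Lemma cmeas_bool (P : X -> Prop) : measurable [set x | P x] -> cmeas (fun x => `[< P x >]).
Proof.
move=> mP [].
  have -> : [set x | `[< P x >] = true] = [set x | P x].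
    by apply/seteqP; split => x /= /asboolP.
  exact: mP.
have -> : [set x | `[< P x >] = false] = [set x | ~ P x].
  by apply/seteqP; split => x /=; [move/negbT/asboolPn|move/asboolPn/negbTE].
exact: meas_not.
Qed.

Lemma cmeas_boolP (b : X -> bool) : measurable [set x | b x] -> cmeas b.
Proof.
move=> /cmeas_bool h; have -> : b = fun x => `[< b x >].
  by apply/funext => x; rewrite asboolb.
exact: h.
Qed.

Lemma cmeas_filter (Y : countType) (P : Y -> X -> bool) (s : seq Y) :
  (forall y, measurable [set x | P y x]) -> cmeas (fun x => [seq y <- s | P y x]).
Proof.
move=> mP; elim: s => [|y s IH] /=; first exact: cmeas_const.
exact: (cmeas_comp2 (fun (b : bool) t => if b then y :: t else t) (cmeas_boolP (mP y)) IH).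
Qed.

Lemma cmeas_map (Y Z : countType) (h : Y -> X -> Z) (s : seq Y) :
  (forall y, cmeas (h y)) -> cmeas (fun x => [seq h y x | y <- s]).
Proof.
move=> mh; elim: s => [|y s IH] /=; first exact: cmeas_const.
exact: (cmeas_comp2 (fun z t => z :: t) (mh y) IH).
Qed.

Lemma meas_eqc (Y : countType) (g1 g2 : X -> Y) :
  cmeas g1 -> cmeas g2 -> measurable [set x | g1 x = g2 x].
Proof.
move=> m1 m2; apply: (meas_cpre (g := g1) (P := fun y x => y = g2 x)) => // y.
by have := m2 y; congr measurable; apply/seteqP; split => x /=.
Qed.

End CountableMeasurable.

(** * Nested base maps of a separable action *)

Record zaction (d : nat) (disp : measure_display) (X : measurableType disp) := ZAction {
  act :> 'rV[int]_d -> X -> X;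
  act0 : forall x, act 0 x = x;
  actD : forall m n x, act (m + n) x = act m (act n x);
  meas_act : forall n (P : X -> Prop), measurable [set x | P x] ->
    measurable [set x | P (act n x)] }.

(** A finite measurable cover whose members are discrete at distance [R] along orbits. It contains
    freeness of the action, since a nonzero [n] with [a n x = x] would be excluded at
    [R = nrm n]. *)
Definition separable d disp (X : measurableType disp) (a : zaction d X) :=
  forall R : nat, exists (p : nat) (U : nat -> X -> Prop),
    [/\ forall i, measurable [set x | U i x],
        forall x, exists2 i, (i < p)%N & U i x
      & forall i x n, U i x -> U i (a n x) -> (nrm n <= R)%N -> n = 0].

Section Action.
Context (d : nat) (disp : measure_display) (X : measurableType disp) (a : zaction d X).
Implicit Types (n u v : 'rV[int]_d) (x y z : X).

Lemma cmeas_act (Y : Type) (g : X -> Y) n : cmeas g -> cmeas (fun x => g (a n x)).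
Proof. by move=> mg y; apply: (meas_act a n (mg y)). Qed.

Lemma cmeas_actb (Y : Type) (b : X -> 'rV[int]_d) (g : X -> Y) :
  cmeas b -> cmeas g -> cmeas (fun x => g (a (b x) x)).
Proof.
move=> mb mg; apply: (@cmeas_bind _ _ 'rV[int]_d Y b (fun n x => g (a n x))) => // n.
exact: cmeas_act.
Qed.

Lemma actN n x : a (- n) (a n x) = x.
Proof. by rewrite -actD addNr act0. Qed.

(** Greedy construction, one class [U i] at a time: a point of the class is added unless the set
    built so far is already within [R]. Points added together do not conflict, because the class is
    discrete at distance [R]. *)
Lemma maximal_discrete (R : nat) : separable a ->
  exists D : X -> Prop, [/\ measurable [set x | D x],
    forall x n, D x -> D (a n x) -> (nrm n <= R)%N -> n = 0
    & forall x, exists2 n, (nrm n <= R)%N & D (a n x)].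
Proof.
move=> /(_ R)[p [U [mU covU sepU]]].
pose D := fix D (i : nat) x : Prop := if i is j.+1 then
  D j x \/ (U j x /\ forall n, (nrm n <= R)%N -> ~ D j (a n x)) else False.
have mD i : measurable [set x | D i x].
  elim: i => [|i IH] /=; first exact: meas_const.
  apply: meas_or => //; apply: meas_and => //; apply: meas_forall => n.
  by apply: meas_imply; [exact: meas_const|apply: meas_not; exact: meas_act].
have sepD i : forall x n, D i x -> D i (a n x) -> (nrm n <= R)%N -> n = 0.
  elim: i => [|i IH] x n //=; case=> [Dx|[Ux nDx]]; case=> [Dn|[Un nDn]] hn.
  - exact: IH Dx Dn hn.
  - by case: (nDn (- n)); rewrite ?nrmN ?actN.
  - by case: (nDx n hn).
  - exact: sepU Ux Un hn.
have sub i j x : (i <= j)%N -> D i x -> D j x.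
  by move=> /subnK <-; elim: (j - i)%N => [|k IH] //= h; left; apply: IH.
exists (D p); split; [exact: mD|exact: sepD|move=> x]; have [i ip Ux] := covU x.
have [h|h] := pselect (exists2 n, (nrm n <= R)%N & D i (a n x)).
  by case: h => n hn Dn; exists n => //; apply: sub Dn; apply: ltnW.
exists 0; rewrite ?nrm0 //; apply: (sub i.+1) => //; rewrite act0 /=; right; split=> //.
by move=> n hn Dn; apply: h; exists n.
Qed.

(** The points [x] and [a n x] have the same base point, expressed through displacements rather than
    points. *)
Definition same (b : X -> 'rV[int]_d) n x : Prop := b x = b (a n x) + n.

Section Base.
Hypothesis sep : separable a.
(** Ratio 8 leaves room for the jumps: a displacement of at most [h m / 2] followed by one of at
    most [2 * h m] stays below [h m.+1 / 2]. *)
Let h (m : nat) : nat := (4 * 8 ^ m)%N.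
Let h_gt0 (m : nat) : (0 < h m)%N. Proof. by rewrite muln_gt0 expn_gt0. Qed.
Let hS (m : nat) : h m.+1 = (8 * h m)%N. Proof. by rewrite /h expnS; lia. Qed.

Let D (m : nat) : X -> Prop := projT1 (cid (maximal_discrete (8 * h m) sep)).
Let DP m : [/\ measurable [set x | D m x],
    forall x n, D m x -> D m (a n x) -> (nrm n <= 8 * h m)%N -> n = 0
    & forall x, exists2 n, (nrm n <= 8 * h m)%N & D m (a n x)].
Proof. exact: projT2 (cid (maximal_discrete (8 * h m) sep)). Qed.

(** [D m] is only dense at distance [8 * h m], too far for a jump. Dividing the coordinates of a
    displacement by [h m] shows that one of its translates by multiples of [h m], with an index in
    [boxs d 8], comes within [h m] of a given point. *)
Let C (i : 'rV[int]_d) m y : Prop := D m (a (i *+ h m) y).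

Let near i K m z : Prop := exists n, (nrm n <= h m + K)%N /\ C i m (a n z).

(** The slack [K], independent of the scale, makes the property invariant along orbits, so that one
    index serves a whole orbit. *)
Let inv_often i z : Prop :=
  exists K : nat, forall N : nat, exists m : nat, (N <= m)%N /\ near i K m z.

Let meas_C i m : measurable [set y | C i m y].
Proof. by apply: meas_act; case: (DP m). Qed.

Let meas_inv_often i : measurable [set z | inv_often i z].
Proof.
apply: meas_exists => K; apply: meas_forall => N; apply: meas_exists => m.
apply: meas_and; first exact: meas_const.
apply: meas_exists => n; apply: meas_and; first exact: meas_const.
exact: meas_act.
Qed.

Let inv_often_act i z n : inv_often i z -> inv_often i (a n z).
Proof.
case=> K hK; exists (K + nrm n)%N => N; have [m [Nm [u [hu Cu]]]] := hK N.
exists m; split=> //; exists (u - n); split.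
  by apply: leq_trans (nrmB _ _) _; lia.
by rewrite -actD subrK.
Qed.

Let near_some m z : exists2 i, i \in boxs d 8 & near i 0 m z.
Proof.
have [_ _ /(_ z)[n hn Dn]] := DP m.
pose i : 'rV[int]_d := \row_j divz (n 0 j) (h m).
exists i.
  rewrite mem_boxs; apply/nrm_leP => j; rewrite rvE.
  have := nrm_coord n j; have := h_gt0 m; move: (n 0 j) hn => c; nia.
exists (n - i *+ h m); split; last by rewrite /C -actD addrC subrK.
rewrite addn0; apply/nrm_leP => j; rewrite rvB.
have -> : (i *+ h m) 0 j = divz (n 0 j) (h m) * h m.
  by rewrite mulmxnE rvE -mulr_natr natz.
have := h_gt0 m; move: (n 0 j) => c; nia.
Qed.

Let inv_often_some z : exists2 i, i \in boxs d 8 & inv_often i z.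
Proof.
apply: contrapT => H.
have {}H i : i \in boxs d 8 -> exists N : nat, forall m, (N <= m)%N -> ~ near i 0 m z.
  move=> hi; apply: contrapT => H2; apply: H; exists i => //; exists 0%N => N.
  apply: contrapT => H3; apply: H2; exists N => m Nm nm; apply: H3.
  by exists m.
have [N HN] : exists N : nat, forall i, i \in boxs d 8 -> forall m, (N <= m)%N -> ~ near i 0 m z.
  elim: (boxs d 8) H => [|i s IH] H; first by exists 0%N.
  have [j|N1 h1] := IH; first by move=> js; apply: H; rewrite inE js orbT.
  have [|N2 h2] := H i; first by rewrite inE eqxx.
  exists (maxn N1 N2) => j; rewrite inE => /orP[/eqP ->|js] m; rewrite geq_max => /andP[m1 m2].
    exact: h2.
  exact: h1.
have [i hi ni] := near_some N z.
exact: HN hi N (leqnn _) ni.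
Qed.

Let idx z : 'rV[int]_d := head 0 [seq i <- boxs d 8 | `[< inv_often i z >]].

Let idxP z : inv_often (idx z) z.
Proof.
rewrite /idx; have [i hi hz] := inv_often_some z.
have : i \in [seq i <- boxs d 8 | `[< inv_often i z >]].
  by rewrite mem_filter hi andbT; apply/asboolP.
case E : [seq i <- _ | _] => [//|j s] _ /=.
have : j \in [seq i <- boxs d 8 | `[< inv_often i z >]] by rewrite E inE eqxx.
by rewrite mem_filter => /andP[/asboolP].
Qed.

Let idx_act n z : idx (a n z) = idx z.
Proof.
rewrite /idx; congr head; apply: eq_filter => i; apply/asboolP/asboolP => H.
  by rewrite -(actN n z); apply: inv_often_act.
exact: inv_often_act.
Qed.

Let cmeas_idx : cmeas idx.
Proof.
apply: (cmeas_comp (head (0 : 'rV[int]_d))); apply: cmeas_filter => i.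
have -> : [set x | `[< inv_often i x >]] = [set x | inv_often i x].
  by apply/seteqP; split => x /= /asboolP.
exact: meas_inv_often.
Qed.

Let CC m z : Prop := C (idx z) m z.

Let meas_CC m : measurable [set z | CC m z].
Proof. exact: (meas_cpre cmeas_idx (P := fun i z => C i m z)). Qed.

Let CC_sep m z n : CC m z -> CC m (a n z) -> (nrm n <= 8 * h m)%N -> n = 0.
Proof.
rewrite /CC idx_act /C -actD addrC actD => h1 h2 hn.
by have [_ sepD _] := DP m; apply: sepD h1 h2 hn.
Qed.

(** At most one displacement qualifies: two of them would differ by at most [4 * h m], below the
    separation [8 * h m]. The default 0 leaves a base point with no such neighbour in place. *)
Let jump m z : 'rV[int]_d := head 0 [seq n <- boxs d (2 * h m) | `[< CC m (a n z) >]].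

Let jumpE m z n : (nrm n <= 2 * h m)%N -> CC m (a n z) -> jump m z = n.
Proof.
move=> hn Cn; rewrite /jump.
have : n \in [seq n <- boxs d (2 * h m) | `[< CC m (a n z) >]].
  by rewrite mem_filter mem_boxs hn andbT; apply/asboolP.
case E : [seq i <- _ | _] => [//|j s] _ /=.
have : j \in [seq n <- boxs d (2 * h m) | `[< CC m (a n z) >]] by rewrite E inE eqxx.
rewrite mem_filter mem_boxs => /andP[/asboolP Cj hj].
apply/eqP; rewrite -subr_eq0; apply/eqP.
apply: (CC_sep (m := m) (z := a n z)) => //; first by rewrite -actD subrK.
by apply: leq_trans (nrmB _ _) _; lia.
Qed.

Let nrm_jump m z : (nrm (jump m z) <= 2 * h m)%N.
Proof.
rewrite /jump; case E : [seq i <- _ | _] => [|j s] /=; first by rewrite nrm0.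
have : j \in [seq n <- boxs d (2 * h m) | `[< CC m (a n z) >]] by rewrite E inE eqxx.
by rewrite mem_filter mem_boxs => /andP[].
Qed.

Let cmeas_jump m : cmeas (jump m).
Proof.
apply: (cmeas_comp (head (0 : 'rV[int]_d))); apply: cmeas_filter => n.
have -> : [set x | `[< CC m (a n x) >]] = [set x | CC m (a n x)].
  by apply/seteqP; split => x /= /asboolP.
exact: meas_act.
Qed.

Let b := fix b (m : nat) z : 'rV[int]_d :=
  if m is k.+1 then jump k (a (b k z) z) + b k z else 0.

Let nrm_b m z : (2 * nrm (b m z) <= h m)%N.
Proof.
elim: m => [|m IH] /=; first by rewrite nrm0.
by rewrite hS; have := nrmD (jump m (a (b m z) z)) (b m z); have := nrm_jump m (a (b m z) z); lia.
Qed.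

(* Clusters are merged by their base points: at stage m every current base point
   within 2 h_m of the sparse set CC m moves there. Each point is infinitely often
   within h_m + K of CC m (pigeonhole over boundedly many shifts), so it and any
   prescribed neighbour are eventually moved together. *)
Lemma exists_base : exists b : nat -> X -> 'rV[int]_d, [/\ forall m, cmeas (b m),
   forall m n x, same (b m) n x -> same (b m.+1) n x
 & forall x n, exists m, same (b m) n x].
Proof.
exists b; split.
- elim=> [|m IH] /=; first exact: cmeas_const.
  apply: (cmeas_comp2 (fun u v : 'rV[int]_d => u + v)) => //.
  exact: cmeas_actb.
- move=> m n x; rewrite /same /= => e.
  have -> : a (b m (a n x)) (a n x) = a (b m x) x by rewrite -actD -e.
  by rewrite -addrA -e.
(* The scale is taken so large that [h m] absorbs the slack [K] and the displacement [n]; both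
   points then jump to the same point of [CC m]. *)
move=> x n; have [K hK] := idxP x; have [m [Nm [u [hu Cu]]]] := hK (2 * (K + nrm n))%N.
have hm : (2 * (K + nrm n) <= h m)%N.
  by apply: leq_trans Nm _; rewrite /h; have := ltn_expl m (isT : 1 < 8)%N; lia.
have step y v : (nrm v <= h m + K + nrm n)%N -> CC m (a v y) -> b m.+1 y = v.
  move=> hv Cv /=; rewrite (jumpE (n := v - b m y)) ?subrK //.
    by apply: leq_trans (nrmB _ _) _; have := nrm_b m y; lia.
  by rewrite -actD subrK.
exists m.+1; rewrite /same (step x u) ?(step (a n x) (u - n)) ?subrK //.
- by apply: leq_trans (nrmB _ _) _; lia.
- by rewrite /CC -actD subrK idx_act.
- by apply: leq_trans hu _; lia.
- by rewrite /CC idx_act.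
Qed.

End Base.

Lemma same_le (b : nat -> X -> 'rV[int]_d) :
  (forall m n x, same (b m) n x -> same (b m.+1) n x) ->
  forall k m n x, (k <= m)%N -> same (b k) n x -> same (b m) n x.
Proof.
move=> bS k m n x /subnK <-; elim: (m - k)%N => [|j IH] // /IH; exact: bS.
Qed.

End Action.

(** * Bounded real flows *)

Lemma cvgn_sum (R : realType) (I : Type) (s : seq I) (u : I -> nat -> R) (l : I -> R) :
  (forall i, u i @ \oo --> l i) -> (fun n => \sum_(i <- s) u i n) @ \oo --> \sum_(i <- s) l i.
Proof.
move=> ul; elim: s => [|i s IH].
  rewrite big_nil; have -> : (fun n => \sum_(i <- [::]) u i n) = fun=> 0.
    by apply/funext => n; rewrite big_nil.
  exact: cvg_cst.
rewrite big_cons; have -> : (fun n => \sum_(j <- i :: s) u j n) =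
    (fun n => u i n + \sum_(j <- s) u j n).
  by apply/funext => n; rewrite big_cons.
exact: cvgD.
Qed.

Section RealFlow.
Context (d : nat) (disp : measure_display) (X : measurableType disp) (a : zaction d X).
Context (R : realType) (f : X -> R) (C : R).
Hypothesis mf : measurable_fun setT f.
Hypothesis hf : forall x j,
  `|\sum_(v <- cube d (2 ^ j)) f (a v x)| <= C * 2 ^+ (j * d) / 4 ^+ j.

Let L (j m : nat) (i : 'I_d) : nat := if (i < m)%N then (2 ^ j.+1)%N else (2 ^ j)%N.

(* The boxes interpolate between the cubes of sides 2^j and 2^(j+1). *)
Let F (j m : nat) x : R :=
  (2 ^+ (j * d + m))^-1 * \sum_(v <- boxL (enum 'I_d) (L j m)) f (a v x).

Let F00 x : F 0 0 x = f x.
Proof.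
rewrite /F mul0n expr0 invr1 mul1r.
suff -> : boxL (enum 'I_d) (L 0 0) = [:: 0] by rewrite big_seq1 act0.
by elim: (enum _) => //= i s ->; rewrite /= mulr0n addr0.
Qed.

Let FS j x : F j d x = F j.+1 0 x.
Proof.
rewrite /F addn0 mulSnr; congr (_ * _); congr bigop.
have -> // : L j d = L j.+1 0.
by apply/funext => i; rewrite /L ltn_ord ltn0.
Qed.

Let F_half j (i : 'I_d) x : F j i.+1 x = (F j i x + F j i (a (unitv i *+ 2 ^ j) x)) / 2.
Proof.
rewrite /F addnS exprS invfM.
rewrite (big_boxL_double (fun v => f (a v x)) (L := L j i) (i := i)) ?enum_uniq ?mem_enum //.
- rewrite big_split /= -mulrA [RHS]mulrC -mulrDr; congr (_ * (_ * (_ + _))).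
  by apply: eq_bigr => v _; rewrite /L ltnn -actD.
- by rewrite /L ltnS leqnn ltnn expnS.
- by move=> k; rewrite -val_eqE /= => /negbTE ki; rewrite /L ltnS leq_eqVlt ki.
Qed.

Let F_le j m x : (m <= d)%N -> `|F j m x| <= C / 4 ^+ j.
Proof.
elim: m x => [|m IH] x md.
  rewrite /F addn0 normrM normfV normrX ger0_norm // mulrC ler_pdivrMr ?exprn_gt0 //.
  rewrite -mulrA [_^-1 * _]mulrC mulrA; have := hf x j; rewrite /cube.
  by have -> : L j 0 = fun=> (2 ^ j)%N by apply/funext => i; rewrite /L ltn0.
have /= -> := F_half j (Ordinal md) x.
have h1 := IH x (ltnW md); have h2 := IH (a (unitv (Ordinal md) *+ 2 ^ j) x) (ltnW md).
rewrite normrM [`|2^-1|]ger0_norm ?invr_ge0 // ler_pdivrMr //.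
apply: le_trans (ler_normD _ _) _; lra.
Qed.

(** The flow that replaces [F j i] by its mean over two points at distance [2 ^ j] in direction [i]:
    its difference telescopes along the segment between them. It has [2 ^ j] terms of size at most
    [C / 4 ^ j], hence decays geometrically. *)
Let h (i : 'I_d) (j : nat) x : R :=
  2^-1 * \sum_(l < 2 ^ j) F j i (a (unitv i *+ l) x).

Let h_div i j x : h i j x - h i j (a (unitv i) x) = F j i x - F j i.+1 x.
Proof.
rewrite F_half /h -mulrBr.
have -> : \sum_(l < 2 ^ j) F j i (a (unitv i *+ l) (a (unitv i) x)) =
    \sum_(l < 2 ^ j) F j i (a (unitv i *+ l.+1) x).
  by apply: eq_bigr => l _; rewrite -actD -mulrSr.
set g := fun l : nat => F j i (a (unitv i *+ l) x).
have -> : \sum_(l < 2 ^ j) F j i (a (unitv i *+ l) x) -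
    \sum_(l < 2 ^ j) F j i (a (unitv i *+ l.+1) x) = g 0%N - g (2 ^ j)%N.
  rewrite -sumrB -[RHS]opprB -(telescope_sumr g (leq0n _)) big_mkord -sumrN.
  by apply: eq_bigr => l _; rewrite opprB.
by rewrite /g mulr0n act0; lra.
Qed.

Let C_ge0 (x : X) : 0 <= C.
Proof.
have := hf x 0; rewrite mul0n !expr0 invr1 !mulr1; exact: le_trans.
Qed.

Let h_le i j x : `|h i j x| <= C / 2 * (2^-1) ^+ j.
Proof.
rewrite /h normrM [`|2^-1|]ger0_norm ?invr_ge0 //.
have : `|\sum_(l < 2 ^ j) F j i (a (unitv i *+ l) x)| <= \sum_(l < 2 ^ j) (C / 4 ^+ j).
  apply: le_trans (ler_norm_sum _ _ _) _; apply: ler_sum => l _.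
  by apply: F_le; apply: ltnW.
rewrite sumr_const card_ord -[(C / _) *+ _]mulr_natr natrX => hle.
have -> : C / 2 * 2^-1 ^+ j = 2^-1 * (C / 4 ^+ j * 2 ^+ j).
  have -> : (4 : R) = 2 * 2 by ring.
  rewrite exprMn exprVn; field.
  by rewrite expf_neq0.
by apply: ler_wpM2l => //; rewrite invr_ge0.
Qed.

Let S i n x : R := \sum_(0 <= j < n) h i j x.

Let S_le i n x : `|S i n x| <= C.
Proof.
apply: le_trans (_ : C * (1 - (2^-1) ^+ n) <= _); last first.
  by rewrite ler_piMr ?(C_ge0 x) // lerBlDr lerDl exprn_ge0 // invr_ge0.
elim: n => [|n IH]; first by rewrite /S big_geq // normr0 expr0 subrr mulr0.
rewrite /S big_nat_recr //=; apply: le_trans (ler_normD _ _) _.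
apply: le_trans (lerD IH (h_le i n x)) _; rewrite exprS; lra.
Qed.

Let S_cvg i x : cvgn (fun n => S i n x).
Proof.
have : cvgn [series h i j x]_j; last by [].
apply: normed_cvg; apply: (@series_le_cvg _ _ (fun j => C / 2 * (2^-1) ^+ j)).
- by move=> n /=.
- by move=> n; rewrite mulr_ge0 ?exprn_ge0 ?invr_ge0 ?divr_ge0 ?(C_ge0 x).
- by move=> n; apply: h_le.
- by apply: is_cvg_geometric_series; rewrite ger0_norm ?invr_ge0 //; lra.
Qed.

Let meas_F j m : measurable_fun setT (F j m).
Proof.
apply: measurable_funM; first exact: measurable_cst.
apply: measurable_sum => v; apply: (measurableT_comp mf).
by move=> _ Y mY; rewrite setTI; exact: (meas_act a v (P := Y)).
Qed.

Let meas_fact (g : X -> R) v : measurable_fun setT g -> measurable_fun setT (fun x => g (a v x)).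
Proof.
move=> mg; apply: (measurableT_comp mg) => _ Y mY; rewrite setTI.
exact: (meas_act a v (P := Y)).
Qed.

Let meas_S i n : measurable_fun setT (S i n).
Proof.
apply: measurable_sum => j; apply: measurable_funM; first exact: measurable_cst.
apply: measurable_sum => l; exact: meas_fact.
Qed.

(** The divergences telescope over directions and scales: after [n] rounds they add up to [f] minus
    its average over a cube of side [2 ^ n], and this average tends to 0. *)
Lemma exists_real_flow : exists phi : 'I_d -> X -> R,
  [/\ forall i, measurable_fun setT (phi i),
      forall i x, `|phi i x| <= C
    & forall x, f x = \sum_i (phi i x - phi i (a (unitv i) x))].
Proof.
pose phi i x := limn (fun n => S i n x).
have phiP i x : (fun n => S i n x) @ \oo --> phi i x by exact: S_cvg.
exists phi; split.
- by move=> i; apply: (measurable_fun_cvg (h := S i)) => //.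
- move=> i x; have : (fun n => `|S i n x|) @ \oo --> `|phi i x| by apply: cvg_norm.
  move=> /cvg_lim <- //; apply: limr_le.
    by apply/cvg_ex; exists `|phi i x|; apply: cvg_norm.
  by apply: nearW => n; apply: S_le.
move=> x.
have E n : \sum_i (S i n x - S i n (a (unitv i) x)) = f x - F n 0 x.
  elim: n => [|n IH].
    by rewrite F00 subrr big1 // => i _; rewrite /S !big_geq // subrr.
  have -> : f x - F n.+1 0 x = f x - F n 0 x + (F n 0 x - F n d x).
    by rewrite FS addrA subrK.
  rewrite -IH -[F n 0 x - F n d x]opprB -(telescope_sumr (fun m => F n m x) (leq0n _)).
  rewrite big_mkord -sumrN -big_split /=; apply: eq_bigr => i _.
  rewrite /S !big_nat_recr //= opprD addrACA; congr (_ + _).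
  by rewrite h_div opprB.
have l1 : (fun n => f x - F n 0 x) @ \oo --> \sum_i (phi i x - phi i (a (unitv i) x)).
  have -> : (fun n => f x - F n 0 x) = (fun n => \sum_i (S i n x - S i n (a (unitv i) x))).
    by apply/funext => n; rewrite E.
  apply: (cvgn_sum (u := fun i n => S i n x - S i n (a (unitv i) x))) => i.
  by apply: cvgB; apply: phiP.
have l2 : (fun n => f x - F n 0 x) @ \oo --> f x - 0.
  apply: cvgB; first exact: cvg_cst.
  have g0 : (fun n => C * (4^-1) ^+ n) @ \oo --> 0.
    by apply: cvg_geometric; rewrite ger0_norm ?invr_ge0 //; lra.
  apply/cvgr0Pnorm_lt => e e0; near=> n.
  apply: le_lt_trans (F_le n x (leq0n _)) _; rewrite -exprVn.
  apply: le_lt_trans (ler_norm _) _; near: n.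
  by move/cvgr0Pnorm_lt : g0; apply.
rewrite -(cvg_lim _ l1) // -[LHS]subr0; apply/esym/cvg_lim => //.
Unshelve. all: by end_near. Qed.

End RealFlow.

(** * Chains on Z^d with coefficients in an abelian group *)

Lemma subr_subACA (V : zmodType) (a b c e : V) : a - b - (c - e) = a - c - (b - e).
Proof. by rewrite !opprB addrACA [RHS]addrACA [- b - c]addrC. Qed.

Section DifferenceCalculus.
Context (d : nat) (V : zmodType).
Local Notation Z := 'rV[int]_d.
Local Notation G := (Z -> V).
Implicit Types (n u : Z) (g : G) (i j : 'I_d).

Definition setc i n (c : int) : Z := \row_j (if j == i then c else n 0 j).

Lemma setcE i n c j : setc i n c 0 j = if j == i then c else n 0 j.
Proof. by rewrite mxE. Qed.

Lemma setc_id i n : setc i n (n 0 i) = n.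
Proof. by apply/rowP => j; rewrite setcE; case: eqP => // ->. Qed.

Lemma setc_unit i n c : setc i n c + unitv i = setc i n (c + 1).
Proof.
apply/rowP => j; rewrite rvD !setcE unitvE eq_sym.
by case: eqP => // _; rewrite addr0.
Qed.

Lemma setcD_unit i n c : setc i (n + unitv i) c = setc i n c.
Proof.
apply/rowP => j; rewrite !setcE rvD unitvE [i == j]eq_sym.
by case: eqP => // _; rewrite addr0.
Qed.

Lemma setc_unit_neq i j n c : i != j -> setc i (n + unitv j) c = setc i n c + unitv j.
Proof.
move=> ij; apply/rowP => k; rewrite rvD !setcE rvD unitvE.
by case: (eqVneq k i) => [->|//]; rewrite eq_sym (negbTE ij) addr0.
Qed.

(* The operators are locked: unification must not see through a sum of functions. *)
Fact operator_key : unit. Proof. exact: tt. Qed.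
Definition Dv i : G -> G := locked_with operator_key (fun g n => g n - g (n + unitv i)).

Lemma DvE i g n : Dv i g n = g n - g (n + unitv i).
Proof. by rewrite /Dv unlock. Qed.

Lemma Dv_is_additive i : zmod_morphism (Dv i).
Proof. by move=> f g; apply/funext => n; rewrite -[RHS]/(Dv i f n - Dv i g n) !DvE !fctE subr_subACA. Qed.
HB.instance Definition _ i := GRing.isZmodMorphism.Build G G (Dv i) (Dv_is_additive i).

(** The constant of integration in direction [i]. *)
Definition ev0 i : G -> G := locked_with operator_key (fun g n => g (setc i n 0)).

Lemma ev0E i g n : ev0 i g n = g (setc i n 0).
Proof. by rewrite /ev0 unlock. Qed.

Lemma ev0_is_additive i : zmod_morphism (ev0 i).
Proof. by move=> f g; apply/funext => n; rewrite -[RHS]/(ev0 i f n - ev0 i g n) !ev0E. Qed.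
HB.instance Definition _ i := GRing.isZmodMorphism.Build G G (ev0 i) (ev0_is_additive i).

(** The right inverse of [Dv i] that vanishes on the hyperplane where the [i]-th coordinate is 0.
    The two branches sum from that hyperplane on its two sides. *)
Definition Iv i : G -> G := locked_with operator_key (fun g n =>
  match n 0 i with
  | Posz l => - \sum_(0 <= k < l) g (setc i n k%:Z)
  | Negz l => \sum_(0 <= k < l.+1) g (setc i n (- k.+1%:Z))
  end).

Lemma IvE i g n : Iv i g n = match n 0 i with
  | Posz l => - \sum_(0 <= k < l) g (setc i n k%:Z)
  | Negz l => \sum_(0 <= k < l.+1) g (setc i n (- k.+1%:Z))
  end.
Proof. by rewrite /Iv unlock. Qed.

Lemma Iv_is_additive i : zmod_morphism (Iv i).
Proof.
move=> f g; apply/funext => n; rewrite -[RHS]/(Iv i f n - Iv i g n) !IvE.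
case: (n 0 i) => l; last by rewrite -sumrB; apply: eq_bigr.
by rewrite -opprD -sumrB.
Qed.
HB.instance Definition _ i := GRing.isZmodMorphism.Build G G (Iv i) (Iv_is_additive i).

Lemma Dv_Iv i g : Dv i (Iv i g) = g.
Proof.
apply/funext => n; rewrite DvE !IvE rvD unitvE eqxx.
have := setc_id i n; case E : (n 0 i) => [l|l] hn.
  rewrite (_ : Posz l + _ = Posz l.+1); last by lia.
  rewrite opprK big_nat_recr //= setcD_unit hn addrA.
  have -> : \sum_(0 <= k < l) g (setc i (n + unitv i) k) = \sum_(0 <= k < l) g (setc i n k).
    by apply: eq_bigr => k _; rewrite setcD_unit.
  by rewrite addNr add0r.
rewrite NegzE in hn; case: l E hn => [|l] E hn.
  rewrite (_ : Negz 0 + _ = Posz 0); last by lia.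
  by rewrite big_nat1 hn big_geq // oppr0 subr0.
rewrite (_ : Negz l.+1 + _ = Negz l); last by lia.
rewrite big_nat_recr //= hn.
have -> : \sum_(0 <= k < l.+1) g (setc i (n + unitv i) (- k.+1%:Z)) =
    \sum_(0 <= k < l.+1) g (setc i n (- k.+1%:Z)).
  by apply: eq_bigr => k _; rewrite setcD_unit.
by rewrite addrAC subrr add0r.
Qed.

Lemma Iv_Dv i g : Iv i (Dv i g) = g - ev0 i g.
Proof.
apply/funext => n; rewrite -[RHS]/(g n - ev0 i g n) ev0E IvE.
have := setc_id i n; case E : (n 0 i) => [l|l] hn.
  have /= T := telescope_sumr (fun k : nat => g (setc i n k%:Z)) (leq0n l).
  have -> : g n = g (setc i n l%:Z) by rewrite hn.
  rewrite -[setc i n 0]/(setc i n 0%:Z) -T -sumrN; apply: eq_bigr => k _.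
  by rewrite DvE setc_unit opprB -PoszD addn1.
rewrite NegzE in hn.
have /= T := telescope_sumr (fun k : nat => g (setc i n (- k%:Z))) (leq0n l.+1).
have -> : g n = g (setc i n (- l.+1%:Z)) by rewrite hn.
rewrite -[setc i n 0]/(setc i n (- 0%:Z)) -T; apply: eq_bigr => k _; rewrite DvE setc_unit; congr (_ - g (setc i n _)); lia.
Qed.

Lemma Dv_Iv_comm i j g : i != j -> Dv j (Iv i g) = Iv i (Dv j g).
Proof.
move=> ij; apply/funext => n; rewrite DvE !IvE rvD unitvE eq_sym (negbTE ij) addr0.
case: (n 0 i) => l.
  rewrite -opprD -sumrN -big_split /=; congr (- _); apply: eq_bigr => k _.
  by rewrite setc_unit_neq // DvE.
by rewrite -sumrB; apply: eq_bigr => k _; rewrite setc_unit_neq // DvE.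
Qed.

Lemma Dv_comm i j g : Dv i (Dv j g) = Dv j (Dv i g).
Proof.
apply/funext => n; rewrite !DvE subr_subACA; congr (_ - _ - (_ - g _)).
by rewrite addrAC.
Qed.

Lemma Dv_ev0 i g : Dv i (ev0 i g) = 0.
Proof. by apply/funext => n; rewrite DvE !ev0E setcD_unit subrr. Qed.

End DifferenceCalculus.

(** * Filling cycles in a truncated Koszul complex *)

Section Koszul.
Context (d : nat) (i0 i1 i2 : 'I_d).
Hypotheses (n01 : i1 != i0) (n02 : i2 != i0) (n12 : i2 != i1).
Let n10 : i0 != i1. Proof. by rewrite eq_sym. Qed.
Let n20 : i0 != i2. Proof. by rewrite eq_sym. Qed.
Let n21 : i1 != i2. Proof. by rewrite eq_sym. Qed.

Definition other (i : 'I_d) := (i != i0) && (i != i1).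

Section Algebra.
Context (V : zmodType).
Local Notation G := ('rV[int]_d -> V).
Implicit Types (th eta : 'I_d -> G).

(* 2-chains without components in the planes (i, j) with i, j both different from
   i0 and i1: the entries are the (i0, i)-, the (i1, i)- and the (i0, i1)-components. *)
Definition chain2 := (('I_d -> G) * ('I_d -> G) * G)%type.
HB.instance Definition _ := GRing.Zmodule.on chain2.
Implicit Types (w : chain2).

Definition bdry w : 'I_d -> G := fun i =>
  if i == i0 then Dv i1 w.2 - \sum_(j | other j) Dv j (w.1.1 j)
  else if i == i1 then - Dv i0 w.2 - \sum_(j | other j) Dv j (w.1.2 j)
  else Dv i0 (w.1.1 i) + Dv i1 (w.1.2 i).

Definition bdry3 eta : chain2 :=
  (fun i => Dv i1 (eta i), fun i => - Dv i0 (eta i), \sum_(j | other j) Dv j (eta j)).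

(** Integrating in direction [i0] accounts for all components other than [i0] and [i1]. What remains
    is a divergence-free flow in the plane of [i0] and [i1], and the last entry is its stream
    function. *)
Definition fill1 th : chain2 :=
  (fun i => Iv i0 (th i), fun=> 0,
   Iv i1 (ev0 i0 (th i0 + \sum_(j | other j) Dv j (Iv i0 (th j)))) - Iv i0 (th i1)).

(** Poincaré lemma in the plane of [i0] and [i1]: when [w] is a cycle, this function has the
    prescribed differences in both directions. *)
Definition fill2_ w i : G := Iv i1 (ev0 i0 (w.1.1 i)) - Iv i0 (w.1.2 i).

(** The part of the [(i0, i1)]-entry not yet filled is annihilated by [Dv i0] and [Dv i1].
    Integrating it in the third direction [i2] therefore leaves the other entries correct; this is
    where a rank above 2 enters. *)
Definition fill2 w i : G := fill2_ w i +
  if i == i2 then Iv i2 (w.2 - \sum_(j | other j) Dv j (fill2_ w j)) else 0.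

Lemma bdryB w w' i : bdry (w - w') i = bdry w i - bdry w' i.
Proof.
have eS (f g : 'I_d -> G) : \sum_(j | other j) Dv j ((f - g) j) =
    \sum_(j | other j) Dv j (f j) - \sum_(j | other j) Dv j (g j).
  by rewrite -sumrB; apply: eq_bigr => j _; rewrite -raddfB.
rewrite /bdry; case: ifP => _; [|case: ifP => _].
- by rewrite eS (raddfB (Dv i1)) subr_subACA.
- by rewrite eS (raddfB (Dv i0)) [X in X - _]opprD [LHS]subr_subACA.
- by rewrite (raddfB (Dv i0)) (raddfB (Dv i1)) addrACA opprD.
Qed.

Lemma bdryD w w' i : bdry (w + w') i = bdry w i + bdry w' i.
Proof.
have b0 : bdry 0 i = 0 by rewrite -(subrr (0 : chain2)) bdryB subrr.
have bN : bdry (- w') i = - bdry w' i by rewrite -[- w']sub0r bdryB b0 sub0r.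
by rewrite -[w' in LHS]opprK bdryB bN opprK.
Qed.

Lemma bdry_bdry3 eta i : bdry (bdry3 eta) i = 0.
Proof.
rewrite /bdry /=; case: ifP => _; [|case: ifP => _].
- by rewrite (raddf_sum (Dv i1)) -sumrB big1 // => j _; rewrite Dv_comm subrr.
- rewrite (raddf_sum (Dv i0)) /= -sumrN -sumrB big1 // => j _.
  by rewrite (raddfN (Dv j)) /= opprK Dv_comm addNr.
- by rewrite (raddfN (Dv i1)) /= Dv_comm subrr.
Qed.

Lemma big_other (F : 'I_d -> G) : \sum_i F i = F i0 + (F i1 + \sum_(j | other j) F j).
Proof. by rewrite (bigD1 i0) //= (bigD1 i1). Qed.

Lemma otherP j : other j -> (i0 != j) * (i1 != j) * ((j == i0) = false) * ((j == i1) = false).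
Proof. by case/andP => /negbTE h0 /negbTE h1; rewrite ![_ == j]eq_sym h0 h1. Qed.

Lemma div_bdry w : \sum_i Dv i (bdry w i) = 0.
Proof.
rewrite big_other /bdry eqxx (negbTE n01) eqxx.
have -> : \sum_(j | other j) Dv j (if j == i0 then Dv i1 w.2 - \sum_(j | other j) Dv j (w.1.1 j)
      else if j == i1 then - Dv i0 w.2 - \sum_(j | other j) Dv j (w.1.2 j)
      else Dv i0 (w.1.1 j) + Dv i1 (w.1.2 j)) =
    \sum_(j | other j) Dv i0 (Dv j (w.1.1 j)) + \sum_(j | other j) Dv i1 (Dv j (w.1.2 j)).
  rewrite -big_split /=; apply: eq_bigr => j oj; rewrite !(otherP oj) raddfD.
  by rewrite /= Dv_comm [X in _ + X]Dv_comm.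
rewrite -(raddf_sum (Dv i0)) -(raddf_sum (Dv i1)) (raddfB (Dv i0)) (raddfB (Dv i1)).
rewrite (raddfN (Dv i1)) /= Dv_comm.
set x := Dv i1 (Dv i0 _); set y := Dv i0 _; set z := Dv i1 _.
by rewrite [y + z]addrC [X in _ + X]addrA subrK addrACA subrr addNr addr0.
Qed.

Lemma bdry_fill1 th : \sum_i Dv i (th i) = 0 -> bdry (fill1 th) = th.
Proof.
rewrite big_other => divth; apply/funext => i; rewrite /bdry /=.
set r := th i0 + _.
have Dr : Dv i0 r = - Dv i1 (th i1).
  apply/eqP; rewrite -addr_eq0 -divth /r (raddfD (Dv i0)) (raddf_sum (Dv i0)) /=.
  rewrite [X in _ + X + _](_ : _ = \sum_(j | other j) Dv j (th j)).
    by rewrite -addrA [_ + Dv i1 _]addrC.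
  by apply: eq_bigr => j _; rewrite Dv_comm Dv_Iv.
case: eqP => [->|_]; [|case: eqP => [->|_]].
- rewrite (raddfB (Dv i1)) /= Dv_Iv Dv_Iv_comm // -[Dv i1 (th i1)]opprK -Dr (raddfN (Iv i0)) /= opprK Iv_Dv.
  by rewrite addrC [ev0 i0 r + _]addrC subrK /r addrC addrK.
- rewrite (raddfB (Dv i0)) /= Dv_Iv Dv_Iv_comm // Dv_ev0 (raddf0 (Iv i1)) sub0r opprK.
  by rewrite big1 ?subr0 // => j _; rewrite (raddf0 (Dv j)).
- by rewrite Dv_Iv (raddf0 (Dv i1)) addr0.
Qed.

Lemma fill2_E w : (forall i, bdry w i = 0) ->
  (forall i, other i -> w.1.1 i = Dv i1 (fill2 w i) /\ w.1.2 i = - Dv i0 (fill2 w i)) /\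
  w.2 = \sum_(j | other j) Dv j (fill2 w j).
Proof.
move=> hw; pose h := w.2 - \sum_(j | other j) Dv j (fill2_ w j).
have E0 i : other i -> Dv i0 (fill2_ w i) = - w.1.2 i.
  by move=> oi; rewrite (raddfB (Dv i0)) /= Dv_Iv Dv_Iv_comm // Dv_ev0 (raddf0 (Iv i1)) sub0r.
have E1 i : other i -> Dv i1 (fill2_ w i) = w.1.1 i.
  move=> oi; have := hw i; rewrite /bdry !(otherP oi) => /eqP; rewrite addr_eq0 => /eqP hi.
  rewrite (raddfB (Dv i1)) /= Dv_Iv Dv_Iv_comm // -[Dv i1 (w.1.2 i)]opprK -hi (raddfN (Iv i0)) /= opprK Iv_Dv.
  by rewrite addrC subrK.
have h0 : Dv i0 h = 0.
  have := hw i1; rewrite /bdry (negbTE n01) eqxx => /eqP; rewrite -opprD oppr_eq0 => /eqP e.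
  rewrite (raddfB (Dv i0)) (raddf_sum (Dv i0)) -[RHS]e /= -sumrN; congr (_ + _); apply: eq_bigr => j oj.
  by rewrite Dv_comm E0 // (raddfN (Dv j)) /= opprK.
have h1 : Dv i1 h = 0.
  have := hw i0; rewrite /bdry eqxx => e.
  rewrite (raddfB (Dv i1)) (raddf_sum (Dv i1)) -[RHS]e /=; congr (_ - _); apply: eq_bigr => j oj.
  by rewrite Dv_comm E1.
have o2 : other i2 by rewrite /other n02 n12.
split=> [i oi|].
  rewrite /fill2 (raddfD (Dv i0)) (raddfD (Dv i1)) /= E0 // E1 //; case: eqP => [e|_]; last first.
    by rewrite (raddf0 (Dv i0)) (raddf0 (Dv i1)) !addr0 opprK.
  by rewrite -/h !Dv_Iv_comm // h0 h1 (raddf0 (Iv i2)) !addr0 opprK.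
rewrite /fill2; have -> : \sum_(j | other j) Dv j (fill2_ w j +
    (if j == i2 then Iv i2 (w.2 - \sum_(j | other j) Dv j (fill2_ w j)) else 0)) =
    \sum_(j | other j) Dv j (fill2_ w j) + h.
  rewrite (eq_bigr (fun j => Dv j (fill2_ w j) + (if j == i2 then h else 0))).
    rewrite big_split /=; congr (_ + _); rewrite (bigD1 i2) //= eqxx big1 ?addr0 //.
    by move=> j /andP[_ /negbTE ->].
  move=> j _; rewrite (raddfD (Dv j)) /=; congr (_ + _); case: eqP => [->|_]; last exact: (raddf0 (Dv j)).
  by rewrite Dv_Iv.
by rewrite addrC subrK.
Qed.

Definition shift_chain (u : 'rV[int]_d) w : chain2 :=
  (fun i n => w.1.1 i (n - u), fun i n => w.1.2 i (n - u), fun n => w.2 (n - u)).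

(** Agreement at one point of the entries that carry meaning: the values of the first two families
    at [i0] and [i1] are junk that [bdry] never reads. *)
Definition chain_at w n (w' : chain2) n' := [/\ forall i, other i -> w.1.1 i n = w'.1.1 i n',
  forall i, other i -> w.1.2 i n = w'.1.2 i n' & w.2 n = w'.2 n'].

Lemma chain_at_sym w n w' n' : chain_at w n w' n' -> chain_at w' n' w n.
Proof. by case=> h1 h2 h3; split => // i oi; rewrite ?h1 ?h2. Qed.

Lemma chain_at_trans w n w' n' w'' n'' :
  chain_at w n w' n' -> chain_at w' n' w'' n'' -> chain_at w n w'' n''.
Proof.
by case=> h1 h2 h3 [g1 g2 g3]; split => [i oi|i oi|]; rewrite ?h1 ?h2 ?h3 ?g1 ?g2 ?g3.
Qed.

Lemma chain_at_add w0 w1 w2 n : chain_at w1 n (w2 - w0) n -> chain_at (w0 + w1) n w2 n.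
Proof.
have E (f g h : G) : g n = (h - f) n -> (f + g) n = h n.
  by rewrite -[(f + g) n]/(f n + g n) => ->; rewrite -[(h - f) n]/(h n - f n) addrC subrK.
by case=> h1 h2 h3; split => [i oi|i oi|]; apply: E; [apply: h1|apply: h2|apply: h3].
Qed.

Lemma sum_at (F : 'I_d -> G) n : (\sum_(j | other j) F j) n = \sum_(j | other j) F j n.
Proof. by rewrite fct_sumE. Qed.

(** The boundary at a point reads a chain only there and at the forward neighbours; this locality is
    what allows solutions on different classes to be glued. *)
Lemma bdry_at w w' n n' i : chain_at w n w' n' ->
  (forall j, chain_at w (n + unitv j) w' (n' + unitv j)) -> bdry w i n = bdry w' i n'.
Proof.
move=> [h1 h2 h3] hj; rewrite /bdry.
case: ifP => [_|e0]; [|case: ifP => [_|e1]].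
- rewrite -[LHS]/(Dv i1 w.2 n - (\sum_(j | other j) Dv j (w.1.1 j)) n).
  rewrite -[RHS]/(Dv i1 w'.2 n' - (\sum_(j | other j) Dv j (w'.1.1 j)) n').
  rewrite !sum_at !DvE h3; have [_ _ ->] := hj i1; congr (_ - _).
  by apply: eq_bigr => j oj; rewrite !DvE h1 //; have [-> //] := hj j.
- rewrite -[LHS]/(- Dv i0 w.2 n - (\sum_(j | other j) Dv j (w.1.2 j)) n).
  rewrite -[RHS]/(- Dv i0 w'.2 n' - (\sum_(j | other j) Dv j (w'.1.2 j)) n').
  rewrite !sum_at !DvE h3; have [_ _ ->] := hj i0; congr (_ - _).
  by apply: eq_bigr => j oj; rewrite !DvE h2 //; have [_ -> //] := hj j.
have oi : other i by rewrite /other e0 e1.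
rewrite -[LHS]/(Dv i0 (w.1.1 i) n + Dv i1 (w.1.2 i) n).
rewrite -[RHS]/(Dv i0 (w'.1.1 i) n' + Dv i1 (w'.1.2 i) n') !DvE h1 // h2 //.
by have [-> // _ _] := hj i0; have [_ -> // _] := hj i1.
Qed.

Lemma bdry_shift u w i n : bdry (shift_chain u w) i n = bdry w i (n - u).
Proof.
by apply: bdry_at; [split|move=> j; split] => //= *; rewrite addrAC.
Qed.

Lemma bdry3_at eta eta' n : (forall i, eta i n = eta' i n) ->
  (forall i j, eta i (n + unitv j) = eta' i (n + unitv j)) ->
  chain_at (bdry3 eta) n (bdry3 eta') n.
Proof.
move=> h hj; split => [i _|i _|] /=.
- by rewrite !DvE h hj.
- by rewrite -[LHS]/(- Dv i0 (eta i) n) -[RHS]/(- Dv i0 (eta' i) n) !DvE h hj.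
- by rewrite !sum_at; apply: eq_bigr => j _; rewrite !DvE h hj.
Qed.

Lemma fill2_at w n : (forall i, bdry w i = 0) -> chain_at (bdry3 (fill2 w)) n w n.
Proof.
by move=> /fill2_E[h h2]; split => [i /h[-> _]|i /h[_ ->]|] //=; rewrite -h2.
Qed.

End Algebra.
End Koszul.

(** * Rounding a real flow to an integer flow *)

Section ChainMap.
Context (d : nat) (i0 i1 i2 : 'I_d) (U V : zmodType) (f : {additive U -> V}).
Local Notation Z := 'rV[int]_d.

Lemma Dv_map i (g : Z -> U) : Dv i (f \o g) = f \o Dv i g.
Proof. by apply/funext => n; rewrite /= !DvE raddfB. Qed.

Lemma ev0_map i (g : Z -> U) : ev0 i (f \o g) = f \o ev0 i g.
Proof. by apply/funext => n; rewrite /= !ev0E. Qed.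

Lemma Iv_map i (g : Z -> U) : Iv i (f \o g) = f \o Iv i g.
Proof.
apply/funext => n; rewrite /= !IvE; case: (n 0 i) => l; last by rewrite raddf_sum.
by rewrite (raddfN f) (raddf_sum f).
Qed.

Lemma sum_map (P : pred 'I_d) (F : 'I_d -> Z -> U) :
  \sum_(j | P j) (f \o F j) = f \o (\sum_(j | P j) F j).
Proof. by apply/funext => n; rewrite /= !fct_sumE raddf_sum. Qed.

Lemma add_map (g h : Z -> U) : (f \o g) + (f \o h) = f \o (g + h).
Proof. by apply/funext => n; apply/esym/(raddfD f). Qed.

Lemma sub_map (g h : Z -> U) : (f \o g) - (f \o h) = f \o (g - h).
Proof. by apply/funext => n; apply/esym/(raddfB f). Qed.

Lemma opp_map (g : Z -> U) : - (f \o g) = f \o (- g).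
Proof. by apply/funext => n; apply/esym/(raddfN f). Qed.

Lemma zero_map : 0 = f \o (0 : Z -> U).
Proof. by apply/funext => n; apply/esym/(raddf0 f). Qed.

Definition chain_map (w : chain2 d U) : chain2 d V :=
  (fun i => f \o w.1.1 i, fun i => f \o w.1.2 i, f \o w.2).

Let sum_Dv (P : pred 'I_d) (F : 'I_d -> Z -> U) :
  \sum_(j | P j) Dv j (f \o F j) = f \o (\sum_(j | P j) Dv j (F j)).
Proof. by rewrite -sum_map; apply: eq_bigr => j _; rewrite Dv_map. Qed.

Lemma bdry_map w i : bdry i0 i1 (chain_map w) i = f \o bdry i0 i1 w i.
Proof.
rewrite /bdry /= !sum_Dv !Dv_map; case: ifP => _; first exact: sub_map.
by case: ifP => _; [rewrite opp_map sub_map|rewrite add_map].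
Qed.

Lemma bdry3_map eta : bdry3 i0 i1 (fun i => f \o eta i) = chain_map (bdry3 i0 i1 eta).
Proof.
rewrite /bdry3 /chain_map /= sum_Dv; congr (_, _, _); apply/funext => i; rewrite Dv_map //.
exact: opp_map.
Qed.

(** The fillings are composed of additive operators, hence commute with any change of coefficients.
    So the formulas can be evaluated on real chains, where measurability makes sense, although the
    equations hold only modulo 1. *)
Lemma fill1_map th : fill1 i0 i1 (fun i => f \o th i) = chain_map (fill1 i0 i1 th).
Proof.
rewrite /fill1 /chain_map /= -sub_map -!Iv_map -ev0_map -add_map -sum_Dv; congr (_, _, _ - _).
- by apply/funext => i; rewrite Iv_map.
- by apply/funext => i; rewrite -zero_map.
- congr (Iv _ (ev0 _ (_ + _))); apply: eq_bigr => i _; by rewrite Iv_map.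
Qed.

Lemma fill2_map w i : fill2 i0 i1 i2 (chain_map w) i = f \o fill2 i0 i1 i2 w i.
Proof.
have E j : fill2_ i0 i1 (chain_map w) j = f \o fill2_ i0 i1 w j.
  by rewrite /fill2_ /= ev0_map !Iv_map sub_map.
rewrite /fill2 E -add_map; congr (_ + _); case: ifP => _; last exact: zero_map.
rewrite -Iv_map -sub_map -sum_Dv; congr (Iv _ (_ - _)); apply: eq_bigr => j _.
by rewrite E.
Qed.

Lemma chain_mapB w w' : chain_map (w - w') = chain_map w - chain_map w'.
Proof.
congr (_, _, _); [apply/funext => i|apply/funext => i|]; apply/funext => n;
  exact: (raddfB f).
Qed.

Lemma chain_mapD w w' : chain_map (w + w') = chain_map w + chain_map w'.
Proof.
congr (_, _, _); [apply/funext => i|apply/funext => i|]; apply/funext => n;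
  exact: (raddfD f).
Qed.

End ChainMap.

(** * Chains depending measurably on the base point *)

Section MeasurableOperators.
Context (d : nat) (i0 i1 i2 : 'I_d) (disp : measure_display) (X : measurableType disp).
Context (R : realType).
Local Notation Z := 'rV[int]_d.
Local Notation G := (Z -> R).

Definition mfield (g : X -> G) := forall n, measurable_fun setT (fun x => g x n).

Lemma mfield0 : mfield (fun=> 0).
Proof. by move=> n; apply: measurable_cst. Qed.

Lemma mfieldD f g : mfield f -> mfield g -> mfield (fun x => f x + g x).
Proof. by move=> mf mg n; apply: measurable_funD; [apply: mf|apply: mg]. Qed.

Lemma mfieldN f : mfield f -> mfield (fun x => - f x).
Proof.
move=> mf n; have /= := @measurable_funB _ _ R setT (fun=> 0) (fun x => f x n)
  (measurable_cst _) (mf n).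
by congr measurable_fun; apply/funext => x /=; rewrite sub0r.
Qed.

Lemma mfieldB f g : mfield f -> mfield g -> mfield (fun x => f x - g x).
Proof. by move=> mf mg n; apply: measurable_funB; [apply: mf|apply: mg]. Qed.

Lemma mfield_sum (P : pred 'I_d) (F : 'I_d -> X -> G) : (forall j, mfield (F j)) ->
  mfield (fun x => \sum_(j | P j) F j x).
Proof.
move=> mF n; have -> : (fun x => (\sum_(j | P j) F j x) n) =
    (fun x => \sum_(j <- [seq j <- index_enum 'I_d | P j]) F j x n).
  by apply/funext => x; rewrite fct_sumE big_filter.
by apply: measurable_sum => j; apply: mF.
Qed.

Lemma mfield_Dv i g : mfield g -> mfield (fun x => Dv i (g x)).
Proof.
move=> mg n; have -> : (fun x => Dv i (g x) n) = (fun x => g x n - g x (n + unitv i)).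
  by apply/funext => x; rewrite DvE.
by apply: measurable_funB; apply: mg.
Qed.

Lemma mfield_ev0 i g : mfield g -> mfield (fun x => ev0 i (g x)).
Proof.
move=> mg n; have -> : (fun x => ev0 i (g x) n) = (fun x => g x (setc i n 0)).
  by apply/funext => x; rewrite ev0E.
exact: mg.
Qed.

Lemma mfield_Iv i g : mfield g -> mfield (fun x => Iv i (g x)).
Proof.
move=> mg n; case E : (n 0 i) => [l|l].
  have -> : (fun x => Iv i (g x) n) = (fun x => 0 - \sum_(0 <= k < l) g x (setc i n k%:Z)).
    by apply/funext => x; rewrite IvE E sub0r.
  by apply: measurable_funB; [exact: measurable_cst|apply: measurable_sum => k; apply: mg].
have -> : (fun x => Iv i (g x) n) = (fun x => \sum_(0 <= k < l.+1) g x (setc i n (- k.+1%:Z))).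
  by apply/funext => x; rewrite IvE E.
by apply: measurable_sum => k; apply: mg.
Qed.

Definition mchain (w : X -> chain2 d R) := [/\ forall i, mfield (fun x => (w x).1.1 i),
  forall i, mfield (fun x => (w x).1.2 i) & mfield (fun x => (w x).2)].

Lemma mchain_fill1 th : (forall i, mfield (fun x => th x i)) ->
  mchain (fun x => fill1 i0 i1 (th x)).
Proof.
move=> mth; split=> [i|i|] /=; [exact: mfield_Iv|exact: mfield0|].
apply: mfieldB; last exact: mfield_Iv.
apply/mfield_Iv/mfield_ev0/mfieldD => //; apply: mfield_sum => j.
exact/mfield_Dv/mfield_Iv.
Qed.

Lemma mchain_bdry3 eta : (forall i, mfield (fun x => eta x i)) ->
  mchain (fun x => bdry3 i0 i1 (eta x)).
Proof.
move=> me; split=> [i|i|] /=; [exact: mfield_Dv|exact/mfieldN/mfield_Dv|].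
by apply: mfield_sum => j; apply: mfield_Dv.
Qed.

Lemma mchainB w w' : mchain w -> mchain w' -> mchain (fun x => w x - w' x).
Proof.
by move=> [h1 h2 h3] [g1 g2 g3]; split=> [i|i|]; apply: mfieldB.
Qed.

Lemma mchainD w w' : mchain w -> mchain w' -> mchain (fun x => w x + w' x).
Proof.
by move=> [h1 h2 h3] [g1 g2 g3]; split=> [i|i|]; apply: mfieldD.
Qed.

Lemma mchain_shift u w : mchain w -> mchain (fun x => shift_chain u (w x)).
Proof. by move=> [h1 h2 h3]; split=> [i|i|] n /=; [apply: h1|apply: h2|apply: h3]. Qed.

Lemma mfield_bdry w i : mchain w -> mfield (fun x => bdry i0 i1 (w x) i).
Proof.
move=> [h1 h2 h3]; rewrite /bdry; case: (i == i0); [|case: (i == i1)].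
- by apply: mfieldB; [apply: mfield_Dv|apply: mfield_sum => j; apply: mfield_Dv].
- apply: mfieldB; first exact/mfieldN/mfield_Dv.
  by apply: mfield_sum => j; apply: mfield_Dv.
- by apply: mfieldD; apply: mfield_Dv.
Qed.

Lemma mfield_fill2 w i : mchain w -> mfield (fun x => fill2 i0 i1 i2 (w x) i).
Proof.
move=> [h1 h2 h3].
have m2 j : mfield (fun x => fill2_ i0 i1 (w x) j).
  by apply: mfieldB; [exact/mfield_Iv/mfield_ev0|exact: mfield_Iv].
rewrite /fill2; case: (i == i2) => /=; apply: mfieldD; first exact: m2.
- apply/mfield_Iv/mfieldB => //; apply: mfield_sum => j; exact/mfield_Dv/m2.
- exact: m2.
- exact: mfield0.
Qed.

Lemma measurable_bind (Y : countType) (c : X -> Y) (F : Y -> X -> R) : cmeas c ->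
  (forall y, measurable_fun setT (F y)) -> measurable_fun setT (fun x => F (c x) x).
Proof.
move=> mc mF _ B mB; rewrite setTI.
apply: (meas_cpre (P := fun y x => B (F y x)) mc) => y.
by have := mF y measurableT B mB; rewrite setTI.
Qed.

End MeasurableOperators.

(** * The group of reals modulo 1 *)

Section Circle.
Context (R : realType).

Definition intp : {pred R} := fun r => r \is a Num.int.
Lemma intp_closed : zmod_closed intp.
Proof. by split => [|x y]; rewrite /intp !unfold_in; [exact: rpred0|exact: rpredB]. Qed.
HB.instance Definition _ := GRing.isZmodClosed.Build R intp intp_closed.

Definition circle : zmodType := Quotient.quot intp.
Definition to_circle : R -> circle := \pi_(Quotient.quot intp).
Lemma to_circle_is_additive : zmod_morphism to_circle.
Proof. exact: pi_is_zmod_morphism. Qed.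
HB.instance Definition _ :=
  GRing.isZmodMorphism.Build R circle to_circle to_circle_is_additive.

Lemma to_circle_eq x y : (to_circle x == to_circle y) = (x - y \is a Num.int).
Proof. by rewrite -Quotient.idealrBE. Qed.

Definition frac (x : R) : R := x - (Num.floor x)%:~R.

Lemma frac_itv x : 0 <= frac x < 1.
Proof. by have := floor_le x; have := lt_succ_floor x; rewrite /frac intrD /=; lra. Qed.

End Circle.

(** * Stabilising solutions modulo 1 along the nested classes *)

Section Rounding.
Context (d : nat) (disp : measure_display) (X : measurableType disp) (a : zaction d X).
Context (R : realType) (i0 i1 i2 : 'I_d).
Hypotheses (n01 : i1 != i0) (n02 : i2 != i0) (n12 : i2 != i1).
Context (b : nat -> X -> 'rV[int]_d).
Hypotheses (mb : forall m, cmeas (b m))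
  (bS : forall m n x, same a (b m) n x -> same a (b m.+1) n x)
  (bE : forall x n, exists m, same a (b m) n x).
Context (phi : 'I_d -> X -> R) (K : R) (f : X -> int).
Hypotheses (mphi : forall i, measurable_fun setT (phi i))
  (phi_le : forall i x, `|phi i x| <= K)
  (phi_div : forall x, (f x)%:~R = \sum_i (phi i x - phi i (a (unitv i) x))).
Local Notation Z := 'rV[int]_d.
Implicit Types (x z : X) (n u : Z) (i j : 'I_d).

Let same_leq := same_le bS.
Context (V : zmodType) (pr : {additive R -> V}).
Hypothesis pr_eq0 : forall r, (pr r == 0) = (r \is a Num.int).
Let prC : chain2 d R -> chain2 d V := @chain_map d R V pr.

Let pr_frac r : pr (frac r) = pr r.
Proof.
apply/eqP; rewrite -subr_eq0 -raddfB pr_eq0 /frac addrAC subrr sub0r rpredN.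
exact: intr_int.
Qed.

Let th z i n : R := phi i (a n z).

(** Seen from [z], the stage [k] base point of [a n z] is at position [u]. The old solution there
    and the fresh solution at [z] differ by a cycle modulo 1. On each class [ext] is a filling of
    this cycle, so adding its boundary turns the fresh solution into the old one inside the
    class. *)
Let ext (k : nat) (O : X -> chain2 d R) z i n : R := let u := b k (a n z) + n in
  fill2 i0 i1 i2 (shift_chain u (O (a u z)) - fill1 i0 i1 (th z)) i n.

(* [Om m z] is a solution, modulo 1, of the equation [bdry w = th z] on the whole orbit
   of [z]; at stage m+1 it extends the stage m solutions of all classes of stage m. *)
Context (Om : nat -> X -> chain2 d R).
Hypotheses (Om0 : forall z, Om 0 z = fill1 i0 i1 (th z))
  (OmS : forall m z, Om m.+1 z = fill1 i0 i1 (th z) + bdry3 i0 i1 (ext m (Om m) z)).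

Let pth z i : Z -> V := pr \o th z i.

Let div_pth z : \sum_i Dv i (pth z i) = 0.
Proof.
apply/funext => n; rewrite fct_sumE.
have -> : \sum_i Dv i (pth z i) n = pr (\sum_i (phi i (a n z) - phi i (a (unitv i) (a n z)))).
  rewrite raddf_sum; apply: eq_bigr => i _.
  by rewrite DvE /pth /= -raddfB /th [n + _]addrC actD.
by rewrite -phi_div; apply/eqP; rewrite pr_eq0 intr_int.
Qed.

Let bdry_pfill1 z i : bdry i0 i1 (prC (fill1 i0 i1 (th z))) i = pth z i.
Proof. by rewrite /prC -fill1_map bdry_fill1 //; exact: div_pth. Qed.

Let bdry_Om m z i : bdry i0 i1 (prC (Om m z)) i = pth z i.
Proof.
case: m => [|m]; first by rewrite Om0 bdry_pfill1.
by rewrite OmS /prC chain_mapD bdryD // bdry_pfill1 -bdry3_map bdry_bdry3 // addr0.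
Qed.

Let cocycle m z u i :
  bdry i0 i1 (prC (shift_chain u (Om m (a u z)) - fill1 i0 i1 (th z))) i = 0.
Proof.
rewrite /prC chain_mapB bdryB // bdry_pfill1; apply/funext => n.
rewrite -[LHS]/(bdry i0 i1 (shift_chain u (prC (Om m (a u z)))) i n - pth z i n).
by rewrite bdry_shift // bdry_Om /pth /th /= -actD subrK subrr.
Qed.

(** When [n] and its forward neighbours lie in one class, [ext] coincides there with a single
    filling, and its boundary at [n] is the entire difference between the two solutions. *)
Let Om_step m z n : (forall j, b m (a (n + unitv j) z) + unitv j = b m (a n z)) ->
  let u := b m (a n z) + n in
  chain_at i0 i1 (prC (Om m.+1 z)) n (prC (Om m (a u z))) (n - u).
Proof.
move=> hb u; pose De := shift_chain u (Om m (a u z)) - fill1 i0 i1 (th z).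
have E : chain_at i0 i1 (bdry3 i0 i1 (fill2 i0 i1 i2 (prC De))) n (prC De) n.
  by apply: fill2_at => // i; apply: cocycle.
pose H := ext m (Om m) z.
have E' : chain_at i0 i1 (bdry3 i0 i1 (fun i => pr \o H i)) n (prC De) n.
  have F i' n' : fill2 i0 i1 i2 (prC De) i' n' = pr (fill2 i0 i1 i2 De i' n').
    by have /(congr1 (fun g => g n')) := @fill2_map d i0 i1 i2 R V pr De i'.
  have H1 i' : H i' n = fill2 i0 i1 i2 De i' n by exact: erefl.
  have H2 i' j : H i' (n + unitv j) = fill2 i0 i1 i2 De i' (n + unitv j).
    rewrite /H /ext /De /u; have <- : b m (a (n + unitv j) z) + (n + unitv j) = b m (a n z) + n.
      by rewrite addrCA hb addrC.
    exact: erefl.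
  apply: chain_at_trans E.
  apply: bdry3_at => [i|i j].
    exact: etrans (congr1 pr (H1 i)) (esym (F i n)).
  exact: etrans (congr1 pr (H2 i j)) (esym (F i (n + unitv j))).
have DeE : prC De = shift_chain u (prC (Om m (a u z))) - prC (fill1 i0 i1 (th z)).
  exact: (@chain_mapB d R V pr).
rewrite (@bdry3_map d i0 i1 R V pr H) DeE in E'.
rewrite OmS /prC chain_mapD; exact: (chain_at_trans (chain_at_add E')).
Qed.

Let interior m x := forall j, same a (b m) (unitv j) x.

Let interior_ex x : exists m, `[< interior m x >].
Proof.
suff [m hm] : exists m, forall j, j \in enum 'I_d -> same a (b m) (unitv j) x.
  by exists m; apply/asboolP => j; apply: hm; rewrite mem_enum.
elim: (enum _) => [|j s [m hm]]; first by exists 0%N.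
have [k hk] := bE x (unitv j); exists (maxn m k) => l; rewrite inE => /orP[/eqP ->|ls].
  by apply: same_leq hk; apply: leq_maxr.
by apply: same_leq (hm l ls); apply: leq_maxl.
Qed.

Let interior_le k m x : (k <= m)%N -> interior k x -> interior m x.
Proof. by move=> km hk j; apply: same_leq (hk j). Qed.

(** Written in coordinates centred at the base point, so that it is literally the same chain for all
    points of a class. *)
Let W m x : chain2 d R := Om m (a (b m x) x).

Let W_step m x : interior m x ->
  chain_at i0 i1 (prC (W m.+1 x)) (- b m.+1 x) (prC (W m x)) (- b m x).
Proof.
move=> hm; have x0 : a (- b m.+1 x) (a (b m.+1 x) x) = x by rewrite actN.
have := @Om_step m (a (b m.+1 x) x) (- b m.+1 x); rewrite /= x0.
have -> : a (b m x - b m.+1 x) (a (b m.+1 x) x) = a (b m x) x by rewrite -actD subrK.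
rewrite opprB addrA addNr add0r; apply=> j.
rewrite -actD addrAC addNr add0r.
by have := hm j; rewrite /same => ->.
Qed.

Let stage x : nat := ex_minn (interior_ex x).

Let stageP x : interior (stage x) x.
Proof. by rewrite /stage; case: ex_minnP => m /asboolP. Qed.

Let meas_interior m : measurable [set x | interior m x].
Proof.
apply: meas_forall => j; apply: meas_eqc => //.
apply: (cmeas_comp (fun n : Z => n + unitv j)); exact: cmeas_act.
Qed.

Let cmeas_stage : cmeas stage.
Proof.
move=> m; have -> : [set x | stage x = m] =
    [set x | interior m x /\ forall k, (k < m)%N -> ~ interior k x].
  apply/seteqP; split => x /=; rewrite /stage; case: ex_minnP => k /asboolP hk kmin.
    by move=> <-; split => // l lk hl; have := kmin l; rewrite leqNgt lk => h; have := h (asboolT hl).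
  case=> hm hmin; apply/eqP; rewrite eqn_leq (kmin m (asboolT hm)) /= leqNgt.
  by apply/negP => /hmin.
apply: meas_and => //; apply: meas_forall => k; apply: meas_imply; first exact: meas_const.
exact: meas_not.
Qed.

(** The value at a point is frozen at the first stage where the point is interior; later stages
    alter it only by integers. Taking fractional parts keeps it bounded, although the chains [Om m]
    need not be. *)
Let om x : chain2 d R :=
  let m := stage x in
  (fun i n => frac ((W (stage (a n x)) (a n x)).1.1 i (- b (stage (a n x)) (a n x))),
   fun i n => frac ((W (stage (a n x)) (a n x)).1.2 i (- b (stage (a n x)) (a n x))),
   fun n => frac ((W (stage (a n x)) (a n x)).2 (- b (stage (a n x)) (a n x)))).

Let om_W m x n : interior m (a n x) ->
  chain_at i0 i1 (prC (om x)) n (prC (W m (a n x))) (- b m (a n x)).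
Proof.
move=> hm; have sm : (stage (a n x) <= m)%N.
  by rewrite {1}/stage; case: ex_minnP => k _; apply; apply/asboolP.
have : chain_at i0 i1 (prC (om x)) n (prC (W (stage (a n x)) (a n x))) (- b (stage (a n x)) (a n x)).
  by split => [i _|i _|]; apply: pr_frac.
rewrite -(subnK sm); elim: (m - stage (a n x))%N => [|k IH] // /IH {}IH.
apply: chain_at_trans IH _; apply: chain_at_sym; apply: W_step.
by apply: interior_le (stageP (a n x)); apply: leq_addl.
Qed.

Let om_act x n : om (a n x) = shift_chain (- n) (om x).
Proof.
by congr (_, _, _); [apply/funext => i|apply/funext => i|]; apply/funext => u;
  rewrite /= opprK actD.
Qed.

(** Subtracting a boundary preserves the divergence; what is left is integral because [om] solves
    the equation modulo 1. *)
Let psi i x : R := phi i x - bdry i0 i1 (om x) i 0.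

Let psi_div x : \sum_i (psi i x - psi i (a (unitv i) x)) = (f x)%:~R.
Proof.
rewrite phi_div.
have E i : psi i x - psi i (a (unitv i) x) =
    (phi i x - phi i (a (unitv i) x)) - Dv i (bdry i0 i1 (om x) i) 0.
  by rewrite /psi subr_subACA om_act bdry_shift // opprK DvE.
under eq_bigr do rewrite E.
have E0 : \sum_i Dv i (bdry i0 i1 (om x) i) 0 = 0.
  by have := congr1 (fun g => g 0) (div_bdry n01 (om x)); rewrite fct_sumE.
by rewrite sumrB E0 subr0.
Qed.

Let psi_int i x : psi i x \is a Num.int.
Proof.
have [m [hm0 hmj hs]] : exists m, [/\ interior m x, forall j, interior m (a (unitv j) x)
    & forall j, same a (b m) (unitv j) x].
  pose M := (\max_j stage (a (unitv j) x))%N.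
  exists (maxn (stage x) M); split.
  - by apply: interior_le (stageP x); apply: leq_maxl.
  - move=> j; apply: interior_le (stageP _); apply: leq_trans (leq_maxr _ _).
    exact: leq_bigmax.
  - by move=> j; apply: interior_le (stageP x) j; apply: leq_maxl.
have a0x : a 0 x = x by rewrite act0.
rewrite -pr_eq0 /psi raddfB subr_eq0; apply/eqP.
rewrite -[RHS]/((pr \o bdry i0 i1 (om x) i) 0) -bdry_map //.
rewrite (@bdry_at _ _ _ _ (chain_map pr (om x)) (prC (W m x)) 0 (- b m x) i).
- by rewrite bdry_Om /pth /th /= actN.
- by have := @om_W m x 0; rewrite a0x; apply.
- move=> j; have := @om_W m x (unitv j); rewrite add0r => /(_ (hmj j)).
  have eb : b m x = b m (a (unitv j) x) + unitv j by have := hs j.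
  have -> : W m (a (unitv j) x) = W m x by rewrite /W eb actD.
  by rewrite eb opprD subrK.
Qed.

Let meas_th i : mfield (fun z => th z i).
Proof.
move=> n _ B mB; rewrite setTI; apply: (meas_act a n (P := fun x => B (phi i x))).
by have := @mphi i measurableT B mB; rewrite setTI.
Qed.

Let mchain_act (w : X -> chain2 d R) n : mchain w -> mchain (fun z => w (a n z)).
Proof.
move=> [h1 h2 h3]; split=> [i|i|] k _ B mB; rewrite setTI.
- apply: (meas_act a n (P := fun x => B ((w x).1.1 i k))).
  by have := h1 i k measurableT B mB; rewrite setTI.
- apply: (meas_act a n (P := fun x => B ((w x).1.2 i k))).
  by have := h2 i k measurableT B mB; rewrite setTI.
- apply: (meas_act a n (P := fun x => B ((w x).2 k))).
  by have := h3 k measurableT B mB; rewrite setTI.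
Qed.

Let meas_Om m : mchain (Om m).
Proof.
elim: m => [|m IH].
  have -> : Om 0 = fun z => fill1 i0 i1 (th z) by apply/funext => z; rewrite Om0.
  exact: mchain_fill1.
have -> : Om m.+1 = fun z => fill1 i0 i1 (th z) + bdry3 i0 i1 (ext m (Om m) z).
  by apply/funext => z; rewrite OmS.
apply: mchainD; first exact: mchain_fill1.
apply: mchain_bdry3 => i n.
pose F u z := fill2 i0 i1 i2 (shift_chain u (Om m (a u z)) - fill1 i0 i1 (th z)) i n.
apply: (@measurable_bind _ _ _ Z (fun z => b m (a n z) + n) F).
  apply: (cmeas_comp (fun v : Z => v + n)); exact: cmeas_act.
move=> u; apply: mfield_fill2; apply: mchainB; last exact: mchain_fill1.
by apply: mchain_shift; apply: mchain_act.
Qed.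

Let meas_frac (g : X -> R) : measurable_fun setT g -> measurable_fun setT (fun x => frac (g x)).
Proof.
move=> mg; apply: measurable_funB => //.
apply: (@measurable_bind _ _ _ int (fun x => Num.floor (g x)) (fun k _ => k%:~R)) => [k|k].
  have -> : [set x | Num.floor (g x) = k] = g @^-1` `[k%:~R, (k + 1)%:~R[%classic.
    apply/seteqP; split => x /=; rewrite in_itv /=; first by move=> <-; exact: floor_itv.
    by move=> h; apply: floor_def.
  by rewrite -[X in measurable X]setTI; apply: mg.
exact: measurable_cst.
Qed.

Let meas_om : mchain om.
Proof.
have M1 (g : nat -> X -> Z -> R) n : (forall m, mfield (g m)) ->
    measurable_fun setT (fun x => frac (g (stage (a n x)) (a (b (stage (a n x)) (a n x)) (a n x))
       (- b (stage (a n x)) (a n x)))).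
  move=> mg; apply: meas_frac.
  have mh : measurable_fun setT (fun x => g (stage x) (a (b (stage x) x) x) (- b (stage x) x)).
    apply: (@measurable_bind _ _ _ nat stage
      (fun m x => g m (a (b m x) x) (- b m x))) => // m.
    apply: (@measurable_bind _ _ _ Z (b m) (fun u x => g m (a u x) (- u))) => // u.
    move=> _ B mB; rewrite setTI; apply: (meas_act a u (P := fun x => B (g m x (- u)))).
    by have := mg m (- u) measurableT B mB; rewrite setTI.
  move=> _ B mB; rewrite setTI.
  apply: (meas_act a n (P := fun x => B (g (stage x) (a (b (stage x) x) x) (- b (stage x) x)))).
  by have := mh measurableT B mB; rewrite setTI.
split=> [i|i|] n /=.
- by apply: (M1 (fun m z => (Om m z).1.1 i)) => m; case: (meas_Om m).
- by apply: (M1 (fun m z => (Om m z).1.2 i)) => m; case: (meas_Om m).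
- by apply: (M1 (fun m z => (Om m z).2)) => m; case: (meas_Om m).
Qed.

Let psi_le i x : `|psi i x| <= K + d%:R + d%:R.
Proof.
have D1 (g : Z -> R) j n : (forall n, 0 <= g n < 1) -> `|Dv j g n| <= 1.
  move=> hg; rewrite DvE ler_norml; have := hg n; have := hg (n + unitv j); lra.
have o1 j n : 0 <= (om x).1.1 j n < 1 by apply: frac_itv.
have o2 j n : 0 <= (om x).1.2 j n < 1 by apply: frac_itv.
have o3 n : 0 <= (om x).2 n < 1 by apply: frac_itv.
have S (g : 'I_d -> Z -> R) : (forall j n, 0 <= g j n < 1) ->
    `|(\sum_(j | other i0 i1 j) Dv j (g j)) 0| <= d%:R.
  move=> hg; rewrite fct_sumE; apply: le_trans (ler_norm_sum _ _ _) _.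
  apply: le_trans (_ : \sum_(j < d) (1 : R) <= _); last by rewrite sumr_const card_ord.
  rewrite [leRHS](bigID (other i0 i1)) /= -[leLHS]addr0; apply: lerD.
    by apply: ler_sum => j _; apply: D1.
  by apply: sumr_ge0.
have d1 : (1 : R) <= d%:R by rewrite ler1n; case: (d) i => [[]|].
rewrite /psi; apply: le_trans (ler_normB _ _) _; rewrite -addrA; apply: lerD => //.
rewrite /bdry; case: (i == i0); [|case: (i == i1)].
- apply: le_trans (ler_normB (Dv i1 (om x).2 0) _) _.
  by have := S _ o1; have := D1 _ i1 0 o3; lra.
- apply: le_trans (ler_normB (- Dv i0 (om x).2 0) _) _; rewrite normrN.
  by have := S _ o2; have := D1 _ i0 0 o3; lra.
- apply: le_trans (ler_normD (Dv i0 ((om x).1.1 i) 0) _) _.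
  by have := D1 _ i0 0 (o1 i); have := D1 _ i1 0 (o2 i); lra.
Qed.

Lemma integer_flow_of_extension : exists (psi : 'I_d -> X -> int) (M : nat),
  [/\ forall i, cmeas (psi i), forall i x, (`|psi i x| <= M)%N
    & forall x, f x = \sum_i (psi i x - psi i (a (unitv i) x))].
Proof.
have psiE i x : psi i x = (Num.floor (psi i x))%:~R.
  by apply/eqP; rewrite eq_sym -intrEfloor psi_int.
exists (fun i x => Num.floor (psi i x)), (Num.bound (K + d%:R + d%:R)); split.
- move=> i k; have -> : [set x | Num.floor (psi i x) = k] = psi i @^-1` [set k%:~R].
    apply/seteqP; split => x /=; rewrite psiE; first by rewrite intrKfloor => ->.
    by move=> /eqP; rewrite eqr_int intrKfloor => /eqP.
  have mpsi : measurable_fun setT (psi i).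
    by apply: measurable_funB; [exact: mphi|exact: (mfield_bdry i0 i1 i meas_om)].
  rewrite -[X in measurable X]setTI; exact: (mpsi measurableT _ (measurable_set1 _)).
- move=> i x; have := psi_le i x; rewrite psiE intrKfloor -intr_norm => h.
  have /archi_boundP := le_trans (normr_ge0 _) (psi_le i x).
  move=> /(le_lt_trans h); rewrite pmulrn ltr_int; lia.
- move=> x; apply/eqP; rewrite -(eqr_int R) -psi_div rmorph_sum /=; apply/eqP.
  by apply: eq_bigr => i _; rewrite rmorphB /= -!psiE.
Qed.

End Rounding.

Lemma exists_integer_flow (d : nat) (disp : measure_display) (X : measurableType disp)
    (a : zaction d X) (R : realType) (phi : 'I_d -> X -> R) (K : R) (f : X -> int) :
    separable a -> (2 < d)%N ->
    (forall i, measurable_fun setT (phi i)) -> (forall i x, `|phi i x| <= K) ->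
    (forall x, (f x)%:~R = \sum_i (phi i x - phi i (a (unitv i) x))) ->
  exists (psi : 'I_d -> X -> int) (M : nat),
  [/\ forall i, cmeas (psi i), forall i x, (`|psi i x| <= M)%N
    & forall x, f x = \sum_i (psi i x - psi i (a (unitv i) x))].
Proof.
move=> sep d3 mphi phi_le phi_div; have [b [mb bS bE]] := exists_base sep.
pose i0 : 'I_d := Ordinal (ltnW (ltnW d3)); pose i1 : 'I_d := Ordinal (ltnW d3).
pose i2 : 'I_d := Ordinal d3.
pose Om := fix Om (m : nat) z : chain2 d R :=
  if m is k.+1 then
    fill1 i0 i1 (fun i n => phi i (a n z)) + bdry3 i0 i1 (fun i n =>
      let u := b k (a n z) + n in
      fill2 i0 i1 i2 (shift_chain u (Om k (a u z)) -
        fill1 i0 i1 (fun i n => phi i (a n z))) i n)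
  else fill1 i0 i1 (fun i n => phi i (a n z)).
apply: (@integer_flow_of_extension d disp X a R i0 i1 i2 _ _ _ b mb bS bE phi K f
  mphi phi_le phi_div (circle R) (@to_circle R) _ Om) => // r.
by rewrite -[r in RHS]subr0 -to_circle_eq raddf0.
Qed.

(** * Tilings and matchings *)

Section Tiles.
Context (d : nat) (disp : measure_display) (X : measurableType disp) (a : zaction d X).
Context (r : nat).
Hypothesis r_gt0 : (0 < r)%N.
Hypothesis sep : separable a.
Implicit Types (x y z : X) (n u v e : 'rV[int]_d).

(* Every point is assigned to the unique centre within distance [r] if there is one, and
   otherwise to the centre of least colour within distance [2 * r]; hence a tile contains
   the ball of radius [r] around its centre and its boundary is covered by the boundaries
   of boundedly many balls. *)
Lemma exists_tiling : exists (D : X -> Prop) (center : X -> 'rV[int]_d),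
  [/\ forall x n, D x -> D (a n x) -> (nrm n <= 2 * r)%N -> n = 0,
      cmeas center,
      forall x, D (a (center x) x) /\ (nrm (center x) <= 2 * r)%N,
      forall x n, (nrm n <= r)%N -> D (a n x) -> center x = n
    & forall x e, (nrm e <= 1)%N -> ~ same a center e x ->
        exists u rho, [/\ rho \in [:: r; (2 * r)%N], D (a u x) & (rho <= nrm u <= rho.+1)%N]].
Proof.
have [D [mD sepD covD]] := maximal_discrete (2 * r) sep.
have [p [U [mU covU sepU]]] := sep (4 * r)%N.
have exU x : exists i, `[< U i x >].
  by have [i _ Ui] := covU x; exists i; apply/asboolP.
pose col x : nat := ex_minn (exU x).
have mcol : cmeas col.
  move=> k; have -> : [set x | col x = k] = [set x | U k x /\ forall l, (l < k)%N -> ~ U l x].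
    apply/seteqP; split => x /=; rewrite /col; case: ex_minnP => l /asboolP Ul lmin.
      move=> <-; split => // j jl Uj; have := lmin j (asboolT Uj); by rewrite leqNgt jl.
    case=> Uk kmin; apply/eqP; rewrite eqn_leq (lmin k (asboolT Uk)) /= leqNgt.
    by apply/negP => /kmin.
  apply: meas_and => //; apply: meas_forall => l; apply: meas_imply; first exact: meas_const.
  exact: meas_not.
have colP x n : col x = col (a n x) -> (nrm n <= 4 * r)%N -> n = 0.
  rewrite /col; case: ex_minnP => i /asboolP Ui _; case: ex_minnP => j /asboolP Uj _ ij hn.
  by rewrite -ij in Uj; apply: sepU Ui Uj hn.
pose key n x : nat := if (nrm n <= r)%N then 0%N else (col (a n x)).+1.
pose cands x := [seq n <- boxs d (2 * r) | `[< D (a n x) >]].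
have candsP x n : n \in cands x <-> D (a n x) /\ (nrm n <= 2 * r)%N.
  rewrite mem_filter mem_boxs; split; first by case/andP => /asboolP.
  by case=> Dn ->; rewrite andbT; apply/asboolP.
have key_inj x n n' : n \in cands x -> n' \in cands x -> key n x = key n' x -> n = n'.
  move=> /candsP[Dn hn] /candsP[Dn' hn'] e.
  apply/eqP; rewrite -subr_eq0; apply/eqP; have hnn := nrmB n n'.
  have en : a (n - n') (a n' x) = a n x by rewrite -actD subrK.
  move: e; rewrite /key; case: leqP => h; case: leqP => h' // e.
    apply: (sepD (a n' x)); rewrite ?en //; apply: leq_trans hnn _; lia.
  case: e => e; apply: (colP (a n' x)); rewrite ?en //; apply: leq_trans hnn _; lia.
pose minimal x n := all (fun n' => key n x <= key n' x)%N (cands x).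
pose center x := head 0 [seq n <- cands x | minimal x n].
have centerP x : center x \in cands x /\ minimal x (center x).
  have [n0 hn0 Dn0] := covD x.
  have c0 : n0 \in cands x by apply/candsP.
  have exk : exists k, k \in [seq key n x | n <- cands x].
    by exists (key n0 x); apply: map_f.
  have [k /mapP[n cn ek] kmin] := ex_minnP exk.
  have : n \in [seq n <- cands x | minimal x n].
    rewrite mem_filter cn andbT; apply/allP => n' cn'; rewrite -ek; apply: kmin.
    exact: map_f.
  rewrite /center; case E : [seq n <- cands x | minimal x n] => [//|m s] _ /=.
  have : m \in [seq n <- cands x | minimal x n] by rewrite E inE eqxx.
  by rewrite mem_filter => /andP[].
have center_uniq x n : n \in cands x -> minimal x n -> center x = n.
  move=> cn /allP mn; have [cc /allP mc] := centerP x.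
  by apply: (key_inj x) => //; apply/eqP; rewrite eqn_leq mc // mn.
have mcands : cmeas cands.
  apply: cmeas_filter => n; have -> : [set x | `[< D (a n x) >]] = [set x | D (a n x)].
    by apply/seteqP; split => x /= /asboolP.
  exact: meas_act.
have mkey n : cmeas (key n).
  rewrite /key; case: (nrm n <= r)%N; first exact: cmeas_const.
  by apply: (cmeas_comp S); apply: cmeas_act.
exists D, center; split => //.
- apply: (@cmeas_bind _ _ (seq 'rV[int]_d) _ cands
    (fun c x => head 0 [seq n <- c | all (fun n' => key n x <= key n' x)%N c])) => // c.
  apply: (cmeas_comp (head (0 : 'rV[int]_d))); apply: cmeas_filter => n.
  apply: (@meas_cpre _ _ _ (key n) (fun k x => all (fun n' => k <= key n' x)%N c)) => // k.
  elim: c => [|m c IH] /=; first exact: meas_const.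
  have -> : [set x | (k <= key m x)%N && all (fun n' => k <= key n' x)%N c] =
      [set x | (k <= key m x)%N /\ all (fun n' => k <= key n' x)%N c].
    by apply/seteqP; split => x /=; [move/andP|move=> ?; apply/andP].
  apply: meas_and => //; apply: (@meas_cpre _ _ _ (key m) (fun l _ => (k <= l)%N)) => // l.
  exact: meas_const.
- by move=> x; have [/candsP[]] := centerP x.
- move=> x n hn Dn; apply: center_uniq; first by apply/candsP; split => //; lia.
  by apply/allP => n' _; rewrite /key hn.
(* If no centre lies near the spheres of radius [r] and [2 * r] around [x], a unit step changes
   neither the candidates nor their keys, so both points choose the same centre. *)
move=> x e he ns; apply: contrapT => H; apply: ns; rewrite /same.
have H1 u rho : rho \in [:: r; (2 * r)%N] -> D (a u x) -> ~~ (rho <= nrm u <= rho.+1)%N.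
  by move=> hr Du; apply/negP => hu; apply: H; exists u, rho.
have Hr u : D (a u x) -> (nrm u < r)%N \/ (r.+1 < nrm u)%N.
  by move=> Du; have := H1 u r; rewrite inE eqxx /= => /(_ isT Du); lia.
have H2r u : D (a u x) -> (nrm u < 2 * r)%N \/ ((2 * r).+1 < nrm u)%N.
  by move=> Du; have := H1 u (2 * r)%N; rewrite !inE eqxx orbT => /(_ isT Du); lia.
have cE u : (u - e) \in cands (a e x) <-> u \in cands x.
  rewrite !candsP -actD subrK; have h1 := nrmB u e; have h2 := nrmD (u - e) e.
  rewrite subrK in h2; split; case=> Du hu; split => //; have := H2r u Du; lia.
have kE u : D (a u x) -> key (u - e) (a e x) = key u x.
  move=> Du; rewrite /key -actD subrK; have h1 := nrmB u e; have h2 := nrmD (u - e) e.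
  move: h1 h2 (Hr u Du) he; rewrite subrK.
  move: (nrm u) (nrm (u - e)) (nrm e) => A B C.
  case: (leqP A r) => hA; case: (leqP B r) => hB h1 h2 [h|h] he //; exfalso; lia.
have [cc /allP mc] := centerP x.
have [Dc _] := (candsP x (center x)).1 cc.
rewrite (center_uniq (a e x) (center x - e)) ?subrK //; first exact/cE.
apply/allP => v cv; have cv' : v + e \in cands x by apply/cE; rewrite addrK.
have [Dv' _] := (candsP x (v + e)).1 cv'.
by rewrite -(addrK e v) !kE //; apply: mc.
Qed.

End Tiles.

Section BoxSums.
Context (d : nat).
Implicit Types (s t : seq 'rV[int]_d) (n u : 'rV[int]_d).

Lemma sum_supp (F : 'rV[int]_d -> int) s t : uniq s -> uniq t ->
  (forall n, F n != 0 -> (n \in s) && (n \in t)) ->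
  \sum_(n <- s) F n = \sum_(n <- t) F n.
Proof.
move=> us ut h; have E w : \sum_(n <- w) F n = \sum_(n <- [seq n <- w | F n != 0]) F n.
  rewrite big_filter [RHS]big_mkcond /=; apply: eq_bigr => n _.
  by case: eqP => // ->.
rewrite (E s) (E t); apply: perm_big; apply: uniq_perm; rewrite ?filter_uniq // => n.
rewrite !mem_filter; case: (boolP (F n == 0)) => //= nz.
by have /andP[-> ->] := h n nz.
Qed.

Lemma sum_boxs_shift (F : 'rV[int]_d -> int) w w' u :
  (forall n, F n != 0 -> (nrm n <= w)%N) -> (w + nrm u <= w')%N ->
  \sum_(n <- boxs d w') F (n + u) = \sum_(n <- boxs d w') F n.
Proof.
move=> h hw; rewrite -(big_map (fun n => n + u) xpredT F); apply: sum_supp.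
- by rewrite map_inj_uniq ?boxs_uniq //; apply: addIr.
- exact: boxs_uniq.
move=> n /h hn; rewrite mem_boxs; apply/andP; split; last by lia.
apply/mapP; exists (n - u); last by rewrite subrK.
by rewrite mem_boxs; apply: leq_trans (nrmB _ _) _; lia.
Qed.

Lemma sum_delta (c : int) s u : uniq s -> u \in s -> \sum_(v <- s) (u == v)%:Z * c = c.
Proof.
move=> us; rewrite -big_distrl /= => hu.
rewrite (bigD1_seq u) //= eqxx big1 ?addr0 ?mul1r // => v /negbTE.
by rewrite eq_sym => ->.
Qed.

Lemma size_filterZ s (P : pred 'rV[int]_d) :
  (size [seq n <- s | P n])%:Z = \sum_(n <- s) (P n)%:Z.
Proof.
elim: s => [|n s IH]; rewrite ?big_nil // big_cons -IH /=; case: (P n) => //=; lia.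
Qed.

(** Points of [s] take the entries of [t] in order; the surplus points fall on the default 0, which
    will mean staying in the tile. *)
Lemma sum_nth_index s t v : uniq s -> (size t <= size s)%N ->
  \sum_(n <- s) (nth 0 t (index n s) == v)%:Z =
  (count_mem v t)%:Z + (0 == v)%:Z * ((size s)%:Z - (size t)%:Z).
Proof.
move=> us; elim: s t us => [|n s IH] [|u t] //= us.
- by rewrite big_nil subrr mulr0.
- move=> _; rewrite big_cons /= eqxx.
  case/andP: us => ns us; have := IH [::] us isT; rewrite /= => E.
  rewrite (eq_big_seq (fun m => (nth 0 [::] (index m s) == v)%:Z)); last first.
    by move=> m ms /=; rewrite !nth_nil.
  by rewrite E; case: (0 == v); lia.
rewrite ltnS => hs; case/andP: us => ns us; rewrite big_cons /= eqxx /=.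
rewrite (eq_big_seq (fun m => (nth 0 t (index m s) == v)%:Z)); last first.
  by move=> m ms /=; case: (eqVneq n m) => [e|//]; rewrite e ms in ns.
by rewrite IH // PoszD -addrA; congr (_ + (_ + _ * _)); rewrite !intS opprD addrACA subrr add0r.
Qed.

End BoxSums.

Definition posn (z : int) : nat := if z is Posz l then l else 0%N.
Definition negn (z : int) : nat := if z is Negz l then l.+1 else 0%N.

Lemma posn_negn z : (posn z)%:Z - (negn z)%:Z = z.
Proof. by case: z => n; rewrite /= ?subr0 // sub0r NegzE. Qed.

(** * Moving points between tiles and matching inside them *)

Section Matching.
Context (d : nat) (disp : measure_display) (X : measurableType disp) (a : zaction d X).
Context (w : nat) (center : X -> 'rV[int]_d).
Hypotheses (mc : cmeas center) (nc : forall x, (nrm (center x) <= w)%N)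
  (cc : forall x, center (a (center x) x) = 0).
Context (A B : X -> bool).
Hypotheses (mA : measurable [set x | A x]) (mB : measurable [set x | B x]).
Context (psi : 'I_d -> X -> int).
Hypotheses (mpsi : forall i, cmeas (psi i))
  (psi_div : forall x, (A x)%:Z - (B x)%:Z = \sum_i (psi i x - psi i (a (unitv i) x))).
Local Notation Z := 'rV[int]_d.
Implicit Types (x y : X) (n u v : Z) (i : 'I_d).

(* Displacement from [y] to the centre of the tile of [a n y]. *)
Definition cpos y n : Z := center (a n y) + n.

Definition tile y : seq Z := [seq n <- boxs d w | cpos y n == 0].

(** Each edge is charged to the end from which its flow leaves: a positive value at [n] sends tokens
    to [n - unitv i], a negative value at [n + unitv i] sends them from [n] to [n + unitv i]. *)
Definition tokens y n i : seq Z :=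
  nseq (posn (psi i (a n y))) (cpos y (n - unitv i)) ++
  nseq (negn (psi i (a (n + unitv i) y))) (cpos y (n + unitv i)).

(* The tiles to which the flow asks the tile of [y] to send a point, with multiplicity;
   the value [psi i x] is the flow from [x] to [a (- unitv i) x]. *)
Definition jobs y : seq Z :=
  [seq u <- flatten [seq flatten [seq tokens y n i | i <- enum 'I_d] | n <- tile y] | u != 0].

Definition listof (P : X -> bool) y : seq Z := [seq n <- tile y | P (a n y)].

Hypothesis enough : forall y, center y = 0 -> (size (jobs y) <= size (listof A y))%N.

(** Displacement to the centre of the destination tile. Points of [A] take the jobs of their tile in
    order; points without a job get the default 0 and keep their own tile. *)
Definition target x : Z := center x +
  nth 0 (jobs (a (center x) x)) (index (- center x) (listof A (a (center x) x))).

(** The window contains every possible sender, since targets have norm at most [3 * w + 1]. *)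
Definition received y : seq Z :=
  [seq n <- boxs d (4 * w).+1 | A (a n y) && (target (a n y) + n == 0)].

Definition move x : Z := target x +
  nth 0 (listof B (a (target x) x)) (index (- target x) (received (a (target x) x))).

Let cposD y u n : cpos (a u y) n = cpos y (n + u) - u.
Proof. by rewrite /cpos -actD addrA addrK. Qed.

Let nrm_cpos y n : (nrm (cpos y n) <= nrm n + w)%N.
Proof. by apply: leq_trans (nrmD _ _) _; rewrite addnC leq_add2l. Qed.

Let nrm_cposV y n : (nrm n <= nrm (cpos y n) + w)%N.
Proof.
have e : n = cpos y n - center (a n y) by rewrite /cpos addrC addKr.
by rewrite {1}e; apply: leq_trans (nrmB _ _) _; rewrite leq_add2l.
Qed.

Lemma mem_tile y n : (n \in tile y) = (cpos y n == 0).
Proof.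
rewrite mem_filter mem_boxs; case: eqP => //= e.
by have := nrm_cposV y n; rewrite e nrm0.
Qed.

Lemma tile_uniq y : uniq (tile y).
Proof. by rewrite filter_uniq // boxs_uniq. Qed.

Let center_tile y n : cpos y n = 0 -> center y = 0.
Proof. by move=> e; rewrite -(cc (a n y)) -actD -[center _ + n]/(cpos y n) e act0. Qed.

Let jobs_nrm y u : u \in jobs y -> (nrm u <= 2 * w + 1)%N.
Proof.
rewrite mem_filter => /andP[_ /flattenP[s /mapP[n]]].
rewrite mem_tile => /eqP hn -> /flattenP[t /mapP[i _ ->]].
have h0 : (nrm n <= w)%N by have := nrm_cposV y n; rewrite hn nrm0.
have h1 e : (nrm e <= 1)%N -> (nrm (cpos y (n + e)) <= 2 * w + 1)%N.
  move=> he; apply: leq_trans (nrm_cpos _ _) _.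
  by apply: leq_trans (leq_add (nrmD _ _) (leqnn w)) _; lia.
rewrite mem_cat !mem_nseq => /orP[|] /andP[_ /eqP ->]; apply: h1; rewrite ?nrmN; exact: nrm_unitv.
Qed.

Let nrm_target x : (nrm (target x) <= 3 * w + 1)%N.
Proof.
rewrite /target; set s := jobs _; set k := index _ _.
have h : (nrm (nth 0%R s k) <= 2 * w + 1)%N.
  have [hk|hk] := ltnP k (size s); last by rewrite nth_default // nrm0.
  by apply: jobs_nrm (mem_nth 0 hk).
by apply: leq_trans (nrmD _ _) _; have := nc x; lia.
Qed.

Let targetE y n : cpos y n = 0 ->
  target (a n y) + n = nth 0 (jobs y) (index n (listof A y)).
Proof.
move=> e; have ec : center (a n y) = - n by apply/eqP; rewrite -addr_eq0 -/(cpos y n) e.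
by rewrite /target ec opprK actN addrAC addNr add0r.
Qed.

Let nrm0w y n : cpos y n = 0 -> (nrm n <= w)%N.
Proof. by move=> e; have := nrm_cposV y n; rewrite e nrm0. Qed.

Let sum_tile (F : Z -> int) y w' : (w <= w')%N ->
  \sum_(n <- tile y) F n = \sum_(n <- boxs d w') (cpos y n == 0)%:Z * F n.
Proof.
move=> ww; have -> : \sum_(n <- tile y) F n = \sum_(n <- tile y) (cpos y n == 0)%:Z * F n.
  by apply: eq_big_seq => n; rewrite mem_tile => ->; rewrite mul1r.
apply: sum_supp => [||n]; [exact: tile_uniq|exact: boxs_uniq|].
rewrite mulf_eq0 negb_or mem_tile mem_boxs; have [e|e] //= := eqVneq (cpos y n) 0.
by rewrite (leq_trans (nrm0w e) ww).
Qed.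

Let sum_tile_shift (F : Z -> int) y u w' : (forall n, F n != 0 -> (nrm n <= w')%N) ->
  \sum_(n <- tile (a u y)) F (n + u) = \sum_(n <- boxs d w') (cpos y n == u)%:Z * F n.
Proof.
move=> hF; have -> : \sum_(n <- tile (a u y)) F (n + u) =
    \sum_(n <- [seq n + u | n <- tile (a u y)]) (cpos y n == u)%:Z * F n.
  rewrite big_map; apply: eq_big_seq => n; rewrite mem_tile cposD subr_eq0 => ->.
  by rewrite mul1r.
apply: sum_supp => [||n]; last first.
- rewrite mulf_eq0 negb_or mem_boxs; have [e|e] //= := eqVneq (cpos y n) u.
  move=> /hF ->; rewrite andbT.
  by apply/mapP; exists (n - u); rewrite ?subrK // mem_tile cposD subrK e subrr.
- exact: boxs_uniq.
- by rewrite map_inj_uniq ?tile_uniq //; apply: addIr.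
Qed.

Lemma count_jobs (P : pred Z) y : (count P (jobs y))%:Z = \sum_(n <- tile y) \sum_i
  ((posn (psi i (a n y)))%:Z * (P (cpos y (n - unitv i)) && (cpos y (n - unitv i) != 0))%:Z +
   (negn (psi i (a (n + unitv i) y)))%:Z *
     (P (cpos y (n + unitv i)) && (cpos y (n + unitv i) != 0))%:Z).
Proof.
rewrite /jobs count_filter; elim: (tile y) => [|n s IH]; first by rewrite big_nil.
rewrite /= count_cat PoszD IH big_cons; congr (_ + _); rewrite -[RHS]big_enum /=.
elim: (enum 'I_d) => [|i t IHt]; first by rewrite big_nil.
rewrite /= count_cat PoszD IHt big_cons; congr (_ + _).
by rewrite /tokens count_cat !count_nseq /= PoszD !PoszM ![_%:Z * (posn _)%:Z]mulrC
  ![_%:Z * (negn _)%:Z]mulrC.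
Qed.

Let out y : int := \sum_(n <- tile y) \sum_i
  ((posn (psi i (a n y)))%:Z * (cpos y (n - unitv i) != 0)%:Z +
   (negn (psi i (a (n + unitv i) y)))%:Z * (cpos y (n + unitv i) != 0)%:Z).

Let size_jobs y : (size (jobs y))%:Z = out y.
Proof. by rewrite -count_predT count_jobs. Qed.

Let inflow y : int := \sum_(n <- tile y) \sum_i
  ((posn (psi i (a (n + unitv i) y)))%:Z * (cpos y (n + unitv i) != 0)%:Z +
   (negn (psi i (a n y)))%:Z * (cpos y (n - unitv i) != 0)%:Z).

Let W := (4 * w).+1.

(** Double counting of the tokens addressed to the tile of [y]: they are listed at the sending end
    of an edge and recounted, after a unit shift, at the receiving end. *)
Let sum_jobs y : \sum_(u <- boxs d (W + w)) (count_mem (- u) (jobs (a u y)))%:Z = inflow y.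
Proof.
pose H u n : int := \sum_i
  ((posn (psi i (a n y)))%:Z * ((cpos y (n - unitv i) == 0) && (cpos y (n - unitv i) != u))%:Z +
   (negn (psi i (a (n + unitv i) y)))%:Z *
     ((cpos y (n + unitv i) == 0) && (cpos y (n + unitv i) != u))%:Z).
have E u : (count_mem (- u) (jobs (a u y)))%:Z = \sum_(n <- boxs d W) (cpos y n == u)%:Z * H u n.
  rewrite count_jobs -(sum_tile_shift (F := H u)) => [|n].
    apply: eq_bigr => n _; apply: eq_bigr => i _; rewrite -!actD !cposD.
    have eqs v : (v - u == - u) = (v == 0) by rewrite -subr_eq0 opprK subrK.
    have eqt v : (v - u != 0) = (v != u) by rewrite subr_eq0.
    by rewrite /= !eqs !eqt [n - _ + u]addrAC [n + _ + u]addrAC.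
  apply: contraNT; rewrite -ltnNge => hn; rewrite /H big1 // => i _.
  have hW e : (nrm e <= 1)%N -> cpos y (n + e) != 0.
    move=> he; apply/eqP => /nrm0w h; have := nrmD (n + e) (- e); rewrite addrK nrmN.
    by rewrite /W in hn; lia.
  by rewrite (negbTE (hW _ (nrm_unitv i))) (negbTE (hW (- unitv i) _)) ?nrmN ?nrm_unitv // !mulr0.
under eq_bigr do rewrite E.
rewrite exchange_big /=.
(* The sum over centres collapses, since [n] belongs only to the tile centred at [cpos y n]. *)
have -> : \sum_(n <- boxs d W) \sum_(u <- boxs d (W + w)) (cpos y n == u)%:Z * H u n =
    \sum_(n <- boxs d W) H (cpos y n) n.
  apply: eq_big_seq => n; rewrite mem_boxs => hn.
  rewrite -(sum_delta (H (cpos y n) n) (boxs_uniq d (W + w)) (u := cpos y n)).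
    apply: eq_bigr => u _; case: eqP => [->|]; by rewrite ?mul0r.
  by rewrite mem_boxs; apply: leq_trans (nrm_cpos _ _) _; rewrite leq_add2r.
rewrite /inflow /H [RHS]exchange_big [LHS]exchange_big /=; apply: eq_bigr => i _.
rewrite big_split [RHS]big_split /=; congr (_ + _).
- pose F n := (posn (psi i (a (n + unitv i) y)))%:Z *
    ((cpos y n == 0) && (cpos y n != cpos y (n + unitv i)))%:Z.
  have hF n : F n != 0 -> (nrm n <= w)%N.
    by rewrite /F; have [/nrm0w //|_] := eqVneq (cpos y n) 0; rewrite /= mulr0 eqxx.
  transitivity (\sum_(n <- boxs d W) F (n + - unitv i)).
    by apply: eq_bigr => n _; rewrite /F subrK.
  rewrite (sum_boxs_shift hF) ?nrmN; last by have := nrm_unitv i; rewrite /W; lia.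
  rewrite (@sum_tile _ y W); last by rewrite /W; lia.
  apply: eq_bigr => n _; rewrite /F mulrCA; case: eqP => [->|_] /=.
    by rewrite mul1r eq_sym.
  by rewrite mul0r mulr0.
- pose F n := (negn (psi i (a n y)))%:Z *
    ((cpos y n == 0) && (cpos y n != cpos y (n - unitv i)))%:Z.
  have hF n : F n != 0 -> (nrm n <= w)%N.
    by rewrite /F; have [/nrm0w //|_] := eqVneq (cpos y n) 0; rewrite /= mulr0 eqxx.
  transitivity (\sum_(n <- boxs d W) F (n + unitv i)).
    by apply: eq_bigr => n _; rewrite /F addrK.
  rewrite (sum_boxs_shift hF); last by have := nrm_unitv i; rewrite /W; lia.
  rewrite (@sum_tile _ y W); last by rewrite /W; lia.
  apply: eq_bigr => n _; rewrite /F mulrCA; case: eqP => [->|_] /=.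
    by rewrite mul1r eq_sym.
  by rewrite mul0r mulr0.
Qed.

Let size_listof (P : X -> bool) y :
  (size (listof P y))%:Z = \sum_(n <- tile y) (P (a n y))%:Z.
Proof. exact: size_filterZ. Qed.

(** Discrete divergence theorem: edges with both ends in the tile cancel after a unit shift, which
    leaves the flow across its boundary. *)
Let balance y : (size (listof A y))%:Z - (size (listof B y))%:Z = out y - inflow y.
Proof.
rewrite !size_listof -sumrB.
under eq_bigr do rewrite psi_div.
rewrite /out /inflow -sumrB.
transitivity (\sum_(n <- tile y) \sum_i
    (psi i (a n y) * (cpos y (n - unitv i) != 0)%:Z -
     psi i (a (n + unitv i) y) * (cpos y (n + unitv i) != 0)%:Z)); last first.
  apply: eq_bigr => n _; rewrite -sumrB; apply: eq_bigr => i _.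
  rewrite -{1}(posn_negn (psi i (a n y))) -{1}(posn_negn (psi i (a (n + unitv i) y))).
  ring.
apply/eqP; rewrite -subr_eq0 -sumrB; apply/eqP.
transitivity (\sum_(n <- tile y) \sum_i
    (psi i (a n y) * (cpos y (n - unitv i) == 0)%:Z -
     psi i (a (n + unitv i) y) * (cpos y (n + unitv i) == 0)%:Z)).
  apply: eq_bigr => n _; rewrite -sumrB; apply: eq_bigr => i _.
  rewrite -actD [unitv i + n]addrC.
  by case: (cpos y (n - unitv i) == 0); case: (cpos y (n + unitv i) == 0) => /=; ring.
rewrite exchange_big big1 //= => i _; rewrite sumrB; apply/eqP; rewrite subr_eq0; apply/eqP.
rewrite !(@sum_tile _ y W); try by rewrite /W; lia.
pose F n := (cpos y n == 0)%:Z * (psi i (a n y) * (cpos y (n - unitv i) == 0)%:Z).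
have hF n : F n != 0 -> (nrm n <= w)%N.
  by rewrite /F; have [/nrm0w //|_] := eqVneq (cpos y n) 0; rewrite /= mul0r eqxx.
rewrite -[LHS](sum_boxs_shift hF (u := unitv i)); last by have := nrm_unitv i; rewrite /W; lia.
apply: eq_bigr => n _; rewrite /F addrK; ring.
Qed.

(** The tile keeps its points of [A] minus the outgoing tokens and gains the incoming ones; by
    [balance] this is its number of points of [B]. The hypothesis [enough] guarantees a carrier for
    every token. *)
Let size_received y : center y = 0 -> size (received y) = size (listof B y).
Proof.
move=> cy; apply/eqP; rewrite -eqz_nat; apply/eqP; rewrite size_filterZ.
pose F n : int := (A (a n y) && (target (a n y) + n == 0))%:Z.
rewrite -/(\sum_(n <- boxs d W) F n).
transitivity (\sum_(u <- boxs d (W + w)) \sum_(n <- boxs d W) (cpos y n == u)%:Z * F n).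
  rewrite exchange_big /=; apply: eq_big_seq => n; rewrite mem_boxs => hn.
  rewrite sum_delta ?boxs_uniq // mem_boxs; apply: leq_trans (nrm_cpos _ _) _.
  by rewrite leq_add2r.
have hF n : F n != 0 -> (nrm n <= W)%N.
  rewrite /F; case: (A _) => //=; rewrite addr_eq0; have [e _|//] := eqVneq (target (a n y)) (- n).
  by rewrite -nrmN -e; apply: leq_trans (nrm_target _) _; rewrite /W; lia.
have E u : \sum_(n <- boxs d W) (cpos y n == u)%:Z * F n =
    (count_mem (- u) (jobs (a u y)))%:Z +
    (u == 0)%:Z * ((size (listof A (a u y)))%:Z - (size (jobs (a u y)))%:Z).
  rewrite -(@sum_tile_shift F y u W hF).
  have [ce|ce] := eqVneq (center (a u y)) 0; last first.
    have T0 : tile (a u y) = [::].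
      case T : (tile (a u y)) => [//|n s]; have : n \in tile (a u y) by rewrite T inE eqxx.
      by rewrite mem_tile => /eqP/center_tile/eqP; rewrite (negbTE ce).
    rewrite T0 big_nil /listof /jobs T0 /= subrr mulr0 addr0 //.
  have e0 : (u == 0) = (0 == - u) by rewrite [RHS]eq_sym oppr_eq0.
  rewrite e0 -sum_nth_index; [|by rewrite filter_uniq // tile_uniq|exact: enough].
  rewrite [X in _ = \big[_/_]_(_ <- X) _]/listof big_filter [RHS]big_mkcond /=.
  apply: eq_big_seq => n; rewrite mem_tile => /eqP cn.
  by rewrite /F actD; case: (A _) => //=; rewrite addrA (targetE cn) addr_eq0.
under eq_bigr do rewrite E.
rewrite big_split /= sum_jobs.
have -> : \sum_(u <- boxs d (W + w))
    (u == 0)%:Z * ((size (listof A (a u y)))%:Z - (size (jobs (a u y)))%:Z) =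
    (size (listof A y))%:Z - out y.
  rewrite -size_jobs -[RHS](sum_delta _ (boxs_uniq d (W + w)) (u := 0)); last first.
    by rewrite mem_boxs nrm0.
  apply: eq_bigr => u _; rewrite eq_sym; case: eqP => [<-|_]; last by rewrite !mul0r.
  by rewrite act0.
by have := balance y; lia.
Qed.

Let nthE x (s := listof B (a (target x) x)) : A x ->
  let m := nth 0 s (index (- target x) (received (a (target x) x))) in
  center (a (target x) x) = 0 /\ m \in s.
Proof.
move=> Ax m; set y := a (target x) x.
have cy : center y = 0.
  rewrite /y /target; set z := a (center x) x; set k := index _ _.
  rewrite addrC actD -/z.
  have [hk|hk] := ltnP k (size (jobs z)); last by rewrite nth_default // act0 cc.
  have := mem_nth 0 hk; move: (nth 0 _ k) => u.
  rewrite mem_filter => /andP[_ /flattenP[t /mapP[n _ ->]]].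
  move=> /flattenP[t' /mapP[i _ ->]]; rewrite mem_cat !mem_nseq.
  by move=> /orP[|] /andP[_ /eqP ->]; rewrite /cpos actD cc.
split => //; rewrite /m /s mem_nth // -size_received // index_mem.
rewrite mem_filter actN Ax subrr eqxx mem_boxs nrmN /=.
by apply: leq_trans (nrm_target _) _; lia.
Qed.

Let moveE x m : center (a (target x) x) = 0 -> m \in listof B (a (target x) x) ->
  move x = target x + m -> center (a (move x) x) = - m.
Proof.
move=> cy; rewrite mem_filter mem_tile => /andP[_ /eqP cm] ->.
by rewrite (addrC (target x) m) (actD a m (target x) x); apply/eqP; rewrite -addr_eq0 -/(cpos _ m) cm.
Qed.

Lemma exists_matching : exists (mv : X -> 'rV[int]_d) (N : nat),
  [/\ cmeas mv, forall x, (nrm (mv x) <= N)%N,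
      forall x, A x -> B (a (mv x) x),
      forall x n, A x -> A (a n x) -> mv x = mv (a n x) + n -> n = 0
    & forall y, B y -> exists n, A (a n y) /\ mv (a n y) + n = 0].
Proof.
have mcpos n : cmeas (fun y => cpos y n).
  by apply: (cmeas_comp (fun u : Z => u + n)); apply: cmeas_act.
have mtile : cmeas tile.
  by apply: cmeas_filter => n; apply: (meas_cpre (P := fun u _ => u == 0)) => // u; apply: meas_const.
have mlist (P : X -> bool) : measurable [set x | P x] -> cmeas (listof P).
  move=> mP; apply: (@cmeas_bind _ _ (seq Z) _ tile
    (fun t y => [seq n <- t | P (a n y)])) => // t.
  by apply: cmeas_filter => n; apply: (meas_act a n (P := P)).
have mtok n i : cmeas (fun y => tokens y n i).
  apply: (cmeas_comp2 (fun s t : seq Z => s ++ t)).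
    apply: (cmeas_comp2 (fun k (u : Z) => nseq (posn k) u)) => //.
    exact: (cmeas_act a n (mpsi i)).
  apply: (cmeas_comp2 (fun k (u : Z) => nseq (negn k) u)) => //.
  exact: (cmeas_act a _ (mpsi i)).
have mjobs : cmeas jobs.
  apply: (cmeas_comp (fun t : seq Z => [seq u <- t | u != 0])).
  apply: (cmeas_comp (fun t : seq (seq Z) => flatten t)).
  apply: (@cmeas_bind _ _ (seq Z) _ tile
    (fun t y => [seq flatten [seq tokens y n i | i <- enum 'I_d] | n <- t])) => // t.
  apply: cmeas_map => n; apply: (cmeas_comp (fun t : seq (seq Z) => flatten t)).
  by apply: (@cmeas_map _ _ 'I_d (seq Z) (fun i y => tokens y n i)).
have mtarget : cmeas target.
  apply: (@cmeas_bind _ _ Z _ center (fun c x => c +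
    nth 0 (jobs (a c x)) (index (- c) (listof A (a c x))))) => // c.
  apply: (cmeas_comp2 (fun s t : seq Z => c + nth 0 s (index (- c) t))).
    exact: (cmeas_act a c mjobs).
  exact: (cmeas_act a c (mlist A mA)).
have mrec : cmeas received.
  apply: cmeas_filter => n.
  have -> : [set x | A (a n x) && (target (a n x) + n == 0)] =
      [set x | A (a n x) /\ target (a n x) = - n].
    by apply/seteqP; split => x /=; rewrite addr_eq0; [move=> /andP[? /eqP]|move=> [-> ->]; rewrite eqxx].
  apply: (meas_act a n (P := fun x => A x /\ target x = - n)).
  by apply: meas_and => //; apply: mtarget.
have mmove : cmeas move.
  apply: (@cmeas_bind _ _ Z _ target (fun c x => c +
    nth 0 (listof B (a c x)) (index (- c) (received (a c x))))) => // c.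
  apply: (cmeas_comp2 (fun s t : seq Z => c + nth 0 s (index (- c) t))).
    exact: (cmeas_act a c (mlist B mB)).
  exact: (cmeas_act a c mrec).
exists move, (4 * w + 1)%N; split => //.
- move=> x; rewrite /move; set s := listof B _; set k := index _ _.
  have h : (nrm (nth 0%R s k) <= w)%N.
    have [hk|hk] := ltnP k (size s); last by rewrite nth_default // nrm0.
    by have := mem_nth 0 hk; rewrite mem_filter mem_tile => /andP[_ /eqP/nrm0w].
  by apply: leq_trans (nrmD _ _) _; have := nrm_target x; lia.
- move=> x Ax; have [cy] := nthE Ax; rewrite /move; move: (nth _ _ _) => m.
  by rewrite mem_filter (addrC (target x) m) (actD a m (target x) x) => /andP[].
(* A common image determines the receiving tile and the place in its list of points of [B], hence
   the place in [received], hence the sender. *)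
- move=> x n Ax An e; have [cy my] := nthE Ax; have [cy' my'] := nthE An.
  have c1 := moveE cy my erefl; have c2 := moveE cy' my' erefl.
  have ez : a (move x) x = a (move (a n x)) (a n x) by rewrite e (actD a (move (a n x)) n x).
  rewrite ez c2 in c1; move/oppr_inj: c1 => em.
  have et : target x = target (a n x) + n.
    have aux (t1 t2 u m : Z) : t1 + u = t2 + u + m -> t1 = t2 + m.
      by move=> h; apply: (addIr u); rewrite h addrAC.
    by move: e; rewrite /move em; apply: aux.
  have ey : a (target x) x = a (target (a n x)) (a n x) by rewrite et (actD a (target (a n x)) n x).
  rewrite ey in em my *.
  have Bu : uniq (listof B (a (target (a n x)) (a n x))) by rewrite filter_uniq // tile_uniq.
  have rec z : A z -> - target z \in received (a (target z) z).
    move=> Az; rewrite mem_filter actN Az subrr eqxx mem_boxs nrmN /=.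
    by apply: leq_trans (nrm_target _) _; lia.
  have i1 := rec x Ax; have i2 := rec (a n x) An; rewrite ey in i1.
  have /eqP := em; rewrite nth_uniq // -?size_received ?index_mem // => /eqP ei.
  have := congr1 (nth 0 (received (a (target (a n x)) (a n x)))) ei.
  rewrite !nth_index // => /oppr_inj; rewrite et => /eqP.
  by rewrite eq_sym addrC -subr_eq0 addrK => /eqP.
- move=> y By; set z := a (center y) y; have cz : center z = 0 by rewrite cc.
  have mB' : - center y \in listof B z.
    by rewrite mem_filter actN By mem_tile /cpos actN subrr eqxx.
  set k := index (- center y) (listof B z).
  have hk : (k < size (received z))%N by rewrite size_received // index_mem.
  set n := nth 0 (received z) k.
  have : n \in received z by apply: mem_nth.
  rewrite mem_filter => /andP[/andP[An /eqP tn] _].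
  exists (n + center y); rewrite actD -/z; split => //.
  have et : target (a n z) = - n by apply/eqP; rewrite -addr_eq0 tn.
  rewrite /move et actN opprK index_uniq ?filter_uniq ?boxs_uniq // nth_index //.
  by rewrite addrACA addNr addNr addr0.
Qed.

End Matching.

(** * Equidecomposition for abstract actions of small discrepancy *)

Section Shell.
Context (d : nat).

Lemma leq_expD (x y n : nat) : (x <= y -> y ^ n <= x ^ n + n * (y - x) * y ^ n.-1)%N.
Proof.
move=> xy; elim: n => [|n IH]; first by rewrite mul0n addn0.
have xyn : (x ^ n <= y ^ n)%N by case: n {IH} => [|n] //; rewrite leq_exp2r.
rewrite /= [(y ^ n.+1)%N]expnS [(x ^ n.+1)%N]expnS.
have h1 : (y * y ^ n = (y - x) * y ^ n + x * y ^ n)%N by rewrite -mulnDl subnK.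
have h2 : (x * y ^ n <= x * x ^ n + n * (y - x) * y ^ n)%N.
  case: n IH {xyn h1} => [|n] /= IH; first by rewrite mul0n addn0.
  apply: leq_trans (leq_mul (leqnn x) IH) _; rewrite mulnDr leq_add2l.
  by rewrite expnS mulnCA leq_mul2l leq_mul2r xy !orbT.
rewrite h1 addnC; apply: leq_trans (leq_add h2 (leqnn _)) _.
by rewrite -addnA leq_add2l -mulnDl -mulSnr.
Qed.

Definition shell (rho : nat) : seq 'rV[int]_d := [seq u <- boxs d rho.+1 | (rho <= nrm u)%N].

Lemma size_shell rho : (0 < rho)%N -> (size (shell rho) <= d * 4 * (2 * rho + 3) ^ d.-1)%N.
Proof.
move=> rho0; have := size_boxs d rho.+1.
rewrite -(count_predC (fun u => rho <= nrm u)%N) -size_filter -/(shell rho).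
have -> : count (predC (fun u => rho <= nrm u)%N) (boxs d rho.+1) = size (boxs d rho.-1).
  rewrite -size_filter; apply: perm_size; apply: uniq_perm; rewrite ?filter_uniq ?boxs_uniq //.
  by move=> u; rewrite mem_filter !mem_boxs /=; lia.
rewrite size_boxs => e.
have -> : (2 * rho + 3 = (2 * rho.+1).+1)%N by lia.
have := @leq_expD (2 * rho.-1).+1 (2 * rho.+1).+1 d; rewrite -e.
have -> : ((2 * rho.+1).+1 - (2 * rho.-1).+1 = 4)%N by lia.
by move=> /(_ ltac:(lia)); lia.
Qed.

(** Pigeonhole: the window is covered by [4 ^ d] cubes of side [2 * r + 1], each holding at most one
    point of a separated set. *)
Lemma size_separated (s : seq 'rV[int]_d) (w r : nat) : uniq s ->
  (forall u v, u \in s -> v \in s -> (nrm (u - v)%R <= 2 * r)%N -> u = v) ->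
  (forall u, u \in s -> (nrm u <= w)%N) -> (2 * w < 4 * (2 * r).+1)%N -> (size s <= 4 ^ d)%N.
Proof.
move=> us sepu su hw.
pose f (u : 'rV[int]_d) : {ffun 'I_d -> 'I_4} :=
  [ffun i => inord (absz (u 0%R i + w%:Z) %/ (2 * r).+1)].
have inj : {in s &, injective f}.
  move=> u v us' vs' /ffunP h; apply: sepu => //; apply/nrm_leP => i; rewrite rvB.
  have hu := leq_trans (nrm_coord u i) (su u us'); have hv := leq_trans (nrm_coord v i) (su v vs').
  have := h i; rewrite !ffunE => /(congr1 val).
  move: (u 0 i) (v 0 i) hu hv => p q hu hv.
  have b (z : int) : (`|z| <= w)%N -> (absz (z + w%:Z)%R %/ (2 * r).+1 < 4)%N.
    by move=> hz; rewrite ltn_divLR //; lia.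
  rewrite /= !inordK ?b //.
  have := divn_eq (absz (p + w%:Z)%R) (2 * r).+1; have := divn_eq (absz (q + w%:Z)%R) (2 * r).+1.
  have := ltn_pmod (absz (p + w%:Z)%R) (ltn0Sn (2 * r)); have := ltn_pmod (absz (q + w%:Z)%R) (ltn0Sn (2 * r)).
  move=> m1 m2 e1 e2 e; rewrite e in e2; lia.
have -> : (4 ^ d)%N = size (enum {ffun 'I_d -> 'I_4}) by rewrite -cardE card_ffun !card_ord.
rewrite -(size_map f).
by apply: uniq_leq_size => [|g _]; [rewrite map_inj_in_uniq|rewrite mem_enum].
Qed.

End Shell.

Section AbstractTheorem.
Context (d : nat) (disp : measure_display) (X : measurableType disp) (a : zaction d X).
Context (R : realType) (A B : X -> bool) (C mu : R).
Hypotheses (d3 : (2 < d)%N) (sep : separable a) (mu_gt0 : 0 < mu).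
Hypotheses (mA : measurable [set x | A x]) (mB : measurable [set x | B x]).
Hypothesis hA : forall x j,
  `|\sum_(v <- cube d (2 ^ j)) (A (a v x))%:R - mu * 2 ^+ (j * d)| <= C * 2 ^+ (j * d) / 4 ^+ j.
Hypothesis hB : forall x j,
  `|\sum_(v <- cube d (2 ^ j)) (B (a v x))%:R - mu * 2 ^+ (j * d)| <= C * 2 ^+ (j * d) / 4 ^+ j.

Let flow : exists (psi : 'I_d -> X -> int) (M : nat),
  [/\ forall i, cmeas (psi i), forall i x, (`|psi i x| <= M)%N
    & forall x, (A x)%:Z - (B x)%:Z = \sum_i (psi i x - psi i (a (unitv i) x))].
Proof.
have mb (P : X -> bool) : measurable [set x | P x] -> measurable_fun setT (fun x => (P x)%:R : R).
  move=> mP; apply: (@measurable_bind _ _ R bool P (fun (b : bool) _ => b%:R)).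
    exact: cmeas_boolP.
  by move=> b; apply: measurable_cst.
pose f x : R := (A x)%:R - (B x)%:R.
have mf : measurable_fun setT f by apply: measurable_funB; apply: mb.
have hf x j : `|\sum_(v <- cube d (2 ^ j)) f (a v x)| <= (2 * C) * 2 ^+ (j * d) / 4 ^+ j.
  rewrite sumrB; have := hA x j; have := hB x j.
  move: (\sum_(v <- _) (A _)%:R) (\sum_(v <- _) (B _)%:R) => p q; rewrite -!mulrA.
  move: (mu * _) (C * _) => s t; rewrite !ler_norml; lra.
have [phi [mphi phi_le phi_div]] := exists_real_flow mf hf.
apply: (exists_integer_flow sep d3 mphi phi_le) => x.
by rewrite -phi_div /f rmorphB /= -!pmulrn.
Qed.

Lemma abstract_equidecomposition : exists (mv : X -> 'rV[int]_d) (N : nat),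
  [/\ cmeas mv, forall x, (nrm (mv x) <= N)%N,
      forall x, A x -> B (a (mv x) x),
      forall x n, A x -> A (a n x) -> mv x = mv (a n x) + n -> n = 0
    & forall y, B y -> exists n, A (a n y) /\ mv (a n y) + n = 0].
Proof.
have [psi [M [mpsi psi_le psi_div]]] := flow.
(* A boundary point of a tile emits at most [2 * d * M] tokens. Boundary points lie on shells around
   at most [4 ^ d] centres, two shells each, and a shell has at most [d * 4 * (7 * r) ^ d.-1]
   points. *)
pose K : nat := (2 * d * M * (4 ^ d * (2 * (d * 4 * 7 ^ d.-1))))%N.
have [j [hj1 hj2]] : exists j : nat, C / 4 ^+ j <= mu / 2 /\ K%:R <= mu / 2 * 2 ^+ j.
  exists (Num.bound (2 * `|C| / mu) + Num.bound (2 * K%:R / mu))%N.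
  set j1 := Num.bound _; set j2 := Num.bound _.
  have b2 n : n%:R <= 2 ^+ n :> R by rewrite -natrX ler_nat; apply/ltnW/ltn_expl.
  have p2 n : 1 <= 2 ^+ n :> R by rewrite exprn_ege1 // ler1n.
  have h1 : 2 * `|C| / mu < j1%:R.
    by apply: archi_boundP; rewrite divr_ge0 ?mulr_ge0 // ltW.
  have h2 : 2 * K%:R / mu < j2%:R.
    by apply: archi_boundP; rewrite divr_ge0 ?mulr_ge0 // ltW.
  split; last first.
    have h3 : 2 * K%:R / mu <= 2 ^+ (j1 + j2).
      apply: (le_trans (ltW h2)); apply: (le_trans (b2 _)).
      by rewrite exprD ler_peMl // exprn_ge0.
    by move: h3; rewrite ler_pdivrMr //; lra.
  have h3 : 2 * `|C| / mu <= 4 ^+ (j1 + j2).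
    apply: (le_trans (ltW h1)); apply: (le_trans (b2 _)).
    have -> : (4 : R) = 2 * 2 by ring.
    rewrite exprMn exprD -mulrA ler_peMr ?exprn_ge0 // mulrC.
    by rewrite mulr_ege1 // mulr_ege1.
  rewrite ler_pdivrMr ?exprn_gt0 //; apply: (le_trans (ler_norm _)).
  move: h3; rewrite ler_pdivrMr //; move: (4 ^+ _) => t; lra.
pose r := (2 ^ j)%N; have r0 : (0 < r)%N by rewrite expn_gt0.
have [D [center [sepD mc cD cuniq cbd]]] := exists_tiling r0 sep.
have cc x : center (a (center x) x) = 0.
  by apply: cuniq; rewrite ?nrm0 // act0; case: (cD x).
apply: (exists_matching (w := 2 * r) mc _ cc mA mB mpsi psi_div) => [x|y cy].
  by case: (cD x).
have mt := mem_tile a (fun x => (cD x).2).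
set J := size (jobs _ _ _ _ _); set L := size (listof _ _ _ _ _).
(* The tile contains the ball of radius [r] around its centre, hence a cube of side [r = 2 ^ j], in
   which the density of [A] is at least [mu / 2]. *)
have hL : mu / 2 * 2 ^+ (j * d) <= L%:R.
  have : \sum_(v <- cube d r) (A (a v y))%:R <= L%:R :> R.
    rewrite -natr_sum ler_nat; apply: leq_trans (_ : size [seq v <- cube d r | A (a v y)] <= _)%N.
      by rewrite size_filter -sum1_count [leqRHS]big_mkcond /=; apply: leq_sum => v _; case: (A _).
    apply: uniq_leq_size => [|n]; first by rewrite filter_uniq // cube_uniq.
    rewrite mem_filter => /andP[An /cube_sub_boxs]; rewrite mem_boxs => hn.
    rewrite mem_filter An mt /cpos (cuniq _ (- n)) ?addNr ?nrmN ?eqxx //.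
    by rewrite actN -[y](act0 a) -cy; case: (cD y).
  move=> h; apply: le_trans h; have := hA y j; rewrite -mulrA -/r.
  have h4 : C * (2 ^+ (j * d) / 4 ^+ j) <= mu / 2 * 2 ^+ (j * d).
    by rewrite mulrCA [leRHS]mulrC; apply: ler_wpM2l; rewrite ?exprn_ge0.
  move: (\sum_(v <- _) _) h4 => p; move: (C * _) => q; rewrite ler_norml.
  move: (2 ^+ _) => t; lra.
have hJ : (J <= K * r ^ d.-1)%N.
  pose bd n := [exists i, (cpos a center y (n - unitv i) != 0) || (cpos a center y (n + unitv i) != 0)].
  have h1 : (J <= 2 * d * M * size [seq n <- tile a (2 * r) center y | bd n])%N.
    rewrite -lez_nat /J -count_predT count_jobs PoszM size_filterZ big_distrr /=.
    apply: ler_sum => n _.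
    apply: le_trans (_ : \sum_(i < d) (2 * M * bd n)%:Z <= _); last first.
      rewrite sumr_const card_ord -mulr_natr natz -!PoszM lez_nat.
      by rewrite [(2 * d)%N]mulnC -!mulnA [leqRHS]mulnC -!mulnA.
    apply: ler_sum => i _.
    have b1 : ((cpos a center y (n - unitv i) != 0%R) <= bd n)%N.
      by case: eqP => //= /eqP e; rewrite lt0b; apply/existsP; exists i; rewrite e.
    have b2 : ((cpos a center y (n + unitv i) != 0%R) <= bd n)%N.
      by case: eqP => //= /eqP e; rewrite lt0b; apply/existsP; exists i; rewrite e orbT.
    have p1 := psi_le i (a n y); have p2 := psi_le i (a (n + unitv i) y).
    have q1 : (posn (psi i (a n y)) <= M)%N by case: (psi i (a n y)) p1 => k /=; lia.
    have q2 : (negn (psi i (a (n + unitv i)%R y)) <= M)%N.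
      by case: (psi i (a (n + unitv i) y)) p2 => k /=; lia.
    rewrite -!PoszM -PoszD lez_nat mul2n -addnn mulnDl; apply: leq_add; exact: leq_mul.
  apply: leq_trans h1 _; rewrite /K -!mulnA 3?leq_mul2l; do 3! (apply/orP; right).
  (* A boundary point is within [2 * r] of [y] and within [2 * r + 1] of the centre responsible for
     it. *)
  pose Cs := [seq c <- boxs d (4 * r).+1 | `[< D (a c y) >]].
  have hCs : (size Cs <= 4 ^ d)%N.
    apply: (@size_separated d Cs (4 * r).+1 r) => [|u v|u|].
    - by rewrite filter_uniq // boxs_uniq.
    - rewrite !mem_filter => /andP[/asboolP Du _] /andP[/asboolP Dv _] huv.
      apply/eqP; rewrite -subr_eq0; apply/eqP.
      by apply: (sepD (a v y)) => //; rewrite -actD subrK.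
    - by rewrite mem_filter mem_boxs => /andP[].
    - lia.
  have hsub : {subset [seq n <- tile a (2 * r) center y | bd n] <=
      [seq c - u | c <- Cs, u <- shell d r ++ shell d (2 * r)]}.
    move=> n; rewrite mem_filter => /andP[/existsP[i hi]].
    rewrite mt => /eqP cn.
    have key e : (nrm e <= 1)%N -> cpos a center y (n + e) != 0 ->
        n \in [seq c - u | c <- Cs, u <- shell d r ++ shell d (2 * r)].
      move=> he hne; have [|u [rho [hrho Du hu]]] := cbd (a n y) e he.
        rewrite /same -actD [e + n]addrC => e1.
        by move/eqP: hne; apply; rewrite /cpos addrCA -e1 addrC.
      apply/allpairsP; exists (u + n, u) => /=; split; last by rewrite addrAC subrr add0r.
        rewrite mem_filter actD; apply/andP; split; first exact/asboolP.
        rewrite mem_boxs; apply: leq_trans (nrmD _ _) _.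
        have hn : (nrm n <= 2 * r)%N.
          have -> : n = - center (a n y) by apply/eqP; rewrite -addr_eq0 addrC -/(cpos a center y n) cn.
          by rewrite nrmN; case: (cD (a n y)).
        have : (rho <= 2 * r)%N by move: hrho; rewrite !inE => /orP[] /eqP ->; lia.
        by move: hu hn; move: (nrm u) (nrm n) => p q; lia.
      rewrite mem_cat !mem_filter !mem_boxs.
      by move: hrho; rewrite !inE => /orP[] /eqP <-; case/andP: hu => -> ->; rewrite ?orbT.
    by case/orP: hi => h; [apply: (key (- unitv i))|apply: (key (unitv i))]; rewrite ?nrmN ?nrm_unitv.
  apply: leq_trans (uniq_leq_size _ hsub) _.
    by rewrite filter_uniq //; apply: tile_uniq.
  rewrite size_allpairs size_cat.
  have s1 := size_shell d r0; have s2 : (size (shell d (2 * r)) <= d * 4 * (2 * (2 * r) + 3) ^ d.-1)%N.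
    by apply: size_shell; lia.
  have e1 : ((2 * r + 3) ^ d.-1 <= (7 * r) ^ d.-1)%N.
    by case: d.-1 => [|k] //; rewrite leq_exp2r //; lia.
  have e2 : ((2 * (2 * r) + 3) ^ d.-1 <= (7 * r) ^ d.-1)%N.
    by case: d.-1 => [|k] //; rewrite leq_exp2r //; lia.
  apply: leq_mul => //; rewrite -expnMn [(2 * (d * _))%N]mul2n -addnn (mulnA d 4).
  have f1 := leq_mul (leqnn (d * 4)%N) e1; have f2 := leq_mul (leqnn (d * 4)%N) e2.
  by apply: leq_add; [exact: (leq_trans s1 f1)|exact: (leq_trans s2 f2)].
rewrite -(ler_nat R); apply: le_trans hL; apply: le_trans (_ : K%:R * (r ^ d.-1)%:R <= _).
  by rewrite -natrM ler_nat.
apply: le_trans (ler_wpM2r _ hj2) _ => //.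
rewrite natrX /r natrX -exprM -(mulrA (mu / 2)) -exprD -mulnS prednK //.
by apply: leq_trans d3.
Qed.

End AbstractTheorem.

(** * Second moments over a prime field *)

Section SecondMoment.
Context (R : realType) (p d k : nat).
Hypothesis p_pr : prime p.
Local Notation K := 'F_p.
Implicit Types (a : 'M[K]_(d, k)) (n : 'rV[int]_d).

Definition modp n : 'rV[K]_d := map_mx intr n.

Lemma modp_inj N : (N <= p)%N -> {in cube d N &, injective modp}.
Proof.
move=> Np n m /mem_cube hn /mem_cube hm /rowP h; apply/rowP => i.
have := h i; rewrite !mxE; have := hn i; have := hm i.
case: (n 0 i) => [x|//]; case: (m 0 i) => [y|//] hy hx.
rewrite -!pmulrn => /(congr1 (fun t : K => (t : nat))); rewrite !val_Fp_nat //.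
by rewrite !modn_small //; [move=> ->|lia|lia].
Qed.

Section Shift.
Context (F : 'rV[K]_k -> R) (H : 'rV[K]_k -> R).

(* Translating [a] by [c *m w] moves [u *m a] by [w] and fixes [v *m a]. *)
Lemma sum_independent (u v : 'rV[K]_d) (c : 'cV[K]_d) : u *m c = 1%:M -> v *m c = 0 ->
  \sum_w F w = 0 -> \sum_(a : 'M[K]_(d, k)) F (u *m a) * H (v *m a) = 0.
Proof.
move=> uc vc F0; set S := \sum_a _.
have E w : S = \sum_(a : 'M[K]_(d, k)) F (u *m a + w) * H (v *m a).
  rewrite /S (reindex_inj (addIr (c *m w))) /=; apply: eq_bigr => a _.
  by rewrite !mulmxDr !mulmxA uc vc mul1mx mul0mx addr0.
have : \sum_(w : 'rV[K]_k) S = 0.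
  under eq_bigr => w _ do rewrite (E w).
  rewrite exchange_big /= big1 // => a _; rewrite -mulr_suml.
  have := F0; rewrite (reindex_inj (addrI (u *m a))) /= => ->; exact: mul0r.
move/eqP; rewrite sumr_const mulrn_eq0 => /orP[|/eqP //].
by rewrite -leqn0 leqNgt => /negP[]; apply/card_gt0P; exists 0.
Qed.

End Shift.

Definition dependent (u v : 'rV[K]_d) := [exists l : K, u == l *: v].

Lemma independent_dual (u v : 'rV[K]_d) : ~~ dependent u v ->
  exists c : 'cV[K]_d, u *m c = 1%:M /\ v *m c = 0.
Proof.
move=> nd; have mulE (w : 'rV[K]_d) (c : 'cV[K]_d) : w *m c = (\sum_i w 0 i * c i 0)%:M.
  by apply/matrixP => x y; rewrite !mxE !ord1 eqxx mulr1n; apply: eq_bigr => i _.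
have delta (w : 'rV[K]_d) i (x : K) : \sum_j w 0 j * (x *: delta_mx i 0 : 'cV[K]_d) j 0 = x * w 0 i.
  rewrite (bigD1 i) //= !mxE !eqxx /= mulr1 mulrC big1 ?addr0 // => j ji.
  by rewrite !mxE (negbTE ji) /= mulr0 mulr0.
have [v0|[l vl]] : v = 0 \/ exists l, v 0 l != 0.
  have [e|/eqP e] := pselect (v = 0); first by left.
  right; apply: contrapT => h; case/eqP: e; apply/rowP => i; rewrite mxE.
  by apply/eqP/negP => hi; apply: h; exists i; apply/negP.
  have [i ui] : exists i, u 0 i != 0.
    apply: contrapT => h; case/negP: nd; apply/existsP; exists 0; rewrite scale0r.
    by apply/eqP/rowP => i; rewrite mxE; apply/eqP/negP => hi; apply: h; exists i; apply/negP.
  exists ((u 0 i)^-1 *: delta_mx i 0); rewrite !mulE !delta v0 mxE mulr0 mulVf //.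
  by split => //; apply/matrixP => x y; rewrite !mxE mul0rn.
have [i hi] : exists i, u 0 i * v 0 l - u 0 l * v 0 i != 0.
  apply: contrapT => h; case/negP: nd; apply/existsP; exists (u 0 l / v 0 l).
  apply/eqP/rowP => i; rewrite mxE; apply: (mulIf vl).
  rewrite mulrAC mulfVK //; apply/eqP; rewrite -subr_eq0; apply/negP => hi.
  by apply: h; exists i; apply/negP.
set D := _ - _ in hi.
exists (D^-1 *: (v 0 l *: delta_mx i 0 - v 0 i *: delta_mx l 0)).
rewrite -!scalemxAr !mulmxBr !mulE !delta; split.
  by rewrite -raddfB /= -mulrC [v 0 i * _]mulrC scale_scalar_mx mulVf.
by rewrite [v 0 l * _]mulrC subrr scaler0.
Qed.

(** Multiples of [v] are determined by one coordinate at which [v] does not vanish, and that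
    coordinate takes at most [N] values on the cube. *)
Lemma count_dependent N (v : 'rV[K]_d) : (0 < N)%N -> (N <= p)%N ->
  (size [seq n <- cube d N | dependent (modp n) v] <= N)%N.
Proof.
move=> N0 Np.
have [f [f_lt f_inj]] : exists f : 'rV[int]_d -> nat,
    (forall n, n \in cube d N -> (f n < N)%N) /\
    {in [seq n <- cube d N | dependent (modp n) v] &, injective f}.
  have [v0|[l vl]] : v = 0 \/ exists l, v 0 l != 0.
    have [e|/eqP e] := pselect (v = 0); first by left.
    right; apply: contrapT => h; case/eqP: e; apply/rowP => i; rewrite mxE.
    by apply/eqP/negP => hi; apply: h; exists i; apply/negP.
    exists (fun=> 0%N); split => // n m; rewrite !mem_filter.
    move=> /andP[/existsP[x /eqP hx] cn] /andP[/existsP[y /eqP hy] cm] _.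
    by apply: (modp_inj Np) => //; rewrite hx hy v0 !scaler0.
  exists (fun n => absz (n 0 l)); split=> [n /mem_cube/(_ l)|n m]; first by lia.
  rewrite !mem_filter.
  move=> /andP[/existsP[x /eqP hx] cn] /andP[/existsP[y /eqP hy] cm] e.
  apply: (modp_inj Np) => //; rewrite hx hy; congr (_ *: _).
  have e1 : n 0 l = m 0 l.
    by move/mem_cube: cn => /(_ l); move/mem_cube: cm => /(_ l); move: e; case: (n 0 l); case: (m 0 l) => //; lia.
  have := congr1 (fun w : 'rV[K]_d => w 0 l) hx; have := congr1 (fun w : 'rV[K]_d => w 0 l) hy.
  by rewrite !mxE e1 => -> /(mulIf vl).
rewrite -(size_map f) -[leqRHS](size_iota 0); apply: uniq_leq_size.
  by rewrite map_inj_in_uniq // filter_uniq // cube_uniq.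
move=> t /mapP[n]; rewrite mem_filter => /andP[_ cn] ->.
by rewrite mem_iota add0n f_lt.
Qed.

(** After expanding the square, linearly independent pairs contribute 0 because [F] has mean 0. For
    each of the [N ^ d] vectors at most [N] others are dependent on it. *)
Lemma second_moment N (F : 'rV[K]_k -> R) : (0 < N)%N -> (N <= p)%N ->
  \sum_w F w = 0 -> (forall w, `|F w| <= 1) ->
  \sum_(a : 'M[K]_(d, k)) (\sum_(n <- cube d N) F (modp n *m a)) ^+ 2 <=
  #|{: 'M[K]_(d, k)}|%:R * N%:R ^+ d.+1.
Proof.
move=> N0 Np F0 F1.
have -> : \sum_(a : 'M[K]_(d, k)) (\sum_(n <- cube d N) F (modp n *m a)) ^+ 2 =
    \sum_(m <- cube d N) \sum_(n <- cube d N)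
      \sum_(a : 'M[K]_(d, k)) F (modp n *m a) * F (modp m *m a).
  rewrite [RHS]exchange_big /=; under [RHS]eq_bigr do rewrite exchange_big /=.
  rewrite [RHS]exchange_big /=; apply: eq_bigr => a _.
  by rewrite expr2 mulr_suml; apply: eq_bigr => n _; rewrite mulr_sumr.
apply: le_trans (_ : \sum_(m <- cube d N) (N%:R * #|{: 'M[K]_(d, k)}|%:R) <= _); last first.
  by rewrite big_const_seq count_predT iter_addr_0 size_cube -[leLHS]mulr_natr natrX exprS mulrAC mulrC.
apply: ler_sum => m _.
apply: le_trans (_ : \sum_(n <- cube d N | dependent (modp n) (modp m)) #|{: 'M[K]_(d, k)}|%:R <= _).
  rewrite [leRHS]big_mkcond /=; apply: ler_sum => n _; case: ifPn => dep.
    rewrite -sum1_card natr_sum; apply: ler_sum => a _.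
    have h1 := F1 (modp n *m a); have h2 := F1 (modp m *m a).
    apply: le_trans (ler_norm _) _; rewrite normrM.
    by rewrite -[leRHS]mulr1; apply: ler_pM.
  by have [c [c1 c2]] := independent_dual dep; rewrite (sum_independent _ c1 c2).
rewrite -big_filter big_const_seq count_predT iter_addr_0 -[leLHS]mulr_natl ler_wpM2r //.
by rewrite ler_nat count_dependent.
Qed.

(** For [u] nonzero, a coordinate of [u *m a] is uniform on the field: some translation of [a] moves
    it by any prescribed amount. *)
Lemma sum_coordinate (F : K -> R) (u : 'rV[K]_d) c : u != 0 ->
  p%:R * \sum_(a : 'M[K]_(d, k)) F ((u *m a) 0 c) = #|{: 'M[K]_(d, k)}|%:R * \sum_x F x.
Proof.
move=> u0; have nd : ~~ dependent u 0.
  by apply/negP => /existsP[l]; rewrite scaler0 (negbTE u0).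
have [e [ue _]] := independent_dual nd.
set S := \sum_a _.
have E x : S = \sum_(a : 'M[K]_(d, k)) F ((u *m a) 0 c + x).
  rewrite /S (reindex_inj (addIr (e *m (x *: delta_mx 0 c)))) /=; apply: eq_bigr => a _.
  by rewrite mulmxDr mulmxA ue mul1mx !mxE !eqxx mulr1.
have : \sum_(x : K) S = #|{: 'M[K]_(d, k)}|%:R * \sum_x F x.
  under eq_bigr => x _ do rewrite (E x).
  rewrite exchange_big /= -sum1_card natr_sum mulr_suml; apply: eq_bigr => a _.
  by rewrite mul1r [RHS](reindex_inj (addrI ((u *m a) 0 c))).
by rewrite sumr_const card_Fp // => <-; rewrite mulr_natl.
Qed.

End SecondMoment.

(** * Rotations of small discrepancy *)

Definition shiftv (R : realType) d k (al : 'M[R]_(d, k)) (n : 'rV[int]_d) : 'rV[R]_k :=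
  map_mx intr n *m al.

Definition cidx (R : realType) k (q : nat) (y : 'rV[R]_k) : 'rV[int]_k :=
  \row_c Num.floor (2 ^+ q * y 0 c).

Definition cmod k (m : nat) (u v : 'rV[int]_k) : bool :=
  [forall c, modz (u 0 c) m == modz (v 0 c) m].

Section FiniteModel.
Context (R : realType).

Lemma count_interval (p m x : nat) : (0 < m)%N -> (0 < p)%N -> (x < m)%N ->
  let q := count (fun t => m * t %/ p == x)%N (iota 0 p) in
  [/\ (q <= p)%N, (q * m <= p + m)%N & (p <= q * m + m)%N].
Proof.
(* [c y] is [y / m] rounded up, that is the number of [t] with [m * t < y]; the count is a
   difference of two such numbers. *)
move=> m0 p0 xm q; pose c y := ((y + m.-1) %/ m)%N.
have cP t y : (t < c y)%N = (m * t < y)%N.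
  by rewrite /c leq_divRL // mulSn mulnC; apply/idP/idP; lia.
have c2p : (c (x.+1 * p) <= p)%N.
  by rewrite leqNgt cP -leqNgt leq_mul2r xm orbT.
have -> : q = (c (x.+1 * p) - c (x * p))%N.
  rewrite /q -size_filter -(size_iota (c (x * p)) (_ - _)); apply/perm_size/uniq_perm.
  - by rewrite filter_uniq // iota_uniq.
  - exact: iota_uniq.
  move=> t; rewrite mem_filter !mem_iota add0n leq0n /= eqn_leq.
  rewrite -ltnS ltn_divLR // leq_divRL // -cP [(x * p <= _)%N]leqNgt -cP -leqNgt.
  move: (c (x * p)%N) (c (x.+1 * p)%N) c2p => c1 c2 c2p; apply/idP/idP; lia.
have h1 := divn_eq (x.+1 * p + m.-1) m; have h2 := divn_eq (x * p + m.-1) m.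
have m1 := ltn_pmod (x.+1 * p + m.-1) m0; have m2 := ltn_pmod (x * p + m.-1) m0.
rewrite -/(c _) in h1; rewrite -/(c _) in h2; rewrite mulSn in h1 m1 *; rewrite mulSn in c2p.
move: (c _) (c _) (modn _ _) (modn _ _) h1 h2 m1 m2 c2p => c2 c1 r2 r1 h1 h2 m1 m2 c2p.
split; first lia.
- rewrite mulnBl; lia.
- rewrite mulnBl; lia.
Qed.

Lemma prodr_itv01 I (s : seq I) (z : I -> R) :
  (forall i, 0 <= z i <= 1) -> 0 <= \prod_(i <- s) z i <= 1.
Proof.
move=> hz; elim/big_ind: _ => [|x y /andP[x0 x1] /andP[y0 y1]|i _]; last exact: hz.
  by rewrite ler01 lexx.
by rewrite mulr_ge0 //= mulr_ile1.
Qed.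

Lemma prod_close I (s : seq I) (x y : I -> R) (e : R) :
  (forall i, 0 <= x i <= 1) -> (forall i, 0 <= y i <= 1) -> (forall i, `|x i - y i| <= e) ->
  `|\prod_(i <- s) x i - \prod_(i <- s) y i| <= (size s)%:R * e.
Proof.
move=> hx hy he; elim: s => [|i s IH]; first by rewrite !big_nil subrr normr0 mul0r.
have := prodr_itv01 s hy; have := hx i; rewrite !big_cons /=; move: IH; have := he i.
move: (\prod_(j <- s) x j) (\prod_(j <- s) y j) => u v h1 h2 h3 h4.
have -> : x i * u - y i * v = x i * (u - v) + (x i - y i) * v by ring.
apply: le_trans (ler_normD _ _) _; rewrite !normrM [`|x i|]ger0_norm; last by case/andP: h3.
rewrite [`|v|]ger0_norm; last by case/andP: h4.
rewrite -add1n natrD mulrDl mul1r addrC; apply: lerD.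
  by apply: le_trans h1; rewrite ler_piMr //; case/andP: h4.
by apply: le_trans h2; rewrite ler_piMl //; case/andP: h3.
Qed.

Context (p d k : nat).
Hypothesis p_pr : prime p.
Local Notation K := 'F_p.
Let p0 : (0 < p)%N := prime_gt0 p_pr.

Lemma sum_Fp (f : nat -> R) : \sum_(x : K) f x = \sum_(t <- iota 0 p) f t.
Proof.
have -> : iota 0 p = index_iota 0 p by rewrite /index_iota subn0.
by rewrite -[in RHS](Fp_cast p_pr) big_mkord.
Qed.

(** Indicator that the point [u / p] of the unit torus lies in the cell [z] of the grid of mesh
    [1 / m]. *)
Definition cellF (m : nat) (z : {ffun 'I_k -> 'I_m}) (u : 'rV[K]_k) : R :=
  \prod_c (m * (u 0%R c : nat) %/ p == z c)%N%:R.

(** The count factors over coordinates, and each factor is within 1 of [p / m]. *)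
Lemma sum_cellF m z : (0 < m)%N ->
  `|(\sum_u @cellF m z u) / p%:R ^+ k - m%:R^-1 ^+ k| <= k%:R / p%:R.
Proof.
move=> m0; have pR : p%:R != 0 :> R by rewrite pnatr_eq0 -lt0n.
pose q x := count (fun t => m * t %/ p == x)%N (iota 0 p).
have -> : \sum_u @cellF m z u = \prod_c (q (z c))%:R.
  have -> : \prod_c (q (z c))%:R = \prod_c \sum_(x : K) (m * (x : nat) %/ p == z c)%N%:R :> R.
    apply: eq_bigr => c _; rewrite (sum_Fp (fun t => (m * t %/ p == z c)%N%:R)).
    by rewrite /q -sum1_count natr_sum big_mkcond /=; apply: eq_bigr => t _; case: eqP.
  rewrite bigA_distr_bigA /= (reindex (fun f : {ffun 'I_k -> K} => \row_c f c)) /=.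
    by apply: eq_bigr => f _; apply: eq_bigr => c _; rewrite mxE.
  exists (fun u : 'rV[K]_k => [ffun c => u 0 c]) => [f|u] _.
    by apply/ffunP => c; rewrite ffunE mxE.
  by apply/rowP => c; rewrite mxE ffunE.
have -> : (\prod_c (q (z c))%:R) / p%:R ^+ k = \prod_c ((q (z c))%:R / p%:R) :> R.
  by rewrite big_split /= prodr_const card_ord exprVn.
have -> : m%:R^-1 ^+ k = \prod_(c < k) m%:R^-1 :> R by rewrite prodr_const card_ord.
apply: le_trans (_ : (size (index_enum 'I_k))%:R * p%:R^-1 <= _); last first.
  by rewrite -[index_enum _]enumT size_enum_ord.
have p0R : 0 < p%:R :> R by rewrite ltr0n.
have m0R : 0 < m%:R :> R by rewrite ltr0n.
apply: prod_close => c.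
- have [qp _ _] := count_interval m0 p0 (ltn_ord (z c)).
  by rewrite divr_ge0 //= ler_pdivrMr // mul1r ler_nat.
- by rewrite invr_ge0 ler0n invf_le1 // ler1n.
have [_ h1 h2] := count_interval m0 p0 (ltn_ord (z c)); rewrite -/(q _) in h1 h2.
rewrite -(ler_nat R) natrD natrM in h1; rewrite -(ler_nat R) natrD natrM in h2.
move: (q (z c))%:R h1 h2 => x h1 h2.
have -> : x / p%:R - m%:R^-1 = (x * m%:R - p%:R) / (p%:R * m%:R).
  by field; rewrite pR gt_eqF.
rewrite normrM normfV [`|p%:R * _|]ger0_norm ?mulr_ge0 // invfM mulrA.
rewrite -[leRHS]mul1r [_ / _ / _]mulrAC ler_wpM2r ?invr_ge0 // ler_pdivrMr // mul1r.
by rewrite ler_norml; apply/andP; split; lra.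
Qed.

Lemma cellF01 m z u : 0 <= @cellF m z u <= 1.
Proof.
by apply: prodr_itv01 => c; case: eqP; rewrite ?lexx ?ler01.
Qed.

Definition dens m z : R := (\sum_u @cellF m z u) / p%:R ^+ k.

Lemma card_rVFp : #|{: 'rV[K]_k}| = (p ^ k)%N.
Proof. by rewrite card_mx card_Fp // mul1n. Qed.

Lemma second_moment_cell m N z : (0 < N)%N -> (N <= p)%N ->
  \sum_(a : 'M[K]_(d, k)) (\sum_(n <- cube d N) (@cellF m z (modp p n *m a)) -
    (N ^ d)%:R * dens z) ^+ 2 <= #|{: 'M[K]_(d, k)}|%:R * N%:R ^+ d.+1.
Proof.
move=> N0 Np; have pk0 : 0 < p%:R ^+ k :> R by rewrite exprn_gt0 // ltr0n.
have d01 : 0 <= dens z <= 1.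
  have s0 : 0 <= \sum_u cellF z u by apply: sumr_ge0 => u _; case/andP: (cellF01 z u).
  rewrite /dens divr_ge0 ?(ltW pk0) //=.
  rewrite ler_pdivrMr // mul1r -natrX -card_rVFp -sum1_card natr_sum.
  by apply: ler_sum => u _; case/andP: (cellF01 z u).
have h w : `|cellF z w - dens z| <= 1 by have := cellF01 z w; rewrite ler_norml; lra.
have s0 : \sum_w (cellF z w - dens z) = 0.
  rewrite sumrB sumr_const card_rVFp -mulr_natr natrX /dens divfK ?subrr //.
  by rewrite gt_eqF.
have := @second_moment R p d k p_pr N (fun u => cellF z u - dens z) N0 Np s0 h.
congr (_ <= _); apply: eq_bigr => a _.
by rewrite sumrB big_const_seq count_predT iter_addr_0 size_cube mulr_natl.
Qed.

End FiniteModel.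

(** * Random rational rotations good up to a given scale *)

Section FiniteAlpha.
Context (R : realType).

Lemma markov (T : finType) (w : T -> R) : (0 < #|T|)%N ->
  \sum_t w t < #|T|%:R -> exists t, w t < 1.
Proof.
move=> T0; apply: contraPP => h; apply/negP; rewrite -leNgt -sum1_card natr_sum.
apply: ler_sum => t _; rewrite leNgt; apply/negP => wt; by apply: h; exists t.
Qed.

Lemma psum_term_lt1 (I : eqType) (s : seq I) (f : I -> R) i : i \in s ->
  (forall i, 0 <= f i) -> \sum_(i <- s) f i < 1 -> f i < 1.
Proof.
move=> si f0; apply: le_lt_trans; rewrite (big_rem i) //= lerDl.
by apply: sumr_ge0 => *; exact: f0.
Qed.

Lemma geometric_half (J : nat) : \sum_(i <- iota 0 J) (2 ^+ i.+2)^-1 < 2^-1 :> R.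
Proof.
have -> : \sum_(i <- iota 0 J) (2 ^+ i.+2)^-1 = 2^-1 - (2 ^+ J.+1)^-1 :> R.
  elim: J => [|J IH]; first by rewrite big_nil expr1 subrr.
  rewrite -addn1 iotaD big_cat /= IH big_seq1 add0n addn1 !exprS; field.
  by rewrite expf_neq0 // pnatr_eq0.
by rewrite ltrBlDl ltrDr invr_gt0 exprn_gt0 // ltr0n.
Qed.

(** For residues [t < p]: the distance from [t / p] to the integers is less than [1 / M]. *)
Definition near_zero (p M t : nat) : bool := ((t * M < p) || ((p - t) * M < p))%N.

Lemma count_near_zero p M : (0 < M <= p)%N ->
  (count (near_zero p M) (iota 0 p) * M <= 4 * p)%N.
Proof.
move=> /andP[M0 Mp]; set q := (p %/ M)%N.
have q1 : (1 <= q)%N by rewrite divn_gt0.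
have qM : (q * M <= p)%N by exact: leq_divM.
have lq t : (t * M < p -> t <= q)%N by move=> h; rewrite leq_divRL // ltnW.
have : (count (near_zero p M) (iota 0 p) <= q.+1 + q)%N.
  rewrite -size_filter -(size_iota 0 q.+1) -{2}(size_iota (p - q) q) -size_cat.
  apply: uniq_leq_size; first by rewrite filter_uniq ?iota_uniq.
  move=> t; rewrite mem_filter mem_cat !mem_iota /near_zero => /andP[/orP[/lq|/lq]]; lia.
move: (count _ _) => c; rewrite mulnC; nia.
Qed.

Context (k L s e0 : nat) (c0 : 'I_k).
Hypotheses (L0 : (0 < L)%N) (Le : (4 * L ^ k < 2 ^ e0)%N).
(** Two demands fix [e] and [d]. Errors of [2^(j e)] in all the cells must total [O(2^(j d) / 4^j)],
    which gives [d = s k + 2 + e]. The variances must be beaten by the tolerance, which requires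
    [(d + 1) + s k - 2 e = - e0]. *)
Let e := (2 * s * k + 3 + e0)%N.
(* With this [d], the variances of the visits to the (L 2^(s j))^k cells add up to
   L^k 2^(- j e0) times the square of the tolerance 2^(j e). *)
Let d := (s * k + 2 + e)%N.

Definition rep_alpha p (a : 'M['F_p]_(d, k)) : 'M[R]_(d, k) :=
  \matrix_(i, c) (L%:R * (a i c : nat)%:R / p%:R).

Section Prime.
Variables (p : nat) (p_pr : prime p).
Let p0 : (0 < p)%N := prime_gt0 p_pr.
Implicit Types a : 'M['F_p]_(d, k).

(** Modulo [L] the real rotation is the linear map over the prime field, rescaled by [L / p]. *)
Lemma shiftv_rep a n c : exists z : int,
  shiftv (rep_alpha a) n 0 c = L%:R * (((modp p n *m a) 0 c : nat)%:R / p%:R + z%:~R).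
Proof.
have pR : p%:R != 0 :> R by rewrite pnatr_eq0 -lt0n.
set t := (modp p n *m a) 0 c.
have /dvdzP[z hz] : (p %| (\sum_i n 0 i * (a i c : nat)%:Z) - (t : nat)%:Z)%Z.
  rewrite (dvdz_pcharf (pchar_Fp p_pr)) rmorphB rmorph_sum /= -pmulrn natr_Zp /t mxE.
  rewrite subr_eq0; apply/eqP/eq_bigr => i _.
  by rewrite rmorphM /= -pmulrn natr_Zp mxE.
exists z; rewrite mxE.
have -> : \sum_j (map_mx intr n : 'rV[R]_d) 0 j * rep_alpha a j c =
    L%:R / p%:R * (\sum_i n 0 i * (a i c : nat)%:Z)%:~R.
  rewrite rmorph_sum mulr_sumr; apply: eq_bigr => i _.
  rewrite !mxE rmorphM /= -pmulrn; ring.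
have -> : \sum_i n 0 i * (a i c : nat)%:Z = (t : nat)%:Z + z * p%:Z by rewrite -hz; ring.
by rewrite rmorphD rmorphM /= -!pmulrn; field.
Qed.

Lemma cmod_rep a n q (zeta : 'rV[int]_k) (z : {ffun 'I_k -> 'I_(L * 2 ^ q)}) :
  (forall c, modz (zeta 0 c) (L * 2 ^ q)%N = (z c : nat)) ->
  (cmod (L * 2 ^ q) (cidx q (shiftv (rep_alpha a) n)) zeta)%:R =
    cellF R z (modp p n *m a).
Proof.
move=> hz; set m := (L * 2 ^ q)%N in z hz *.
have m0 : (0 < m)%N by rewrite muln_gt0 L0 expn_gt0.
have p0R : 0 < p%:R :> R by rewrite ltr0n.
have hc c : modz (cidx q (shiftv (rep_alpha a) n) 0 c) m =
    (m * ((modp p n *m a) 0%R c : nat) %/ p)%N.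
  have [w ->] : exists w : int, cidx q (shiftv (rep_alpha a) n) 0 c =
      ((m * ((modp p n *m a) 0%R c : nat) %/ p)%N : int) + w * m.
    have [w hw] := shiftv_rep a n c; exists w; rewrite mxE hw.
    set t := (modp p n *m a) 0 c : nat.
    apply: Num.Theory.floor_def.
    have -> : 2 ^+ q * (L%:R * (t%:R / p%:R + w%:~R)) = (m * t)%:R / p%:R + (w * m%:Z)%:~R :> R.
      by rewrite intrM -pmulrn /m !natrM natrX; field; rewrite gt_eqF.
    rewrite -addrA [w * _ + 1]addrC addrA !rmorphD /= lerD2r ltrD2r mulr1z -!pmulrn natr1.
    rewrite ler_pdivlMr // ltr_pdivrMr // -!natrM ler_nat ltr_nat leq_divM /=.
    by rewrite -ltn_divLR.
  rewrite addrC modzMDl modz_nat modn_small // ltn_divLR // ltn_pmul2l //.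
  by rewrite -[ltnRHS](Fp_cast p_pr).
rewrite /cellF -natr_prod; congr (_ %:R).
have -> : cmod m (cidx q (shiftv (rep_alpha a) n)) zeta =
    [forall c, (m * ((modp p n *m a) 0%R c : nat) %/ p)%N == z c].
  by apply: eq_forallb => c; rewrite hc hz.
case: forallP => h; first by rewrite big1 // => c _; rewrite h.
have [c hcc] : exists c, ~~ ((m * ((modp p n *m a) 0%R c : nat) %/ p)%N == z c).
  by apply: contrapT => h'; apply: h => c; apply: contrapT => h''; apply: h'; exists c; apply/negP.
by rewrite (bigD1 c) //= (negbTE hcc) mul0n.
Qed.

(** A sum of squared deviations in units of the tolerance: a value below 1 forces every cell at this
    scale to be within tolerance. *)
Definition dev_weight j a : R :=
  \sum_(z : {ffun 'I_k -> 'I_(L * 2 ^ (s * j))})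
    (\sum_(n <- cube d (2 ^ j)) cellF R z (modp p n *m a) -
      ((2 ^ j) ^ d)%:R * dens R p z) ^+ 2 / (2 ^+ (j * e)) ^+ 2.

Lemma sum_dev_weight j : (0 < j)%N -> (2 ^ j <= p)%N ->
  \sum_a dev_weight j a <= #|{: 'M['F_p]_(d, k)}|%:R * (2 ^+ j.+1)^-1.
Proof.
move=> j0 jp; rewrite /dev_weight exchange_big /=.
have E0 q : 2 ^+ q != 0 :> R by rewrite expf_neq0 // pnatr_eq0.
have E0' q : 0 < 2 ^+ q :> R by rewrite exprn_gt0 // ltr0n.
apply: le_trans (_ : \sum_(z : {ffun 'I_k -> 'I_(L * 2 ^ (s * j))})
    #|{: 'M['F_p]_(d, k)}|%:R * (2 ^ j)%:R ^+ d.+1 / (2 ^+ (j * e)) ^+ 2 <= _).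
  apply: ler_sum => z _; rewrite -mulr_suml ler_wpM2r ?invr_ge0 ?sqr_ge0 //.
  by apply: second_moment_cell; rewrite // expn_gt0.
rewrite sumr_const card_ffun !card_ord -[leLHS]mulr_natl [_%:R * _]mulrC -!mulrA ler_wpM2l // mulrA.
have -> : (2 ^ j)%:R ^+ d.+1 / (2 ^+ (j * e)) ^+ 2 * ((L * 2 ^ (s * j)) ^ k)%:R =
    (L ^ k)%:R / 2 ^+ (j * e0) :> R.
  rewrite expnMn natrM -expnM !natrX -!exprM.
  apply: (mulIf (E0 (j * e0)%N)); rewrite mulfVK //.
  apply: (mulIf (E0 (j * e * 2)%N)).
  have -> : 2 ^+ (j * d.+1) / 2 ^+ (j * e * 2) * (L%:R ^+ k * 2 ^+ (s * j * k)) *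
     2 ^+ (j * e0) * 2 ^+ (j * e * 2) =
     L%:R ^+ k * (2 ^+ (j * d.+1) * 2 ^+ (s * j * k) * 2 ^+ (j * e0)) :> R.
    by field; rewrite E0.
  rewrite -!exprD; congr (_ * 2 ^+ _); rewrite /d /e; ring.
rewrite ler_pdivrMr // mulrC ler_pdivlMr // -!natrX -natrM ler_nat.
case: j j0 {jp} => // j _; rewrite mulSn expnD.
have -> : (L ^ k * 2 ^ j.+2 = 4 * L ^ k * 2 ^ j)%N by rewrite !expnS; ring.
apply: leq_mul; first exact: ltnW.
rewrite leq_exp2l // -[leqLHS]muln1 leq_mul2l; apply/orP; right.
have := Le; case: (e0) => //; rewrite expn0 ltnS leqn0 muln_eq0 /= expn_eq0.
by rewrite -leqn0 leqNgt L0.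
Qed.

(** Lattice vectors are enumerated by [pickle] so that the thresholds can shrink with the index: the
    [i]-th vector is bad with probability at most [4 / 2^(i+4)], and the total is below 1/2. *)
Definition bad_weight i a : R :=
  if unpickle i is Some n then
    ((n != 0 :> 'rV[int]_d) && near_zero p (2 ^ (i + 4)) ((modp p n *m a) 0 c0))%:R else 0.

Lemma sum_bad_weight i : (2 ^ (i + 4) <= p)%N ->
  (forall n : 'rV[int]_d, unpickle i = Some n -> (nrm n < p)%N) ->
  \sum_a bad_weight i a <= #|{: 'M['F_p]_(d, k)}|%:R * (2 ^+ i.+2)^-1.
Proof.
move=> ip hn; have E0' q : 0 < 2 ^+ q :> R by rewrite exprn_gt0 // ltr0n.
have T0 : 0 <= #|{: 'M['F_p]_(d, k)}|%:R * (2 ^+ i.+2)^-1 :> R.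
  by rewrite mulr_ge0 // invr_ge0 ltW.
rewrite /bad_weight; case: (unpickle i) hn => [n|_]; last by rewrite big1.
move=> /(_ n erefl) np; have [->|n0] := eqVneq n 0; first by rewrite big1.
have un0 : modp p n != 0.
  apply/eqP => /rowP h; case/eqP: n0; apply/rowP => i'; rewrite mxE.
  have := h i'; rewrite !mxE => /eqP; rewrite -(dvdz_pcharf (pchar_Fp p_pr)).
  have := leq_ltn_trans (nrm_coord n i') np; rewrite dvdzE /= => hlt hd; apply/eqP.
  rewrite -absz_eq0; apply: contraLR hlt; rewrite -lt0n -leqNgt => /dvdn_leq; exact.
have p0R : 0 < p%:R :> R by rewrite ltr0n.
have M0 : (0 < 2 ^ (i + 4) <= p)%N by rewrite expn_gt0.
have := sum_coordinate p_pr (fun x : 'F_p => (near_zero p (2 ^ (i + 4)) x)%:R : R) c0 un0.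
rewrite (sum_Fp p_pr (fun x => (near_zero p (2 ^ (i + 4)) x)%:R)) => h.
rewrite -(ler_pM2l p0R) h mulrCA ler_wpM2l //.
have -> : \sum_(t <- iota 0 p) (near_zero p (2 ^ (i + 4)) t)%:R =
    (count (near_zero p (2 ^ (i + 4))) (iota 0 p))%:R :> R.
  by rewrite -sum1_count natr_sum [RHS]big_mkcond /=; apply: eq_bigr => t _; case: near_zero.
have := count_near_zero M0; move: (count _ _) => c hc.
rewrite ler_pdivlMr // -natrX -natrM ler_nat -(@leq_pmul2l 4) //.
by apply: leq_trans hc; rewrite addn4 !expnS; lia.
Qed.

End Prime.

(* The matrix is uniform in a finite set and all requirements hold simultaneously by the
   union bound. *)
Lemma finite_alpha (J : nat) : exists al : 'M[R]_(d, k),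
  [/\ forall i c, 0 <= al i c <= L%:R,
   forall j zeta, (0 < j <= J)%N ->
     `|\sum_(n <- cube d (2 ^ j)) (cmod (L * 2 ^ (s * j)) (cidx (s * j) (shiftv al n)) zeta)%:R
       - 2 ^+ (j * d) / (L * 2 ^ (s * j))%:R ^+ k| <= 2 * 2 ^+ (j * e) :> R
   & forall (n : 'rV[int]_d) (z : int), n != 0 -> (pickle n <= J)%N ->
     L%:R / 2 ^+ (pickle n + 4) <= `|shiftv al n 0 c0 - L%:R * z%:~R| ].
Proof.
have [K1 K1E] : {K1 | K1 = J.+1} by exists J.+1.
(* The prime exceeds [B] so that the nonzero vectors considered remain nonzero modulo [p],
   [2 ^ (J + 4)] so that cubes embed and thresholds make sense, and [k * 2 ^ (J * d)] so that
   replacing [dens] by the true volume costs at most 1. *)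
pose B := \sum_(i < J.+1) nrm (odflt (0 : 'rV[int]_d) (unpickle i)).
have [p pbig p_pr] := prime_above (2 ^ (J + 4) + k * 2 ^ (J * d) + B).
have p0 : (0 < p)%N := prime_gt0 p_pr.
have p0R : 0 < p%:R :> R by rewrite ltr0n.
have pB i (n : 'rV[int]_d) : (i < J.+1)%N -> unpickle i = Some n -> (nrm n < p)%N.
  move=> iJ hi; apply: leq_ltn_trans pbig; apply: leq_trans (leq_addl _ _).
  by rewrite /B (bigD1 (Ordinal iJ)) //= hi /= leq_addr.
have pJ i : (i <= J + 4)%N -> (2 ^ i <= p)%N.
  move=> iJ; apply: leq_trans (ltnW pbig); rewrite -addnA; apply: leq_trans (leq_addr _ _).
  by rewrite leq_exp2l.
have pk : (k * 2 ^ (J * d) <= p)%N.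
  by apply: leq_trans (ltnW pbig); rewrite addnAC leq_addl.
pose w (a : 'M['F_p]_(d, k)) := \sum_(i <- iota 0 J) dev_weight i.+1 a +
  \sum_(i <- iota 0 K1) bad_weight i a.
have dev0 i a : 0 <= @dev_weight p i a.
  by apply: sumr_ge0 => z _; rewrite divr_ge0 ?sqr_ge0.
have bad0 i a : 0 <= @bad_weight p i a.
  by rewrite /bad_weight; case: unpickle => // n.
have [a wa] : exists a, w a < 1.
  apply: markov; first by apply/card_gt0P; exists 0.
  have M0 : 0 < #|{: 'M['F_p]_(d, k)}|%:R :> R.
    by rewrite ltr0n; apply/card_gt0P; exists 0.
  rewrite big_split /= [X in X + _]exchange_big [X in _ + X]exchange_big /=.
  apply: le_lt_trans (_ : #|{: 'M['F_p]_(d, k)}|%:R * \sum_(i <- iota 0 J) (2 ^+ i.+2)^-1 +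
    #|{: 'M['F_p]_(d, k)}|%:R * \sum_(i <- iota 0 K1) (2 ^+ i.+2)^-1 < _).
    apply: lerD; rewrite mulr_sumr big_seq_cond [leRHS]big_seq_cond; apply: ler_sum => i.
      by rewrite andbT mem_iota => hi; apply: sum_dev_weight => //; apply: pJ; lia.
    rewrite andbT mem_iota => hi; apply: sum_bad_weight => //; first by apply: pJ; lia.
    by move=> n; apply: pB; lia.
  have h1 := geometric_half J; have h2 := geometric_half K1.
  rewrite -mulrDr -[ltRHS]mulr1 ltr_pM2l //; lra.
have {}wa : \sum_(i <- iota 0 J) dev_weight i.+1 a < 1 /\
    \sum_(i <- iota 0 K1) bad_weight i a < 1.
  have := sumr_ge0 (I := nat) ( iota 0 J) (P := xpredT) (F := fun i => dev_weight i.+1 a) (fun i _ => dev0 _ _).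
  have := sumr_ge0 (I := nat) ( iota 0 K1) (P := xpredT) (F := fun i => bad_weight i a) (fun i _ => bad0 _ _).
  by move: wa; rewrite /w => ? ? ?; split; lra.
case: wa => devs bads; exists (rep_alpha a); split.
- move=> i c; rewrite mxE; have : ((a i c : nat) <= p)%N.
    by rewrite ltnW // -[ltnRHS](Fp_cast p_pr).
  rewrite -(ler_nat R) => h; rewrite divr_ge0 ?mulr_ge0 // ler_pdivrMr //.
  by rewrite ler_wpM2l.
- move=> j zeta /andP[j0 jJ].
  set m := (L * 2 ^ (s * j))%N; have m0 : (0 < m)%N by rewrite muln_gt0 L0 expn_gt0.
  have hz c : (absz (modz (zeta 0%R c) m) < m)%N.
    have := @ltz_pmod (zeta 0 c) m; have := @modz_ge0 (zeta 0 c) m; lia.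
  pose z : {ffun 'I_k -> 'I_m} := [ffun c => Ordinal (hz c)].
  have zE c : modz (zeta 0 c) m = (z c : nat).
    by rewrite ffunE /= gez0_abs // modz_ge0 //; lia.
  under eq_bigr => n _ do rewrite (cmod_rep p_pr a n zE).
  have hd : dev_weight j a < 1.
    have -> : j = j.-1.+1 by lia.
    apply: (psum_term_lt1 (f := fun i => dev_weight i.+1 a) _ _ devs) => //.
    by rewrite mem_iota; lia.
  set S := \sum_(n <- _) _.
  have {hd} : (S - ((2 ^ j) ^ d)%:R * dens R p z) ^+ 2 / (2 ^+ (j * e)) ^+ 2 < 1.
    apply: le_lt_trans hd; rewrite /dev_weight (bigD1 z) //= lerDl.
    by apply: sumr_ge0 => z' _; rewrite divr_ge0 ?sqr_ge0.
  have E0 : 0 < 2 ^+ (j * e) :> R by rewrite exprn_gt0 // ltr0n.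
  rewrite ltr_pdivrMr ?exprn_gt0 // mul1r => h.
  have {}h : `|S - ((2 ^ j) ^ d)%:R * dens R p z| < 2 ^+ (j * e).
    by rewrite -(@ltr_pXn2r _ 2) ?nnegrE ?(ltW E0) // real_normK ?num_real.
  have h2 := sum_cellF R p_pr z m0; rewrite -/(dens R p z) in h2.
  have h3 : `|((2 ^ j) ^ d)%:R * dens R p z - 2 ^+ (j * d) / m%:R ^+ k| <= 1.
    have -> : 2 ^+ (j * d) / m%:R ^+ k = ((2 ^ j) ^ d)%:R * m%:R^-1 ^+ k :> R.
      by rewrite -expnM natrX exprVn.
    rewrite -mulrBr normrM normr_nat.
    apply: le_trans (ler_wpM2l _ h2) _ => //; rewrite mulrA ler_pdivrMr // mul1r -natrM ler_nat.
    apply: leq_trans pk; rewrite mulnC leq_mul2l -expnM leq_exp2l // leq_mul2r jJ !orbT //.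
  have h4 : 1 <= 2 ^+ (j * e) :> R by rewrite exprn_ege1 // ler1n.
  rewrite -(subrK (((2 ^ j) ^ d)%:R * dens R p z) S) -addrA.
  apply: le_trans (ler_normD _ _) _; rewrite [2 * _]mulrDl; apply: lerD; rewrite mul1r.
    exact: ltW.
  exact: le_trans h4.
- move=> n z n0 nJ; have hb : bad_weight (pickle n) a < 1.
    by apply: (psum_term_lt1 _ _ bads) => //; rewrite mem_iota; lia.
  move: hb; rewrite /bad_weight pickleK n0 /=; case: (boolP (near_zero _ _ _)) => [_|nb _]; first by rewrite ltxx.
  have [w' ->] := shiftv_rep p_pr a n c0.
  set t := (modp p n *m a) 0 c0 : nat in nb *.
  have tp : (t < p)%N by rewrite /t -[ltnRHS](Fp_cast p_pr); exact: ltn_ord.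
  move: nb; rewrite /near_zero negb_or -!leqNgt => /andP[].
  rewrite -!(ler_nat R) !natrM natrB ?(ltnW tp) // natrX => h1 h2.
  have M0 : 0 < 2 ^+ (pickle n + 4) :> R by rewrite exprn_gt0 // ltr0n.
  rewrite -mulrBr normrM normr_nat ler_wpM2l //.
  have k1 : (2 ^+ (pickle n + 4))^-1 <= t%:R / p%:R :> R.
    by rewrite ler_pdivlMr // mulrC ler_pdivrMr.
  have k2 : (2 ^+ (pickle n + 4))^-1 <= 1 - t%:R / p%:R :> R.
    have -> : 1 - t%:R / p%:R = (p%:R - t%:R) / p%:R :> R by field; rewrite gt_eqF.
    by rewrite ler_pdivlMr // mulrC ler_pdivrMr.
  rewrite -addrA -intrB ler_normr; apply/orP.
  have [hw|hw] := leP 0 (w' - z).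
    by left; apply: le_trans k1 _; rewrite lerDl ler0z.
  right; apply: le_trans k2 _; rewrite opprD [leRHS]addrC lerD2r lerNr.
  rewrite (_ : -1 = (-1)%:~R) ?ler_int ?rmorphN1 //; move: hw; move: (w' - z) => v; lia.
Qed.

End FiniteAlpha.

Section Cluster.
Context (R : realType) (d k : nat).

Lemma bounded_cluster (L : R) (u : nat -> 'M[R]_(d, k)) : (forall J i c, 0 <= u J i c <= L) ->
  exists al : 'M[R]_(d, k), forall rho J0, 0 < rho ->
    exists2 J, (J0 <= J)%N & forall i c, `|u J i c - al i c| < rho.
Proof.
move=> hu; pose v J : 'rV[R]_(d * k) := mxvec (u J).
have := @rV_compact R (d * k) (fun=> `[0, L]%classic) (fun=> @segment_compact R 0 L).
move=> /(_ (v @ \oo) _) []; last move=> w [_ cw].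
- by exists 0%N => // J _ i /=; rewrite in_itv /= /v; case/mxvec_indexP: i => i c; rewrite mxvecE.
exists (vec_mx w) => rho J0 rho0.
have [] := cw [set v J | J in [set J | (J0 <= J)%N]] (ball w rho).
- by exists J0 => // J J0J; exists J.
- exact: nbhsx_ballx.
move=> x [[J J0J <-] [_ /= h]]; exists J => // i c.
have := h 0 (mxvec_index i c).
by rewrite /v mxvecE -[w in X in X -> _]vec_mxK mxvecE distrC.
Qed.

End Cluster.

(** * Covers by boxes *)

Section BoxVolume.
Context (R : realType).

Lemma horner_slack (p : {poly R}) (eps : R) : 0 < eps ->
  exists2 tau, 0 < tau & forall x, `|x| <= tau -> `|p.[x] - p.[0]| < eps.
Proof.
move=> e0; have /cvgrPdist_lt /(_ _ e0) /nbhs_ballP [r /= r0 h] := @continuous_horner R p 0.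
exists (r / 2); first by rewrite divr_gt0.
move=> x xr; rewrite distrC; apply: h; rewrite /ball /= sub0r normrN.
by apply: le_lt_trans xr _; rewrite ltr_pdivrMr // ltr_pMr // ltr1n.
Qed.

Lemma prod_slack (I : finType) (l : I -> R) (eps : R) : 0 < eps ->
  exists2 tau, 0 < tau & \prod_i (l i + tau) < \prod_i l i + eps.
Proof.
move=> /(horner_slack (\prod_i ('X + (l i)%:P))) [t t0 ht]; exists t => //.
have /ht /ltr_normlW : `|t| <= t by rewrite ger0_norm ?lexx // ltW.
rewrite !horner_prod; under eq_bigr do rewrite hornerD hornerX hornerC addrC.
under [X in _ - X]eq_bigr do rewrite hornerD hornerX hornerC add0r.
by rewrite ltrBlDl.
Qed.

Lemma count_open_interval (N : nat) (x y : R) :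
  (count (fun t : nat => x < t%:R < y) (iota 0 N))%:R <= Num.max 0 (y - x) + 1.
Proof.
have M0 : 0 <= Num.max 0 (y - x) by rewrite le_max lexx.
case: (boolP (has (fun t : nat => x < t%:R < y) (iota 0 N))) => [|]; last first.
  by rewrite has_count -leqNgt leqn0 => /eqP ->; rewrite addr_ge0.
move=> /hasP[t1 _ ht1].
have ex : exists t : nat, x < t%:R < y by exists t1.
case: (ex_minnP ex) => t0 /andP[xt0 t0y] tmin.
apply: le_trans (_ : ((Num.truncn (Num.max 0 (y - x))).+1)%:R <= _).
  rewrite ler_nat -size_filter -[leqRHS](size_iota t0).
  apply: uniq_leq_size; first by rewrite filter_uniq ?iota_uniq.
  move=> t; rewrite mem_filter mem_iota => /andP[/andP[xt ty] _].
  have tt : (t0 <= t)%N by apply: tmin; rewrite xt ty.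
  have : (t - t0 <= Num.truncn (Num.max 0%R (y - x)%R))%N.
    by rewrite truncn_ge_nat // natrB // le_max; apply/orP; right; lra.
  by move: (Num.truncn _) => q hq; rewrite mem_iota tt addnS ltnS -leq_subLR.
by rewrite -natr1 lerD2r truncn_le.
Qed.

Lemma open_openbox k (a b : 'rV[R]_k) : open [set x : 'rV[R]_k | forall i, a 0 i < x 0 i < b 0 i].
Proof.
rewrite openE => x /= hx; rewrite /interior /=.
apply: (filter_forall (F := nbhs x)) => i /=; have /andP[ax xb] := hx i.
have cx : (fun M : 'rV[R]_k => M 0 i) @ x --> x 0 i by exact: coord_continuous.
have h1 := @cvgr_gt _ _ _ (nbhs_filter x) _ _ cx _ ax.
have h2 := @cvgr_lt _ _ _ (nbhs_filter x) _ _ cx _ xb.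
by apply: filterS2 h1 h2 => y ay yb; rewrite ay yb.
Qed.

(** Sampling on a grid of spacing [w / N]: each of the [N ^ #|I|] points lies in some box, and an
    interval of length [l] contains at most [l * N / w + 1] samples. *)
Lemma grid_count (I : finType) (N B : nat) (w : R) (c l r : nat -> I -> R) :
  0 < w -> (0 < N)%N ->
  (forall f : {ffun I -> 'I_N}, exists2 n, (n < B)%N &
     forall i, l n i < c n i + (f i)%:R * (w / N%:R) < r n i) ->
  w ^+ #|I| <= \sum_(n < B) \prod_i (Num.max 0 (r n i - l n i) + w / N%:R).
Proof.
move=> w0 N0 hcov; have NR : 0 < N%:R :> R by rewrite ltr0n.
have wN : 0 < w / N%:R by rewrite divr_gt0.
pose P n i (t : nat) : bool := (l n i < c n i + t%:R * (w / N%:R) < r n i).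
have h1 : N%:R ^+ #|I| <= \sum_(n < B) \prod_i (count (P n i) (iota 0 N))%:R :> R.
  apply: le_trans (_ : \sum_(f : {ffun I -> 'I_N}) \sum_(n < B) \prod_i (P n i (f i))%:R <= _).
    rewrite -natrX -{1}[N]card_ord -card_ffun -sum1_card natr_sum; apply: ler_sum => f _.
    have [n nB hn] := hcov f; rewrite (bigD1 (Ordinal nB)) //= big1 => [|i _]; last by rewrite /P hn.
    by rewrite lerDl sumr_ge0 // => *; rewrite prodr_ge0.
  rewrite exchange_big /=; apply: ler_sum => n _.
  rewrite le_eqVlt; apply/orP; left; apply/eqP; rewrite -(bigA_distr_bigA (fun i (t : 'I_N) => (P n i t)%:R)) /=.
  apply: eq_bigr => i _; rewrite -sum1_count natr_sum.
  have -> : iota 0 N = index_iota 0 N by rewrite /index_iota subn0.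
  by rewrite big_mkord [RHS]big_mkcond /=; apply: eq_bigr => t _; case: (P n i t).
have h2 n i : (count (P n i) (iota 0 N))%:R <=
    (N%:R / w) * (Num.max 0 (r n i - l n i) + w / N%:R).
  have -> : count (P n i) (iota 0 N) =
      count (fun t : nat => (l n i - c n i) * (N%:R / w) < t%:R < (r n i - c n i) * (N%:R / w)) (iota 0 N).
    apply: eq_count => t; rewrite /P -[_ < c n i + _]ltrBlDl -[c n i + _ < _]ltrBrDl.
    have E : t%:R * (w / N%:R) = t%:R / (N%:R / w) by rewrite invf_div.
    by rewrite E ltr_pdivlMr ?divr_gt0 // ltr_pdivrMr ?divr_gt0.
  apply: le_trans (count_open_interval _ _ _) _.
  rewrite mulrDr -mulrBl [_ * (w / _)](_ : _ = 1); last by field; rewrite !gt_eqF.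
  rewrite lerD2r; set u := N%:R / w.
  have u0 : 0 <= u by rewrite divr_ge0 ?ltW.
  have -> : r n i - c n i - (l n i - c n i) = r n i - l n i by ring.
  by rewrite [_ * u]mulrC -[X in Num.max X _](mulr0 u) -maxr_pMr.
apply: le_trans (_ : (w / N%:R) ^+ #|I| *
    \sum_(n < B) \prod_i (count (P n i) (iota 0 N))%:R <= _).
  rewrite -[leLHS](_ : (w / N%:R) ^+ #|I| * N%:R ^+ #|I| = _); last first.
    by rewrite -exprMn divfK // gt_eqF.
  by rewrite ler_wpM2l // exprn_ge0 // ltW.
rewrite mulr_sumr; apply: ler_sum => n _.
rewrite -prodr_const -big_split /=; apply: ler_prod => i _.
rewrite mulr_ge0 ?(ltW wN) //=; apply: le_trans (ler_wpM2l (ltW wN) (h2 n i)) _.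
by rewrite mulrA [w / _ * _](_ : _ = 1) ?mul1r //; field; rewrite !gt_eqF.
Qed.

Lemma box_volume_ge0 k (a b : 'rV[R]_k) : 0 <= box_volume a b.
Proof. by apply: prodr_ge0 => i _; rewrite le_max lexx. Qed.

(** A slightly smaller closed cube is compact, and moving the lower faces by [tau n / 2] makes the
    boxes open. The finite subcover is then measured by counting grid points, with the other half of
    [tau n] absorbing the grid spacing. *)
Lemma cover_volume k (w : R) (a0 : 'rV[R]_k) (ab : nat -> 'rV[R]_k * 'rV[R]_k) : 0 < w ->
  box a0 (a0 + const_mx w) `<=` \bigcup_n box (ab n).1 (ab n).2 ->
  ((w ^+ k)%:E <= \sum_(0 <= n <oo) (box_volume (ab n).1 (ab n).2)%:E)%E.
Proof.
move=> w0 hcov; set S := (\sum_(0 <= n <oo) _)%E.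
have S_ge B : ((\sum_(n < B) box_volume (ab n).1 (ab n).2)%:E <= S)%E.
  rewrite -(big_mkord xpredT (fun n => box_volume (ab n).1 (ab n).2)) -sumEFin.
  by apply: nneseries_lim_ge => n _ _; rewrite lee_fin box_volume_ge0.
apply/lee_addgt0Pr => eps eps0.
have eps2 : 0 < eps / 2 by rewrite divr_gt0.
have [t1 t10 ht1] := horner_slack ((w%:P - 'X) ^+ k) eps2.
pose t := Num.min t1 (w / 2).
have t0 : 0 < t by rewrite lt_min t10 divr_gt0.
have tw : t < w by rewrite gt_min; apply/orP; right; lra.
have wt0 : 0 < w - t by rewrite subr_gt0.
have {ht1} wt : w ^+ k <= (w - t) ^+ k + eps / 2.
  have /ht1 : `|t| <= t1 by rewrite ger0_norm ?(ltW t0) // ge_min lexx.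
  rewrite !hornerE subr0 distrC => /ltr_normlW; lra.
have slack n : {tau : R | 0 < tau &
    \prod_i (Num.max 0 ((ab n).2 0 i - (ab n).1 0 i) + tau) <
    box_volume (ab n).1 (ab n).2 + (eps / 2) / 2 ^+ n.+1}.
  apply: cid2; apply: prod_slack; rewrite divr_gt0 // exprn_gt0 //.
pose tau n := s2val (slack n).
have tau0 n : 0 < tau n := s2valP (slack n).
have tauP n := s2valP' (slack n).
pose U n := [set x : 'rV[R]_k | forall i,
  ((ab n).1 - const_mx (tau n / 2)) 0 i < x 0 i < (ab n).2 0 i].
pose K := [set x : 'rV[R]_k | forall i, x ord0 i \in `[a0 0 i, a0 0 i + (w - t)]].
have cK : compact K.
  by apply: (@rV_compact R k (fun i => `[a0 0 i, a0 0 i + (w - t)]%classic)) => i; exact: segment_compact.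
have [B hB] : exists B, forall x, K x -> exists2 n, (n < B)%N & U n x.
  move: cK; rewrite compact_cover => /(_ nat setT U) [n _|x /= Kx|D _ hD].
  - exact: open_openbox.
  - have [|n _ /= hn] := hcov x.
      move=> i; have := Kx i; rewrite in_itv /= !mxE => /andP[-> h]; lra.
    exists n => // i; have := hn i; have := tau0 n; rewrite !mxE => ? /andP[? ?]; lra.
  exists (\max_(n <- finmap.enum_fset D) n).+1 => x /hD [n /= nD Un]; exists n => //.
  by rewrite ltnS (leq_bigmax_seq (F := id)).
pose N := (\sum_(n < B) Num.truncn (2 * (w - t) / tau n)).+1.
have hN n : (n < B)%N -> (w - t) / N%:R <= tau n / 2.
  move=> nB; have q0 : 0 <= 2 * (w - t) / tau n by rewrite divr_ge0 ?mulr_ge0 // ltW.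
  have : 2 * (w - t) / tau n < N%:R.
    apply: lt_le_trans (truncnS_gt _) _; rewrite ler_nat ltnS.
    by rewrite (bigD1 (Ordinal nB)) //= leq_addr.
  by rewrite ltr_pdivrMr // ler_pdivrMr // => h; lra.
have h := @grid_count _ N B (w - t) (fun _ i => a0 0 i)
  (fun n i => (ab n).1 0 i - tau n / 2) (fun n i => (ab n).2 0 i) wt0 (ltn0Sn _).
have {h} : (w - t) ^+ k <= \sum_(n < B)
    (box_volume (ab n).1 (ab n).2 + (eps / 2) / 2 ^+ n.+1).
  rewrite -[k in leLHS]card_ord; apply: le_trans (h _) _ => [f|].
    have [|n nB Un] := hB (\row_i (a0 0 i + (f i)%:R * ((w - t) / N%:R))).
      move=> i; rewrite in_itv /= mxE lerDl lerD2l; apply/andP; split.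
        by rewrite mulr_ge0 // divr_ge0 // ltW.
      rewrite mulrCA ger_pMr // ler_pdivrMr ?ltr0n // mul1r ler_nat ltnW //.
    by exists n => // i; have := Un i; rewrite !mxE.
  apply: ler_sum => n _; apply: le_trans (ltW (tauP n)); apply: ler_prod => i _.
  have h1 := hN n (ltn_ord n); have h2 : 0 <= (w - t) / N%:R by rewrite divr_ge0 // ltW.
  rewrite addr_ge0 ?le_max ?lexx //=.
  apply: le_trans (_ : Num.max 0 ((ab n).2 0 i - (ab n).1 0 i) + tau n / 2 + tau n / 2 <= _); last first.
    by rewrite -addrA -splitr.
  apply: lerD => //; rewrite opprB addrA.
  have t2 : 0 <= tau n / 2 by rewrite divr_ge0 // ltW.
  rewrite ge_max addr_ge0 ?le_max ?lexx //= addrAC lerD2r le_max lexx orbT //.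
rewrite big_split /= => h.
have hgeo : \sum_(n < B) (eps / 2) / 2 ^+ n.+1 <= eps / 2.
  rewrite -mulr_sumr ger_pMr //.
  have -> : \sum_(n < B) (2 ^+ n.+1)^-1 = 1 - (2 ^+ B)^-1 :> R.
    elim: (B) => [|b IH]; first by rewrite big_ord0 expr0 invr1 subrr.
    rewrite big_ord_recr /= IH exprS; field.
    by rewrite expf_neq0 // pnatr_eq0.
  by rewrite gerBl invr_ge0 exprn_ge0.
apply: le_trans (leeD2r _ (S_ge B)); rewrite -EFinD lee_fin; lra.
Qed.

End BoxVolume.

(** * Lebesgue measure and unions of grid cells *)

Section Cells.
Context (R : realType) (k : nat).
Hypothesis k0 : (0 < k)%N.

Lemma series_prefix (f : nat -> R) (g : nat -> \bar R) (N : nat) :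
  (forall n, 0 <= f n) -> (forall n, 0 <= g n)%E ->
  (\sum_(0 <= n <oo) (if (n < N)%N then (f n)%:E else g (n - N)%N) =
   (\sum_(n < N) f n)%:E + \sum_(0 <= n <oo) g n)%E.
Proof.
move=> f0 g0; have h0 n : (0 <= if (n < N)%N then (f n)%:E else g (n - N)%N)%E.
  by case: ifP => // _; rewrite lee_fin.
rewrite (nneseries_split 0 N) // add0n; congr (_ + _)%E.
  by rewrite big_mkord -sumEFin; apply: eq_bigr => n _; rewrite ltn_ord.
rewrite -nneseries_addn //; apply: eq_eseriesr => n _.
by rewrite ltnNge leq_addl /= addnK.
Qed.

Definition corner (e : R) (z : 'rV[int]_k) : 'rV[R]_k := \row_c ((z 0 c)%:~R * e).

Lemma grid_cubeE e z : grid_cube e z = box (corner e z) (corner e z + const_mx e).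
Proof.
apply/seteqP; split => x h c; have := h c; rewrite !mxE mulrDl mul1r; exact.
Qed.

Lemma volume_cube e (a : 'rV[R]_k) : 0 < e -> box_volume a (a + const_mx e) = e ^+ k.
Proof.
move=> e0; rewrite /box_volume -[in RHS](card_ord k) -prodr_const.
by apply: eq_bigr => i _; rewrite !mxE addrAC subrr add0r max_r // ltW.
Qed.

Lemma volume_empty : box_volume (0 : 'rV[R]_k) 0 = 0.
Proof.
by case: k k0 => // k' _; rewrite /box_volume big_ord_recl mxE subr0 maxxx mul0r.
Qed.

Lemma lebesgue_le_cells e (s : seq 'rV[int]_k) (X : set 'rV[R]_k) : 0 < e ->
  (forall x, X x -> exists2 z, z \in s & grid_cube e z x) ->
  (lebesgue X <= ((size s)%:R * e ^+ k)%:E)%E.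
Proof.
move=> e0 hX; apply: ge_ereal_inf.
pose ab n : 'rV[R]_k * 'rV[R]_k := if (n < size s)%N then
  (corner e (nth 0 s n), corner e (nth 0 s n) + const_mx e) else (0, 0).
exists (\sum_(0 <= n <oo) (box_volume (ab n).1 (ab n).2)%:E)%E; first exists ab => //.
  move=> x /hX [z zs hz]; exists (index z s) => //.
  by rewrite /ab index_mem zs /= nth_index // -grid_cubeE.
have -> : (\sum_(0 <= n <oo) (box_volume (ab n).1 (ab n).2)%:E)%E =
    (\sum_(0 <= n <oo) (if (n < size s)%N then (e ^+ k)%:E else (fun=> 0) (n - size s)%N))%E.
  apply: eq_eseriesr => n _; rewrite /ab; case: ifP => _ /=; first by rewrite volume_cube.
  by rewrite volume_empty.
rewrite (@series_prefix (fun=> e ^+ k) (fun=> 0%E)) // => [|n]; last by rewrite exprn_ge0 // ltW.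
by rewrite eseries0 // adde0 sumr_const card_ord -[in leLHS]mulr_natl.
Qed.

(* Adding the cells outside [s] turns a cover of [X] into a cover of a large cube, for
   which the volume inequality is known. *)
Lemma cells_le_lebesgue e h (s : seq 'rV[int]_k) (X : set 'rV[R]_k) : 0 < e -> (0 < h)%N ->
  uniq s -> (forall (z : 'rV[int]_k) c, z \in s -> - h%:Z <= z 0 c < h%:Z) ->
  (forall z, z \in s -> grid_cube e z `<=` X) ->
  (((size s)%:R * e ^+ k)%:E <= lebesgue X)%E.
Proof.
move=> e0 h0 us hs sX; apply/ereal_infP => _ [ab hab <-].
pose W := [seq (u - const_mx h%:Z : 'rV[int]_k) | u <- cube k (2 * h)].
have uW : uniq W by rewrite map_inj_uniq ?cube_uniq //; exact: addIr.
have sW : size W = ((2 * h) ^ k)%N by rewrite size_map size_cube.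
have mW (z : 'rV[int]_k) : (forall c, - h%:Z <= z 0 c < h%:Z) -> z \in W.
  move=> hz; apply/mapP; exists (z + const_mx h%:Z); last by rewrite addrK.
  apply/mem_cube => c; have := hz c; rewrite rvD mxE; lia.
pose t := [seq z <- W | z \notin s].
have st : (size s + size t = (2 * h) ^ k)%N.
  rewrite -sW -size_cat; apply/perm_size/uniq_perm => //.
    rewrite cat_uniq us filter_uniq // andbT /=.
    by apply/hasPn => z; rewrite mem_filter => /andP[].
  move=> z; rewrite mem_cat mem_filter; case: (boolP (z \in s)) => //= zs.
  by symmetry; apply: mW => c; exact: hs.
pose ab' n : 'rV[R]_k * 'rV[R]_k := if (n < size t)%N then
  (corner e (nth 0 t n), corner e (nth 0 t n) + const_mx e) else ab (n - size t)%N.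
pose a0 : 'rV[R]_k := const_mx (- h%:R * e).
have w0 : 0 < (2 * h)%:R * e by rewrite mulr_gt0 // ltr0n muln_gt0.
have /(cover_volume w0) : box a0 (a0 + const_mx ((2 * h)%:R * e)) `<=`
    \bigcup_n box (ab' n).1 (ab' n).2.
  move=> x hx; pose z : 'rV[int]_k := \row_c Num.floor (x 0 c / e).
  have xz : grid_cube e z x.
    move=> c; rewrite mxE -ler_pdivlMr // -ltr_pdivrMr //.
    by rewrite -[1]/(1%:~R) -intrD floor_itv.
  have [zs|zs] := boolP (z \in s).
    have [n _ hn] := hab x (sX _ zs _ xz); exists (n + size t)%N => //.
    by rewrite /ab' ltnNge leq_addl /= addnK.
  have zt : z \in t.
    rewrite mem_filter zs mW // => c; rewrite mxE.
    have := hx c; rewrite !mxE => /andP[h1 h2].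
    rewrite Num.Theory.floor_ge_int ler_pdivlMr // floor_lt_int ltr_pdivrMr // mulrNz h1 /=.
    by apply: lt_le_trans h2 _; rewrite -mulrDl natrM; rewrite ler_wpM2r ?(ltW e0) //; lra.
  exists (index z t) => //; rewrite /ab' index_mem zt /= nth_index // -grid_cubeE //.
have -> : (\sum_(0 <= n <oo) (box_volume (ab' n).1 (ab' n).2)%:E)%E =
    (\sum_(0 <= n <oo) (if (n < size t)%N then (e ^+ k)%:E else
      (fun n => (box_volume (ab n).1 (ab n).2)%:E) (n - size t)%N))%E.
  by apply: eq_eseriesr => n _; rewrite /ab'; case: ifP => _ //=; rewrite volume_cube.
rewrite (@series_prefix (fun=> e ^+ k) (fun n => (box_volume (ab n).1 (ab n).2)%:E)) => [|n|n]; last first.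
- by rewrite lee_fin box_volume_ge0.
- by rewrite exprn_ge0 // ltW.
rewrite sumr_const card_ord exprMn -natrX -st natrD mulrDl addrC -[in X in (_ <= X + _)%E]mulr_natl.
by rewrite EFinD leeD2lE.
Qed.

End Cells.

(** * Boundaries of upper Minkowski dimension less than k *)

Section Boundary.
Context (R : realType) (k : nat).

(** The crossing point is the supremum of the parameters whose points lie in [A]. *)
Lemma segment_boundary (A : set 'rV[R]_k) (x y : 'rV[R]_k) : A x -> ~ A y ->
  exists2 t : R, 0 <= t <= 1 & boundary A (x + t *: (y - x)).
Proof.
move=> Ax Ay; pose g (t : R) : 'rV[R]_k := x + t *: (y - x).
have cg : continuous g.
  by move=> t; apply: cvgD; [exact: cvg_cst | apply: cvgZr_tmp; exact: cvg_id].
pose S := [set t : R | 0 <= t <= 1 /\ A (g t)].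
have S0 : S 0 by split; rewrite ?lexx ?ler01 // /g scale0r addr0.
have ubS : ubound S 1 by move=> t [/andP[]].
have hS : has_sup S by split; [exists 0 | exists 1].
pose t0 := sup S.
have t00 : 0 <= t0 by apply: ub_le_sup => //; case: hS.
have t01 : t0 <= 1 by apply: ge_sup => //; exists 0.
exists t0; first by rewrite t00.
have near_t (B : set 'rV[R]_k) : nbhs (g t0) B ->
    exists2 r : R, 0 < r & forall t, `|t0 - t| < r -> B (g t).
  by move=> /cg /nbhs_ballP [r /= r0 h]; exists r => // t /h.
split.
  move=> B /near_t [r r0 hr]; have [t [ht1 Agt] ltt] := sup_adherent r0 hS.
  exists (g t); split => //; apply: hr.
  have : t <= t0 by apply: ub_le_sup => //; case: hS.
  by rewrite ltr_norml; move: ltt; rewrite -/t0; lra.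
move=> /near_t [r r0 hr].
have [t1|t1] := ltP t0 1; last first.
  apply: Ay; have := hr t0; rewrite subrr normr0 => /(_ r0).
  have -> : t0 = 1 by apply/eqP; rewrite eq_le t01.
  by rewrite /g scale1r addrC subrK.
pose t := Num.min (t0 + r / 2) 1.
have tt0 : t0 < t by rewrite lt_min t1 andbT; lra.
have tr : t <= t0 + r / 2 by rewrite ge_min lexx.
have tt1 : t <= 1 by rewrite ge_min lexx orbT.
have : t <= t0.
  apply: ub_le_sup; first by case: hS.
  split; first by apply/andP; split => //; lra.
  by apply: hr; rewrite ltr_norml; lra.
by rewrite leNgt tt0.
Qed.

(** With [k - eta] above the dimension, the count is at most [e^(eta - k)] for small [e]; the bound
    [expR (eta * ln e)] is [e^eta]. *)
Lemma minkowski_cells (X : set 'rV[R]_k) : (upper_minkowski_dim X < k%:R%:E)%E ->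
  exists eta e0 : R, [/\ 0 < eta, 0 < e0 & forall e, 0 < e < e0 ->
    exists2 T : seq 'rV[int]_k, (forall z, grid_cube e z `&` X !=set0 -> z \in T) &
      (size T)%:R * e ^+ k <= expR (eta * ln e)].
Proof.
move=> /ereal_inf_lt [_ [V V0 <-]].
set c := ereal_sup _ => ck.
have [eta eta0 hc] : exists2 eta : R, 0 < eta & (c <= (k%:R - eta)%:E)%E.
  move: ck; case: c => [c| |] //.
  - rewrite lte_fin => ck; exists ((k%:R - c) / 2); first by rewrite divr_gt0 // subr_gt0.
    by rewrite lee_fin; lra.
  - by exists 1 => //; rewrite leNye.
have [r /= r0 hr] := V0.
exists eta, (Num.min r 1); split; rewrite ?lt_min ?r0 ?ltr01 // => e /andP[e0].
rewrite lt_min => /andP[er e1].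
have lne0 : 0 < ln e^-1 by rewrite ln_gt0 // invf_gt1.
have Ve : V e by apply: hr => //=; rewrite sub0r normrN gtr0_norm.
have : (lne (box_count e X) * ((ln e^-1)^-1)%:E <= (k%:R - eta)%:E)%E.
  by apply: le_trans hc; apply: ereal_sup_ubound; exists e.
(* An infinite count would make the quotient infinite, which the bound on the supremum excludes. *)
rewrite /box_count /counting; case: asboolP => [fT|_]; last first.
  by rewrite gt0_mulye ?lte_fin ?invr_gt0 // leye_eq.
set T := fset_set _ => h.
exists (finmap.enum_fset T) => [z hz|].
  by apply: etrans (in_fset_set fT z) _; exact/mem_set.
move: h; set n := (X in X%:R%:E); have -> : size (finmap.enum_fset T) = n by [].
have [->|n0] := posnP n; first by rewrite mul0r expR_ge0.
rewrite lne_EFin ?ltr0n // -EFinM lee_fin ler_pdivrMr // lnV ?posrE // => h.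
have -> : e ^+ k = expR (k%:R * ln e) by rewrite mulrC expRM_natr lnK.
rewrite -[n%:R]lnK ?posrE ?ltr0n // -expRD ler_expR.
by move: h; rewrite mulrN mulrBl; lra.
Qed.

(** Once [s * eta >= 2], cells of side [2^-(s j)] give [2^-(s j eta) <= 4^-j]. The finitely many
    scales that are too coarse have finite counts, since [X] is bounded, and go into the
    constant. *)
Lemma minkowski_dyadic (X : set 'rV[R]_k) (M : nat) :
  (forall x c, X x -> `|x 0 c| <= M%:R) -> (upper_minkowski_dim X < k%:R%:E)%E ->
  exists s0, forall s, (s0 <= s)%N -> exists C : R, 0 <= C /\ forall j,
    exists2 T : seq 'rV[int]_k,
      (forall z, grid_cube (2 ^- (s * j)) z `&` X !=set0 -> z \in T) &
      (size T)%:R * (2 ^- (s * j)) ^+ k <= C / 4 ^+ j.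
Proof.
move=> bX /minkowski_cells [eta [e0 [eta0 e00 he]]].
have [s0 hs0] : exists s0, 2 / eta <= s0%:R.
  by exists (Num.truncn (2 / eta)).+1; rewrite ltW // truncnS_gt.
exists s0.+1 => s ss0.
have seta : 2 <= s%:R * eta.
  rewrite -ler_pdivrMr //; apply: le_trans hs0 _; rewrite ler_nat; lia.
pose good j (C : R) := exists2 T : seq 'rV[int]_k,
  (forall z, grid_cube (2 ^- (s * j)) z `&` X !=set0 -> z \in T) &
      (size T)%:R * (2 ^- (s * j)) ^+ k <= C / 4 ^+ j.
have p2 n : 0 < 2 ^+ n :> R by rewrite exprn_gt0.
have p4 n : 0 < 4 ^+ n :> R by rewrite exprn_gt0.
have ex j : {C : R | 0 <= C & good j C}.
  apply: cid2; pose T : seq 'rV[int]_k := boxs k (M.+1 * 2 ^ (s * j)).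
  exists ((size T)%:R * (2 ^- (s * j)) ^+ k * 4 ^+ j).
    by rewrite !mulr_ge0 ?exprn_ge0 ?invr_ge0 ?exprn_ge0.
  exists T; last by rewrite mulfK // gt_eqF.
  move=> z [x [hz Xx]]; rewrite mem_boxs; apply/nrm_leP => c.
  have := hz c; rewrite -ler_pdivlMr ?invr_gt0 // -ltr_pdivrMr ?invr_gt0 // invrK => /andP[h1 h2].
  have := bX x c Xx; rewrite ler_norml => /andP[h3 h4].
  have q0 := p2 (s * j)%N.
  have u1 : (z 0 c)%:~R <= (M * 2 ^ (s * j))%:R :> R.
    by apply: le_trans h1 _; rewrite natrM natrX ler_pM2r.
  have u2 : - (M * 2 ^ (s * j))%:R < (z 0 c)%:~R + 1 :> R.
    by apply: le_lt_trans h2; rewrite natrM natrX -mulNr ler_pM2r.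
  have {}u1 : z 0 c <= (M * 2 ^ (s * j))%N%:Z by rewrite -(ler_int R).
  have {}u2 : - (M * 2 ^ (s * j))%N%:Z < z 0 c + 1.
    by rewrite -(ltr_int R) rmorphN rmorphD.
  have : (0 < 2 ^ (s * j))%N by rewrite expn_gt0.
  rewrite mulSn; move: u1 u2; generalize (z 0 c) (M * 2 ^ (s * j))%N (2 ^ (s * j))%N => a b q; lia.
have [j0 hj0] : exists j0, forall j, (j0 <= j)%N -> 2 ^- (s * j) < e0.
  exists (Num.truncn e0^-1).+1 => j jj; rewrite invf_plt ?posrE //.
  apply: lt_le_trans (truncnS_gt _) _; rewrite -natrX ler_nat.
  apply: leq_trans jj _; apply: leq_trans (ltnW (ltn_expl _ (ltnSn 1))) _.
  by rewrite leq_exp2l // leq_pmull //; lia.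
pose C j := s2val (ex j).
have C0 j : 0 <= C j := s2valP (ex j).
have CP j : good j (C j) := s2valP' (ex j).
have sC0 : 0 <= \sum_(j < j0) C j by apply: sumr_ge0.
exists (1 + \sum_(j < j0) C j); split; first by rewrite addr_ge0.
move=> j; have [jj|jj] := leqP j0 j; last first.
  have [T T1 T2] := CP j; exists T => //; apply: le_trans T2 _.
  rewrite ler_wpM2r ?invr_ge0 ?(ltW (p4 j)) // (bigD1 (Ordinal jj)) //= addrCA lerDl.
  by rewrite addr_ge0 // sumr_ge0.
have [|T T1 T2] := he (2 ^- (s * j)); first by rewrite invr_gt0 p2 hj0.
exists T => //; apply: le_trans T2 _.
apply: le_trans (_ : 1 / 4 ^+ j <= _); last first.
  by rewrite ler_wpM2r ?invr_ge0 ?(ltW (p4 j)) // lerDl.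
rewrite lnV ?posrE // lnXn // mulrN expRN div1r lef_pV2 ?posrE ?expR_gt0 //.
have -> : 4 ^+ j = expR ((2 * j)%:R * ln 2) :> R.
  rewrite expRM_natl lnK ?posrE // exprM; congr (_ ^+ j).
  by rewrite expr2; ring.
rewrite ler_expR -[ln 2 *+ _]mulr_natl mulrA ler_wpM2r ?ln_ge0 ?ler1n //.
rewrite !natrM mulrA [eta * _]mulrC ler_wpM2r //.
Qed.

End Boundary.

(** * Discrepancy of a bounded set with small boundary *)

Section CellIndex.
Context (R : realType) (k : nat).
Implicit Types (x y : 'rV[R]_k) (z w : 'rV[int]_k).

Lemma cidx_itv q x c : (cidx q x 0 c)%:~R <= 2 ^+ q * x 0 c < (cidx q x 0 c)%:~R + 1.
Proof. by rewrite mxE -[X in _ + X]/(1%:~R) -intrD floor_itv. Qed.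

Lemma cidx_eq q x z : (forall c, (z 0 c)%:~R <= 2 ^+ q * x 0 c < (z 0 c)%:~R + 1) -> cidx q x = z.
Proof.
move=> h; apply/rowP => c; rewrite mxE; apply: Num.Theory.floor_def.
by rewrite intrD; exact: h.
Qed.

Lemma close_itv (u v : int) (a : R) : (absz (u - v) <= 2)%N ->
  u%:~R <= a < u%:~R + 1 -> v%:~R - 2 <= a < v%:~R + 3.
Proof.
move=> uv /andP[a1 a2]; have h1 : (v - 2)%:~R <= u%:~R :> R by rewrite ler_int; lia.
have h2 : (u + 1)%:~R <= (v + 3)%:~R :> R by rewrite ler_int; lia.
by move: h1 h2; rewrite intrB !intrD; lra.
Qed.

Lemma itv_close (u v : int) (a : R) : v%:~R - 2 <= a < v%:~R + 3 ->
  u%:~R <= a < u%:~R + 1 -> (absz (v - u) <= 2)%N.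
Proof.
move=> /andP[h1 h2] /andP[h3 h4].
have : (v - 2)%:~R < (u + 1)%:~R :> R by rewrite intrB intrD; lra.
have : u%:~R < (v + 3)%:~R :> R by rewrite intrD; lra.
by rewrite !ltr_int; lia.
Qed.

Lemma convex_itv (t a b l r : R) : 0 <= t -> t <= 1 -> l <= a -> a < r -> l <= b -> b < r ->
  l <= (1 - t) * a + t * b < r.
Proof.
move=> t0 t1 la ar lb br; apply/andP; split; first by nra.
apply: le_lt_trans (_ : Num.max a b < r); last by rewrite gt_max ar.
have ua : a <= Num.max a b by rewrite le_max lexx.
have ub : b <= Num.max a b by rewrite le_max lexx orbT.
by move: (Num.max a b) ua ub => u ua ub; nra.
Qed.

Lemma grid_cubeP q x z : grid_cube (2 ^- q) z x <-> cidx q x = z.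
Proof.
have p2 : 0 < 2 ^+ q :> R by rewrite exprn_gt0.
split=> [h|<- c].
  apply: cidx_eq => c; have := h c.
  by rewrite ler_pdivrMr // ltr_pdivlMr // [_ * 2 ^+ q]mulrC.
by rewrite ler_pdivrMr // ltr_pdivlMr // [_ * 2 ^+ q]mulrC cidx_itv.
Qed.

Lemma cidx_shift q x z (L : nat) :
  cidx q (x - L%:R *: map_mx intr z) = cidx q x - (L * 2 ^ q)%N%:Z *: z.
Proof.
apply: cidx_eq => c; have := cidx_itv q x c; rewrite !mxE.
rewrite intrB intrM -pmulrn natrM natrX.
move: (Num.floor _)%:~R => f; have -> : 2 ^+ q * (x 0 c - L%:R * (z 0 c)%:~R) =
  2 ^+ q * x 0 c - L%:R * 2 ^+ q * (z 0 c)%:~R by ring.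
by move: (L%:R * 2 ^+ q * _) => g; lra.
Qed.

Lemma cmodP m (u v : 'rV[int]_k) : cmod m u v -> exists w, u = v + m%:Z *: w.
Proof.
move=> /forallP h; exists (\row_c divz (u 0 c - v 0 c) m); apply/rowP => c.
rewrite rvD !mxE mulrC divzK; first by rewrite addrC subrK.
by rewrite -eqz_mod_dvd; exact: h.
Qed.

Lemma cmod_scale m (u v w : 'rV[int]_k) : u = v + m%:Z *: w -> cmod m u v.
Proof.
by move=> ->; apply/forallP => c; rewrite rvD mxE addrC mulrC modzMDl.
Qed.

Lemma cmodD m (u v w : 'rV[int]_k) : cmod m (w + u) v = cmod m u (v - w).
Proof.
apply: eq_forallb => c; rewrite rvD rvB !eqz_mod_dvd.
by congr (_ \in dvdz _); ring.
Qed.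

Lemma sum_le1 (I : eqType) (s : seq I) (P : I -> bool) : uniq s ->
  {in s &, forall i j, P i -> P j -> i = j} -> \sum_(i <- s) (P i)%:R <= 1 :> R.
Proof.
move=> us h; have -> : \sum_(i <- s) (P i)%:R = (size [seq i <- s | P i])%:R :> R.
  rewrite size_filter -sum1_count natr_sum [RHS]big_mkcond /=.
  by apply: eq_bigr => i _; case: (P i).
rewrite -[leRHS]/(1%:R) ler_nat; have := filter_uniq P us.
case E : [seq i <- s | P i] => [|i [|j r]] //= /andP[]; rewrite inE negb_or => /andP[/eqP ij _] _.
have : i \in [seq i <- s | P i] by rewrite E inE eqxx.
have : j \in [seq i <- s | P i] by rewrite E !inE eqxx orbT.
rewrite !mem_filter => /andP[Pj js] /andP[Pi is_].
by case: ij; apply: h.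
Qed.

Lemma sumr_const_list (I : Type) (s : seq I) (c : R) : \sum_(i <- s) c = (size s)%:R * c.
Proof. by rewrite big_const_seq count_predT iter_addr_0 mulr_natl. Qed.

Definition per (L : nat) (A : set 'rV[R]_k) : set 'rV[R]_k :=
  [set x | exists z : 'rV[int]_k, A (x - L%:R *: map_mx intr z)].

End CellIndex.

(** * Visits to a set, compared with visits to grid cells *)

Section Discrepancy.
Context (R : realType) (k : nat).
Hypothesis k0 : (0 < k)%N.
Variables (L' M s e0 : nat).
Hypothesis ML : (M + 5 <= L')%N.
Let L := (2 * L')%N.
Let e := (2 * s * k + 3 + e0)%N.
Let d := (s * k + 2 + e)%N.
Variable al : 'M[R]_(d, k).
Hypothesis al_approx : forall rho J, 0 < rho -> exists al' : 'M[R]_(d, k),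
  (forall i c, `|al' i c - al i c| < rho) /\
  forall j zeta, (0 < j <= J)%N ->
    `|\sum_(n <- cube d (2 ^ j)) (cmod (L * 2 ^ (s * j)) (cidx (s * j) (shiftv al' n)) zeta)%:R
       - 2 ^+ (j * d) / (L * 2 ^ (s * j))%:R ^+ k| <= 2 * 2 ^+ (j * e) :> R.
Variables (A : set 'rV[R]_k) (lam C : R).
Hypothesis bA : forall x c, A x -> `|x 0 c| <= M%:R.
Hypothesis lamE : lebesgue A = lam%:E.
Hypothesis C0 : 0 <= C.
Hypothesis bdry : forall j, exists2 T : seq 'rV[int]_k,
  (forall z, grid_cube (2 ^- (s * j)) z `&` boundary A !=set0 -> z \in T) &
  (size T)%:R * (2 ^- (s * j)) ^+ k <= C / 4 ^+ j.

Section Scale.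
Variable (j : nat).
Hypothesis j0 : (0 < j)%N.
Let q := (s * j)%N.
Let m := (L * 2 ^ q)%N.
Let h := (L' * 2 ^ q)%N.
Variable T : seq 'rV[int]_k.
Hypothesis TP : forall z, grid_cube (2 ^- q) z `&` boundary A !=set0 -> z \in T.

Definition near_bdry (z : 'rV[int]_k) := has (fun t => (nrm (z - t) <= 2)%N) T.

(** A segment from a point of [A] to a point outside meets the boundary. The points whose index is
    within two of [z] form a convex set, so the crossing would make [z] near the boundary. *)
Lemma off_boundary (z : 'rV[int]_k) x y : ~~ near_bdry z ->
  (nrm (cidx q x - z) <= 2)%N -> (nrm (cidx q y - z) <= 2)%N -> A x -> A y.
Proof.
move=> nb /nrm_leP hx /nrm_leP hy Ax; apply: contrapT => Ay.
have [t /andP[t0 t1] bt] := segment_boundary Ax Ay.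
set p := x + t *: (y - x) in bt; case/negP: nb; apply/hasP; exists (cidx q p).
  by apply: TP; exists p; split => //; apply/grid_cubeP.
apply/nrm_leP => c; have := hx c; have := hy c; rewrite !rvB => hyc hxc.
have /andP[x1 x2] := close_itv hxc (cidx_itv q x c).
have /andP[y1 y2] := close_itv hyc (cidx_itv q y c).
apply: (itv_close _ (cidx_itv q p c)).
have -> : 2 ^+ q * p 0 c = (1 - t) * (2 ^+ q * x 0 c) + t * (2 ^+ q * y 0 c).
  by rewrite /p !mxE; ring.
exact: convex_itv.
Qed.

Let m0 : (0 < m)%N. Proof. by rewrite !muln_gt0 expn_gt0 /=; lia. Qed.
Let mE : m = (2 * h)%N. Proof. by rewrite /m /h /L mulnA. Qed.
Let h_big : (M * 2 ^ q + 4 < h)%N.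
Proof.
have : ((M + 5) * 2 ^ q <= h)%N by rewrite leq_mul2r ML orbT.
have : (0 < 2 ^ q)%N by rewrite expn_gt0.
rewrite mulnDl; generalize (M * 2 ^ q)%N (2 ^ q)%N h; lia.
Qed.

Definition bdry_cells := [seq z <- boxs k h.-1 | near_bdry z].
Definition inner_cells :=
  [seq z <- boxs k h.-1 | ~~ near_bdry z && `[< grid_cube (2 ^- q) z `<=` A >]].
Local Notation In := inner_cells.
Local Notation Bd := bdry_cells.

Lemma cells_small (z : 'rV[int]_k) : z \in In ++ Bd -> (nrm z <= h.-1)%N.
Proof.
by rewrite mem_cat !mem_filter mem_boxs => /orP[|] /andP[].
Qed.

Lemma uniq_cells : uniq (In ++ Bd).
Proof.
rewrite cat_uniq !filter_uniq ?boxs_uniq // andbT /=.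
by apply/hasPn => z; rewrite !mem_filter => /andP[-> _].
Qed.

Lemma size_cells : (size (In ++ Bd) <= m ^ k)%N.
Proof.
apply: leq_trans (_ : size (boxs k h.-1) <= _)%N.
  by apply: uniq_leq_size uniq_cells _ => z /cells_small; rewrite mem_boxs.
by rewrite size_boxs leq_exp2r // mE; move: h_big; lia.
Qed.

Lemma size_bdry_cells : (size Bd <= 5 ^ k * size T)%N.
Proof.
have -> : (5 ^ k * size T)%N = size [seq v + t | v <- boxs k 2, t <- T].
  by rewrite size_allpairs size_boxs.
apply: uniq_leq_size; first by rewrite filter_uniq ?boxs_uniq.
move=> z; rewrite mem_filter => /andP[/hasP[t tT zt] _].
by apply/allpairsP; exists (z - t, t); rewrite /= mem_boxs subrK.
Qed.

Lemma mem_cells x (z : 'rV[int]_k) : A x -> (nrm (cidx q x - z) <= 2)%N -> z \in In ++ Bd.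
Proof.
move=> Ax hz; rewrite mem_cat !mem_filter mem_boxs.
have -> : (nrm z <= h.-1)%N.
  apply/nrm_leP => c; have /nrm_leP/(_ c) := hz; rewrite rvB.
  have /andP[x1 x2] := cidx_itv q x c; have := bA c Ax; rewrite ler_norml => /andP[a1 a2].
  have p2 : 0 < 2 ^+ q :> R by rewrite exprn_gt0.
  have u1 : cidx q x 0 c <= (M * 2 ^ q)%N%:Z.
    rewrite -(ler_int R) -pmulrn natrM natrX mulrC; apply: le_trans x1 _.
    by rewrite ler_pM2l.
  have u2 : - (M * 2 ^ q)%N%:Z < cidx q x 0 c + 1.
    rewrite -(ltr_int R) intrD rmorphN /= -pmulrn natrM natrX; apply: le_lt_trans x2.
    by rewrite -mulNr mulrC ler_pM2l.
  move: h_big u1 u2; generalize (cidx q x 0 c) (z 0 c) (M * 2 ^ q)%N h => a b u v; lia.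
rewrite !andbT; case: (boolP (near_bdry z)) => //= nb; rewrite orbF.
apply/asboolP => y /grid_cubeP yz; apply: off_boundary nb hz _ Ax.
by rewrite yz subrr nrm0.
Qed.

Lemma inner_sub x (z : 'rV[int]_k) : z \in In -> (nrm (cidx q x - z) <= 2)%N -> A x.
Proof.
rewrite mem_filter => /andP[/andP[nb /asboolP hz] _] hx.
apply: (off_boundary (x := corner (2 ^- q) z) nb _ hx).
  have /grid_cubeP -> : grid_cube (2 ^- q) z (corner (2 ^- q : R) z).
    by move=> c; rewrite mxE lexx ltr_pM2r ?invr_gt0 ?exprn_gt0 // ltrDl ltr01.
  by rewrite subrr nrm0.
by apply: hz => c; rewrite mxE lexx ltr_pM2r ?invr_gt0 ?exprn_gt0 // ltrDl ltr01.
Qed.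

Lemma lebesgue_inner : (size In)%:R * (2 ^- q) ^+ k <= lam.
Proof.
rewrite -lee_fin -lamE; apply: (@cells_le_lebesgue R k k0 _ h) => //.
- by move: h_big; lia.
- by rewrite filter_uniq ?boxs_uniq.
- move=> z c zI; have := @cells_small z; rewrite mem_cat zI => /(_ isT) /nrm_leP/(_ c).
  by move: h_big; generalize (z 0 c) h (M * 2 ^ q)%N => a b u; lia.
- by move=> z; rewrite mem_filter => /andP[/andP[_ /asboolP]].
Qed.

Lemma lebesgue_outer : lam <= (size (In ++ Bd))%:R * (2 ^- q) ^+ k.
Proof.
rewrite -lee_fin -lamE; apply: lebesgue_le_cells => // x Ax.
exists (cidx q x); last exact/grid_cubeP.
by apply: mem_cells Ax _; rewrite subrr nrm0.
Qed.

Variables (x : 'rV[R]_k) (I : eqType) (ns : seq I) (y : I -> 'rV[R]_k) (zeta : I -> 'rV[int]_k).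
Hypothesis y_close : forall n, n \in ns -> (nrm (cidx q (y n) - zeta n) <= 2)%N.

(** An inner cell lies in [A] together with everything within two cells of it, so an approximate
    visit is a true visit. Inner cells have indices below [h] in absolute value, so no two are
    congruent modulo [m = 2 * h] and no visit counts twice. *)
Lemma sum_inner : \sum_(z <- In) \sum_(n <- ns) (cmod m (zeta n) z)%:R <=
  \sum_(n <- ns) (`[< per L A (y n) >])%:R :> R.
Proof.
rewrite exchange_big /= big_seq [leRHS]big_seq; apply: ler_sum => n nn.
case: (boolP (has (cmod m (zeta n)) In)) => [/hasP[z zI hz]|]; last first.
  by move=> /hasPn nz; rewrite big_seq big1 // => z /nz /negbTE ->.
have [w hw] := cmodP hz.
have -> : `[< per L A (y n) >] = true.
  apply/asboolP; exists w; apply: (inner_sub zI).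
  by rewrite cidx_shift addrAC -addrA -opprD -hw; exact: y_close.
apply: sum_le1; first by rewrite filter_uniq ?boxs_uniq.
suff inj : forall z1 z2 : 'rV[int]_k, z1 \in In -> z2 \in In ->
    cmod m (zeta n) z1 -> cmod m (zeta n) z2 -> z1 = z2 by move=> z1 z2; exact: inj.
move=> z1 z2 h1 h2 /forallP c1 /forallP c2; apply/rowP => c.
have {}h1 : (nrm z1 <= h.-1)%N by apply: cells_small; rewrite mem_cat h1.
have {}h2 : (nrm z2 <= h.-1)%N by apply: cells_small; rewrite mem_cat h2.
have /eqP := c1 c; have /eqP -> := c2 c => /eqP; rewrite eqz_mod_dvd => hd.
have := leq_trans (nrm_coord z1 c) h1; have := leq_trans (nrm_coord z2 c) h2.
move: hd m0 mE; rewrite dvdzE /=; generalize (z1 0 c) (z2 0 c) m h => a b u v hd u0 uE ha hb.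
have [/eqP|ab] := posnP (absz (b - a)); first by lia.
by have := dvdn_leq ab hd; lia.
Qed.

Lemma sum_outer : \sum_(n <- ns) (`[< per L A (y n) >])%:R <=
  \sum_(z <- In ++ Bd) \sum_(n <- ns) (cmod m (zeta n) z)%:R :> R.
Proof.
rewrite exchange_big /= big_seq [leRHS]big_seq; apply: ler_sum => n nn.
case: asboolP => [[w Aw]|_]; last by rewrite sumr_ge0.
have zI : zeta n - m%:Z *: w \in In ++ Bd.
  apply: (mem_cells Aw); rewrite cidx_shift opprB addrA subrK.
  exact: y_close.
rewrite (big_rem _ zI) /= (cmod_scale (w := w)) ?subrK // lerDl.
by rewrite sumr_ge0.
Qed.

End Scale.

(** Rounding [x] and the shift separately costs one unit, and passing from [al] to [al'] another:
    hence the tolerance 2 in the cell indices. *)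
Lemma close_cells q (N : nat) (rho : R) (al' : 'M[R]_(d, k)) (x : 'rV[R]_k) n :
  (forall i c, `|al' i c - al i c| < rho) -> 2 ^+ q * ((d * N)%:R * rho) <= 1 ->
  n \in cube d N ->
  (nrm (cidx q (x + shiftv al n) - (cidx q x + cidx q (shiftv al' n))) <= 2)%N.
Proof.
move=> hal hrho /mem_cube hn; apply/nrm_leP => c; rewrite rvB rvD.
have p2 : 0 < 2 ^+ q :> R by rewrite exprn_gt0.
have hd : `|2 ^+ q * shiftv al' n 0 c - 2 ^+ q * shiftv al n 0 c| <= 1.
  apply: le_trans hrho; rewrite -mulrBr normrM gtr0_norm // ler_pM2l //.
  rewrite !mxE -sumrB; apply: le_trans (ler_norm_sum _ _ _) _.
  rewrite natrM -mulrA mulr_natl -[in leRHS](card_ord d) -sumr_const; apply: ler_sum => i _.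
  rewrite !mxE -mulrBr normrM; apply: ler_pM => //; last exact/ltW/hal.
  rewrite -intr_norm pmulrn ler_int; have := hn i; generalize (n 0 i) => a; lia.
have := cidx_itv q (x + shiftv al n) c; have := cidx_itv q x c.
have := cidx_itv q (shiftv al' n) c; move: hd.
have -> : 2 ^+ q * (x + shiftv al n) 0 c = 2 ^+ q * x 0 c + 2 ^+ q * shiftv al n 0 c.
  by rewrite !mxE mulrDr.
move: (2 ^+ q * x 0 c) (2 ^+ q * shiftv al n 0 c) (2 ^+ q * shiftv al' n 0 c) => a b b'.
generalize (cidx q (x + shiftv al n) 0 c) (cidx q x 0 c) (cidx q (shiftv al' n) 0 c) => u v w.
rewrite ler_norml => /andP[h1 h2] /andP[h3 h4] /andP[h5 h6] /andP[h7 h8].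
have : (u - v - w)%:~R < 3%:~R :> R by rewrite !intrB; lra.
have : (-2)%:~R < (u - v - w)%:~R :> R by rewrite !intrB; lra.
by rewrite !ltr_int; lia.
Qed.

(** Both the visits and the measure lie between the contributions of the inner cells and of the
    inner and boundary cells. The gap consists of the boundary cells, few by dimension, and of the
    frequency errors of all cells, small by the choice of [d]. *)
Lemma discrepancy_scale j x : (0 < j)%N ->
  `|\sum_(n <- cube d (2 ^ j)) (`[< per L A (x + shiftv al n) >])%:R -
      lam / L%:R ^+ k * 2 ^+ (j * d)| <=
  ((5 ^ k)%:R * C + 2 * L%:R ^+ k) * 2 ^+ (j * d) / 4 ^+ j.
Proof.
move=> j0; have [T TP hT] := bdry j; pose q := (s * j)%N.
have p2 n : 0 < 2 ^+ n :> R by rewrite exprn_gt0.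
have L0 : (0 < L)%N by rewrite /L; lia.
have LR : 1 <= L%:R ^+ k :> R by rewrite exprn_ege1 // ler1n.
have d0 : (0 < d)%N by rewrite /d /e; lia.
(* Chosen so that replacing [al] by [al'] moves no point of the cube by more than one cell side. *)
pose rho : R := (2 ^+ q * (d * 2 ^ j)%:R)^-1.
have dj0 : 0 < (d * 2 ^ j)%:R :> R by rewrite ltr0n muln_gt0 d0 expn_gt0.
have rho0 : 0 < rho by rewrite invr_gt0 mulr_gt0.
have [al' [hal hdev]] := al_approx j rho0.
have hrho : 2 ^+ q * ((d * 2 ^ j)%:R * rho) <= 1.
  by rewrite mulrA /rho divff // mulf_neq0 // gt_eqF.
have close n : n \in cube d (2 ^ j) -> _ := close_cells x hal hrho.
have h1 := sum_inner j0 TP close; have h2 := sum_outer j0 TP close.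
set S := \sum_(n <- _) (`[< per L A _ >])%:R in h1 h2 *.
have dev z : `|\sum_(n <- cube d (2 ^ j)) (cmod (L * 2 ^ q) (cidx q x + cidx q (shiftv al' n)) z)%:R
    - 2 ^+ (j * d) / (L * 2 ^ q)%:R ^+ k| <= 2 * 2 ^+ (j * e) :> R.
  under eq_bigr => n _ do rewrite cmodD.
  by apply: hdev; rewrite j0 leqnn.
have l1 := lebesgue_inner j0 T; have l2 := lebesgue_outer j0 TP.
have sz := size_cells j0 T; have sb := size_bdry_cells j T.
rewrite -/q in l1 l2 sz.
set In := inner_cells j T in h1 h2 l1 l2 sz *; set Bd := bdry_cells j T in h2 l2 sz sb *.
pose G : R := 2 ^+ (j * d) / L%:R ^+ k; pose de : R := (2 ^- q) ^+ k.
have G0 : 0 <= G by rewrite divr_ge0 ?exprn_ge0 // ltW.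
have DE : 2 ^+ (j * d) / (L * 2 ^ q)%:R ^+ k = G * de.
  by rewrite /G /de natrM natrX exprMn invfM mulrA exprVn.
rewrite DE in dev; pose E : R := 2 * 2 ^+ (j * e).
have E0 : 0 <= E by rewrite mulr_ge0 // ltW.
have k1 : (size In)%:R * (G * de - E) <= S.
  apply: (le_trans _ h1); rewrite -sumr_const_list; apply: ler_sum => z _.
  by have := dev z; rewrite ler_norml -/E => /andP[? _]; lra.
have k2 : S <= (size (In ++ Bd))%:R * (G * de + E).
  apply: (le_trans h2); rewrite -sumr_const_list; apply: ler_sum => z _.
  by have := dev z; rewrite ler_norml -/E => /andP[_ ?]; lra.
have hE : (size (In ++ Bd))%:R * E <= 2 * L%:R ^+ k * 2 ^+ (j * d) / 4 ^+ j.
  apply: le_trans (_ : (L * 2 ^ q)%:R ^+ k * E <= _).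
    by rewrite ler_wpM2r // -natrX ler_nat.
  rewrite ler_pdivlMr ?exprn_gt0 // /E -!natrX -!natrM ler_nat.
  have -> : (j * d = q * k + j * e + 2 * j)%N by rewrite /d /q; ring.
  rewrite expnMn -expnM 2!expnD -[4%N]/(2 ^ 2)%N -[((2 ^ 2) ^ j)%N]expnM; apply/eq_leq; ring.
have hB : (size Bd)%:R * de * G <= (5 ^ k)%:R * C * 2 ^+ (j * d) / 4 ^+ j.
  have -> : (5 ^ k)%:R * C * 2 ^+ (j * d) / 4 ^+ j = (5 ^ k)%:R * (C / 4 ^+ j) * 2 ^+ (j * d) by ring.
  apply: ler_pM => //; first by rewrite mulr_ge0 // /de exprn_ge0 // invr_ge0 ltW.
    apply: le_trans (_ : (5 ^ k * size T)%:R * de <= _).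
      by rewrite ler_wpM2r ?ler_nat // /de exprn_ge0 // invr_ge0 ltW.
    by rewrite natrM -mulrA ler_wpM2l.
  by rewrite /G ler_pdivrMr ?(lt_le_trans ltr01) // ler_peMr // ltW.
have hG : lam / L%:R ^+ k * 2 ^+ (j * d) = G * lam by rewrite /G; ring.
have g1 := ler_wpM2l G0 l1; have g2 := ler_wpM2l G0 l2.
rewrite hG mulrDl mulrDl; move: k1 k2 hE hB g1 g2; rewrite size_cat natrD -/de.
move: (_ / 4 ^+ j) (_ / 4 ^+ j) => Y1 Y2 k1 k2 hE hB g1 g2.
have aE : 0 <= (size Bd)%:R * E by rewrite mulr_ge0.
by rewrite ler_norml; apply/andP; split; lra.
Qed.

Lemma discrepancy : exists C' : R, forall j x,
  `|\sum_(n <- cube d (2 ^ j)) (`[< per L A (x + shiftv al n) >])%:R -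
      lam / L%:R ^+ k * 2 ^+ (j * d)| <= C' * 2 ^+ (j * d) / 4 ^+ j.
Proof.
(* The added constant covers scale 0, where the sum has a single term. *)
exists (((5 ^ k)%:R * C + 2 * L%:R ^+ k) + (1 + `|lam / L%:R ^+ k|)) => j x.
have P0 : 0 <= 2 ^+ (j * d) / 4 ^+ j :> R by rewrite divr_ge0 ?exprn_ge0.
have [->|j0] := posnP j; last first.
  apply: le_trans (discrepancy_scale x j0) _; rewrite -!mulrA ler_wpM2r // lerDl.
  by rewrite addr_ge0.
rewrite mul0n !expr0 mulr1 divr1 mulr1; apply: le_trans (ler_normB _ _) _.
rewrite addrA lerD2r -[leLHS]add0r; apply: lerD.
  by rewrite addr_ge0 ?mulr_ge0 // exprn_ge0.
apply: le_trans (ler_norm_sum _ _ _) _.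
apply: le_trans (_ : \sum_(n <- cube d (2 ^ 0)) 1 <= _).
  by apply: ler_sum => n _; case: asboolP => _; rewrite ?normr1 ?normr0.
by rewrite big_const_seq count_predT iter_addr_0 size_cube expn0 exp1n.
Qed.

End Discrepancy.

(** * Borel pieces *)

Section Borel.
Context (R : realType) (k : nat).
Local Notation E := 'rV[R]_k.
Local Notation BE := (g_sigma_algebraType (@open E)).

Lemma borel_preimage (f : E -> E) (A : set E) : continuous f -> borel A -> borel (f @^-1` A).
Proof.
move=> cf bA; have sa : sigma_algebra setT (image_set_system setT f (@borel R k)).
  exact/sigma_algebra_image/smallest_sigma_algebra.
have : image_set_system setT f (@borel R k) A; last by rewrite /image_set_system /= setTI.
apply: (smallest_sub sa _ bA) => U oU; rewrite /image_set_system /= setTI.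
by apply: sub_gen_smallest; apply: open_comp => // x _; exact: cf.
Qed.

Lemma borel_translate (t : E) (A : set E) : borel A -> borel [set x | A (x + t)].
Proof.
have cf : continuous (fun x : E => x + t).
  move=> x; exact: (cvgD (@cvg_id _ (nbhs x)) (cvg_cst t)).
exact: borel_preimage cf.
Qed.

Lemma borel_exists (Y : countType) (P : Y -> E -> Prop) :
  (forall y, borel [set x | P y x]) -> borel [set x | exists y, P y x].
Proof. by move=> bP; exact: (@meas_exists _ BE Y P bP). Qed.

Lemma borel_and (P Q : E -> Prop) : borel [set x | P x] -> borel [set x | Q x] ->
  borel [set x | P x /\ Q x].
Proof. by move=> bP bQ; exact: (@meas_and _ BE P Q bP bQ). Qed.

Lemma borel_slab c (u v : R) : borel [set x : E | u <= x 0 c < v].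
Proof.
have lt w : borel [set x : E | x 0 c < w].
  apply: sub_gen_smallest.
  apply: (@open_comp _ _ (fun x : E => x 0 c) [set y | y < w]); last exact: open_lt.
  by move=> x _; exact: coord_continuous.
have -> : [set x : E | u <= x 0 c < v] = [set x : E | ~ (x 0 c < u) /\ x 0 c < v].
  apply/seteqP; split=> x /=; first by move=> /andP[h ->]; split => //; apply/negP; rewrite -leNgt.
  by move=> [/negP h ->]; rewrite andbT leNgt.
apply: (borel_and _ (lt v)); exact: (@meas_not _ BE _ (lt u)).
Qed.

Variable L : nat.

Definition periodic (A : set E) := forall x (w : 'rV[int]_k), A x -> A (x + L%:R *: map_mx intr w).

Definition per_borel : set (set E) := [set A | borel A /\ periodic A].

Lemma periodicE A x (w : 'rV[int]_k) : periodic A -> A (x + L%:R *: map_mx intr w) <-> A x.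
Proof.
move=> pA; split=> [|]; last exact: pA.
by move=> /(pA _ (- w)); rewrite map_mxN scalerN addrK.
Qed.

Lemma per_borel_sigma : sigma_algebra setT per_borel.
Proof.
have [b0 bC bU] := smallest_sigma_algebra setT (@open E).
split; first by split.
- move=> A [bA pA]; split; first exact: bC.
  move=> x w [_ nA]; split => // /(periodicE _ _ pA); exact: nA.
- move=> F hF; split; first by apply: bU => n; case: (hF n).
  by move=> x w [n _ Fx]; exists n => //; case: (hF n) => _; exact.
Qed.

(* Points are not identified modulo the lattice: working with the periodic Borel sets makes
   every measurable map automatically invariant under the lattice. *)
Definition torus := g_sigma_algebraType per_borel.

Lemma torus_measurable (A : set torus) : measurable A <-> borel (A : set E) /\ periodic A.
Proof.
split; last by move=> hA; apply: sub_gen_smallest.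
exact: (smallest_sub per_borel_sigma (fun _ h => h)).
Qed.

Lemma periodic_per (A : set E) : periodic (per L A).
Proof.
move=> x w [z hz]; exists (z + w).
by rewrite map_mxD scalerDr opprD [in X in A X]addrACA subrr addr0.
Qed.

Lemma borel_per (A : set E) : borel A -> borel (per L A).
Proof. by move=> bA; apply: borel_exists => z; exact: borel_translate. Qed.

Variables (d : nat) (al : 'M[R]_(d, k)).

Lemma shiftvD m n : shiftv al (m + n) = shiftv al m + shiftv al n.
Proof. by rewrite /shiftv map_mxD mulmxDl. Qed.

Lemma shiftv0 : shiftv al 0 = 0.
Proof. by rewrite /shiftv map_mx0 mul0mx. Qed.

Definition rotate (n : 'rV[int]_d) (x : torus) : torus := (x : E) + shiftv al n.

Lemma rotate0 x : rotate 0 x = x.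
Proof. by rewrite /rotate shiftv0 addr0. Qed.

Lemma rotateD m n x : rotate (m + n) x = rotate m (rotate n x).
Proof. by rewrite /rotate shiftvD addrA addrAC. Qed.

Lemma meas_rotate n (P : torus -> Prop) : measurable [set x | P x] ->
  measurable [set x | P (rotate n x)].
Proof.
move=> /torus_measurable [bP pP]; apply/torus_measurable; split.
  exact: (borel_translate (shiftv al n) bP).
by move=> x w /=; rewrite /rotate addrAC; exact: pP.
Qed.

Definition rotation := ZAction rotate0 rotateD meas_rotate.

(** The finitely many short displacements move the coordinate [c0] by at least some [eps] modulo
    [L]. Colouring by intervals of length [L / p < eps] of this coordinate modulo [L] thus
    separates. *)
Lemma rotation_separable (c0 : 'I_k) : (0 < L)%N ->
  (forall n : 'rV[int]_d, n != 0 -> exists2 eps : R, 0 < eps &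
    forall z : int, eps <= `|shiftv al n 0 c0 - L%:R * z%:~R|) ->
  separable rotation.
Proof.
move=> L0 free r; have L0R : 0 < L%:R :> R by rewrite ltr0n.
have [eps eps0 heps] : exists2 eps : R, 0 < eps & forall (n : 'rV[int]_d) (z : int),
    n != 0 -> (nrm n <= r)%N -> eps <= `|shiftv al n 0 c0 - L%:R * z%:~R|.
  have : exists2 eps : R, 0 < eps & forall (n : 'rV[int]_d) (z : int),
      n \in boxs d r -> n != 0 -> eps <= `|shiftv al n 0 c0 - L%:R * z%:~R|.
    elim: (boxs d r) => [|n s [e1 e10 IH]]; first by exists 1.
    have [->|n0] := eqVneq n 0.
      by exists e1 => // m z; rewrite inE => /orP[/eqP -> /eqP|] // /IH; apply.
    have [e2 e20 he2] := free n n0; exists (Num.min e1 e2); first by rewrite lt_min e10.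
    move=> m z; rewrite inE ge_min => /orP[/eqP -> _|ms m0].
      by rewrite he2 orbT.
    by rewrite IH.
  by move=> [eps e0 h]; exists eps => // n z n0 nr; apply: h; rewrite ?mem_boxs.
pose p := (Num.truncn (L%:R / eps)).+1.
have p0 : 0 < p%:R :> R by rewrite ltr0n.
have pe : L%:R / p%:R < eps.
  by rewrite ltr_pdivrMr // mulrC -ltr_pdivrMr // truncnS_gt.
pose U (i : nat) (x : torus) := exists z : int,
  L%:R * z%:~R + i%:R * (L%:R / p%:R) <= (x : E) 0 c0 < L%:R * z%:~R + i.+1%:R * (L%:R / p%:R).
exists p, U; split.
- move=> i; apply/torus_measurable; split.
    by apply: borel_exists => z; exact: borel_slab.
  move=> x w [z hz]; exists (z + w 0 c0); move: hz; rewrite !mxE intrD mulrDr.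
  by move: (L%:R * (w 0 c0)%:~R) => t; lra.
- move=> x; pose y : R := (x : E) 0 c0 * (p%:R / L%:R).
  have := floor_itv y; set f := Num.floor y => hf.
  have p0' : p%:Z != 0 by [].
  exists (absz (modz f p)); first by have := ltz_pmod f (d := p); have := modz_ge0 f p0'; lia.
  exists (divz f p).
  have fE : (absz (modz f p))%:R = f%:~R - (divz f p)%:~R * p%:R :> R.
    rewrite [LHS]pmulrn [p%:R]pmulrn -intrM -intrB gez0_abs ?modz_ge0 //.
  rewrite fE; have -> : (absz (modz f p)).+1%:R = f%:~R + 1 - (divz f p)%:~R * p%:R :> R.
    by rewrite -natr1 fE addrAC.
  have E1 (g : R) : L%:R * (divz f p)%:~R + (g - (divz f p)%:~R * p%:R) * (L%:R / p%:R) = g / (p%:R / L%:R).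
    by field; rewrite !gt_eqF.
  rewrite !E1 ler_pdivrMr ?divr_gt0 // ltr_pdivlMr ?divr_gt0 // -/y.
  by rewrite -[1]/(1%:~R) -intrD.
- move=> i x n [z1 h1] [z2 h2] nr; apply/eqP; apply: contraT => n0.
  have := heps n (z2 - z1) n0 nr; rewrite leNgt => /negP[].
  apply: le_lt_trans pe; move: h1 h2; rewrite /= /rotate !mxE intrB mulrBr -natr1 mulrDl mul1r.
  move: (L%:R / p%:R) (i%:R * _) (L%:R * z1%:~R) (L%:R * z2%:~R) => t g u v.
  by move=> /andP[h1 h2] /andP[h3 h4]; rewrite ler_norml; apply/andP; split; lra.
Qed.

End Borel.

(** * Passing to a cluster point *)

Section Angles.
Context (R : realType) (k L s e0 : nat) (c0 : 'I_k).
Hypotheses (L0 : (0 < L)%N) (Le : (4 * L ^ k < 2 ^ e0)%N).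
Let e := (2 * s * k + 3 + e0)%N.
Let d := (s * k + 2 + e)%N.

(** Floors are discontinuous, so the counting estimates are not claimed for the limit but only for
    matrices arbitrarily close to it. The lower bounds for freeness depend continuously on the
    matrix and survive with half the constant. *)
Lemma exists_angles : exists al : 'M[R]_(d, k),
  (forall rho J, 0 < rho -> exists al' : 'M[R]_(d, k),
    (forall i c, `|al' i c - al i c| < rho) /\
    forall j zeta, (0 < j <= J)%N ->
      `|\sum_(n <- cube d (2 ^ j)) (cmod (L * 2 ^ (s * j)) (cidx (s * j) (shiftv al' n)) zeta)%:R
       - 2 ^+ (j * d) / (L * 2 ^ (s * j))%:R ^+ k| <= 2 * 2 ^+ (j * e) :> R) /\
  (forall n : 'rV[int]_d, n != 0 -> exists2 eps : R, 0 < eps &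
    forall z : int, eps <= `|shiftv al n 0 c0 - L%:R * z%:~R|).
Proof.
have [u hu] := choice (fun J => finite_alpha R s c0 L0 Le J).
have [al hal] : exists al : 'M[R]_(d, k), forall rho J0, 0 < rho ->
    exists2 J, (J0 <= J)%N & forall i c, `|u J i c - al i c| < rho.
  by apply: (bounded_cluster (L := L%:R)) => J; case: (hu J).
exists al; split.
  move=> rho J rho0; have [J' JJ' close] := hal rho J rho0; exists (u J'); split => // j zeta.
  move=> /andP[j0 jJ]; have [_ h _] := hu J'; apply: h.
  by rewrite j0 (leq_trans jJ).
move=> n n0; pose eps : R := L%:R / 2 ^+ (pickle n + 4).
have eps0 : 0 < eps by rewrite divr_gt0 ?exprn_gt0 // ltr0n.
have eps20 : 0 < eps / 2 by apply: divr_gt0.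
exists (eps / 2) => // z.
pose w : R := \sum_i `|(n 0 i)%:~R|.
have w0 : 0 <= w by rewrite sumr_ge0.
have w1 : 0 < w + 1 by apply: ltr_wpDl.
have rho0 : 0 < eps / 2 / (w + 1) by apply: divr_gt0 => //; apply: divr_gt0.
have [J nJ close] := hal _ (pickle n) rho0; have [_ _ /(_ n z n0 nJ)] := hu J.
rewrite -/eps => h.
have h2 : `|shiftv (u J) n 0 c0 - shiftv al n 0 c0| <= eps / 2.
  rewrite !mxE -sumrB; apply: le_trans (ler_norm_sum _ _ _) _.
  apply: le_trans (_ : w * (eps / 2 / (w + 1)) <= _).
    rewrite mulr_suml; apply: ler_sum => i _; rewrite !mxE -mulrBr normrM.
    by rewrite ler_wpM2l // ltW.
  by rewrite mulrA ler_pdivrMr // mulrC (ler_pM2l eps20) lerDl.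
have := ler_distD (shiftv al n 0 c0) (shiftv (u J) n 0 c0) (L%:R * z%:~R).
lra.
Qed.

End Angles.

(** * From a matching modulo the lattice to Borel pieces *)

Section Pieces.
Context (R : realType) (k d L' : nat) (al : 'M[R]_(d, k)).
Let L := (2 * L')%N.
Hypothesis L0 : (0 < L')%N.
Variables (A B : set 'rV[R]_k).
Hypothesis bA : forall x c, A x -> `|x 0 c| < L'%:R.
Hypothesis bB : forall x c, B x -> `|x 0 c| < L'%:R.
Hypotheses (mA : borel A) (mB : borel B).
Variables (mv : torus R k L -> 'rV[int]_d) (N : nat).
Hypothesis mmv : cmeas mv.
Hypothesis mvN : forall x, (nrm (mv x) <= N)%N.
Local Notation rot := (rotation L al).
Hypothesis mvB : forall x, per L A x -> per L B (rot (mv x) x).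
Hypothesis mv_inj : forall x n, per L A x -> per L A (rot n x) -> mv x = mv (rot n x) + n -> n = 0.
Hypothesis mv_surj : forall y, per L B y -> exists n, per L A (rot n y) /\ mv (rot n y) + n = 0.

Local Notation lat z := (L%:R *: map_mx intr (z : 'rV[int]_k) : 'rV[R]_k).

(** [D] lies in an open cube of side [L], which meets each class modulo the lattice at most once. *)
Lemma lattice_unique (D : set 'rV[R]_k) x (z w : 'rV[int]_k) :
  (forall x c, D x -> `|x 0 c| < L'%:R) -> D (x - lat z) -> D (x - lat w) -> z = w.
Proof.
move=> bD Dz Dw; apply/rowP => c; have := bD _ c Dz; have := bD _ c Dw.
rewrite !mxE !ltr_norml => /andP[h1 h2] /andP[h3 h4].
have L0R : 0 < L'%:R :> R by rewrite ltr0n.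
have : (z 0 c - w 0 c)%:~R < 1 :> R.
  rewrite intrB -(ltr_pM2l L0R); move: h1 h2 h3 h4; rewrite /L natrM; nra.
have : -1 < (z 0 c - w 0 c)%:~R :> R.
  rewrite intrB -(ltr_pM2l L0R); move: h1 h2 h3 h4; rewrite /L natrM; nra.
rewrite -[1]/(1%:~R) -rmorphN !ltr_int; generalize (z 0 c) (w 0 c) => a b; lia.
Qed.

Lemma mv_measurable v : borel [set x : 'rV[R]_k | mv x = v] /\ periodic L [set x | mv x = v].
Proof. by apply/torus_measurable; exact: mmv. Qed.

Lemma mv_lattice (x : 'rV[R]_k) (z : 'rV[int]_k) : mv (x + lat z) = mv x.
Proof. by have [_ /(_ x z)] := mv_measurable (mv x); apply. Qed.

(** The lattice part brings the rotated point back to the representative of its class that lies in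
    [B]. *)
Definition trans (vw : 'rV[int]_d * 'rV[int]_k) : 'rV[R]_k := shiftv al vw.1 - lat vw.2.

Definition piece (vw : 'rV[int]_d * 'rV[int]_k) : set 'rV[R]_k :=
  [set x | (A x /\ mv x = vw.1) /\ B (x + trans vw)].

Lemma borel_piece vw : borel (piece vw).
Proof.
apply: borel_and; last exact: borel_translate.
by apply: borel_and => //; case: (mv_measurable vw.1).
Qed.

Lemma piece_of x : A x -> exists w, piece (mv x, w) x.
Proof.
move=> Ax; have [|w hw] := mvB (x := x); first by exists 0; rewrite map_mx0 scaler0 subr0.
by exists w; split => //; rewrite /trans /= addrA.
Qed.

Lemma piece_inj u v x : piece u x -> piece v x -> u = v.
Proof.
case: u v => [v w] [v' w'] [[_ /= h1] B1] [[_ /= h2] B2]; congr (_, _); first by rewrite -h1.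
apply: (lattice_unique (D := B) (x := x + shiftv al v) bB).
  by move: B1; rewrite /trans /= addrA.
by move: B2; rewrite /trans /= addrA -h2 h1.
Qed.

Lemma trans_surj y : B y -> exists vw x, piece vw x /\ trans vw + x = y.
Proof.
move=> By; have [|n [[w Aw] hn]] := mv_surj (y := y); first by exists 0; rewrite map_mx0 scaler0 subr0.
have E : y + shiftv al n - lat w + trans (- n, - w) = y.
  rewrite /trans /= map_mxN scalerN opprK.
  have -> : shiftv al (- n) = - shiftv al n by rewrite /shiftv map_mxN mulNmx.
  by rewrite [- _ + lat w]addrC addrA subrK addrK.
exists (- n, - w), (y + shiftv al n - lat w); split; last by rewrite addrC.
split; last by rewrite E.
split => //=; rewrite -scalerN -map_mxN mv_lattice.
by apply/eqP; rewrite -addr_eq0 hn.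
Qed.

(** Equal images place [x] and [y] in one orbit modulo the lattice. Injectivity of the matching
    equates the rotation parts, and boundedness of [A] then equates the lattice parts. *)
Lemma trans_inj u v x y : piece u x -> piece v y -> trans u + x = trans v + y -> u = v.
Proof.
case: u v => [v w] [v' w'] px py h.
have hy : y = x + shiftv al (v - v') - lat (w - w').
  have hv : shiftv al (v - v') = shiftv al v - shiftv al v'.
    by rewrite shiftvD /shiftv map_mxN mulNmx.
  move: h; rewrite hv map_mxB scalerBr /trans /= => h.
  apply: (addrI (shiftv al v' - lat w')); rewrite -h.
  by apply/rowP => c; rewrite !mxE; ring.
have [[Ax mx] _] := px; have [[Ay my] _] := py; rewrite /= in mx my.
have v0 : v - v' = 0.
  apply: (mv_inj (x := x)).
  - by exists 0; rewrite map_mx0 scaler0 subr0.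
  - by exists (w - w'); rewrite /= /rotate -hy.
  have -> : mv (rot (v - v') x) = v'.
    by rewrite -[RHS]my hy -scalerN -map_mxN mv_lattice.
  by rewrite mx addrC subrK.
have vv : v = v' by apply/eqP; rewrite -subr_eq0 v0.
move: hy; rewrite v0 shiftv0 addr0 => hy.
have w0 : w - w' = 0.
  by apply/esym/(lattice_unique (x := x) bA); rewrite ?map_mx0 ?scaler0 ?subr0 // -hy.
by rewrite vv; congr (_, _); apply/eqP; rewrite -subr_eq0 w0.
Qed.

(** Finiteness of the decomposition: bounded moves between bounded sets involve only finitely many
    lattice vectors. *)
Lemma piece_bounded : exists W, forall v w x, piece (v, w) x -> (nrm w <= W)%N.
Proof.
pose K : R := \sum_(v <- boxs d N) \sum_c `|shiftv al v 0 c| + 2 * L'%:R.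
exists (Num.truncn K).+1 => v w x [[Ax /= mx] Bx]; apply/nrm_leP => c.
have h1 := bA c Ax; have h2 := bB c Bx; move: h2; rewrite /trans /= !mxE => h2.
have h3 : `|shiftv al v 0 c| <= K - 2 * L'%:R.
  have vN : v \in boxs d N by rewrite mem_boxs -mx.
  rewrite addrK (big_rem _ vN) /= (bigD1 c) //= -addrA lerDl.
  by rewrite addr_ge0 // !sumr_ge0 // => *; rewrite sumr_ge0.
have L1 : 1 <= L%:R :> R by rewrite ler1n /L; lia.
have : `|(w 0 c)%:~R| < (Num.truncn K).+1%:R :> R.
  apply: le_lt_trans (truncnS_gt _); apply: le_trans (_ : `|L%:R * (w 0 c)%:~R| <= _).
    by rewrite normrM normr_nat ler_peMl.
  move: h1 h2 h3; rewrite [(shiftv al v) 0 c]mxE.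
  move: (\sum_j _) (L%:R * _) => p q; rewrite !ltr_norml !ler_norml.
  by move=> /andP[? ?] /andP[? ?] /andP[? ?]; apply/andP; split; lra.
by rewrite -intr_norm pmulrn ltr_int; generalize (w 0 c) => a; lia.
Qed.

Lemma pieces_equidecompose : equidecomposable_borel A B.
Proof.
have [W hW] := piece_bounded.
(* Empty pieces are discarded because a [partition] requires nonempty ones. *)
pose l := [seq vw <- [seq (v, w) | v <- boxs d N, w <- boxs k W] | `[< piece vw !=set0 >]].
have ul : uniq l.
  apply: filter_uniq; apply: allpairs_uniq; rewrite ?boxs_uniq //.
  by move=> [a b] [a' b'] _ _ [-> ->].
have ml vw x : piece vw x -> vw \in l.
  case: vw => v w hx; rewrite mem_filter; apply/andP; split; first by apply/asboolP; exists x.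
  apply/allpairsP; exists (v, w); split => //=; rewrite mem_boxs; last exact: hW hx.
  by case: hx => [[_ /= <-] _].
have index vw : vw \in l -> exists i : 'I_(size l), tnth (in_tuple l) i = vw.
  by move=> /(nthP vw) [i il <-]; exists (Ordinal il); rewrite (tnth_nth vw).
have tinj (i j : 'I_(size l)) : tnth (in_tuple l) i = tnth (in_tuple l) j -> i = j.
  by move=> h; apply: (tuple_uniqP (in_tuple l) ul).
have ne i : piece (tnth (in_tuple l) i) !=set0.
  have := mem_tnth i (in_tuple l); rewrite mem_filter => /andP[/asboolP]; exact.
exists (size l), (fun i => piece (tnth (in_tuple l) i)), (fun i => trans (tnth (in_tuple l) i)).
split; first by move=> i; exact: borel_piece.
- split=> [|i j _ _ [x [xi xj]]|i _]; last exact: ne.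
  + apply/seteqP; split => [x [i _ [[]]] //|x Ax].
    have [w hw] := piece_of Ax; have [i hi] := index _ (ml _ _ hw).
    by exists i => //; rewrite hi.
  + exact/tinj/(piece_inj xi xj).
- split=> [|i j _ _ [y [[x1 p1 e1] [x2 p2 e2]]]|i _].
  + apply/seteqP; split => [y [i _ [x [_ Bx] <-]]|y By]; first by rewrite addrC.
    have [vw [x [px <-]]] := trans_surj By; have [i hi] := index _ (ml _ _ px).
    by exists i => //; exists x; rewrite hi.
  + by apply/tinj/(trans_inj p1 p2); rewrite e1 e2.
  + by have [x px] := ne i; exists (trans (tnth (in_tuple l) i) + x), x.
Qed.

End Pieces.

(** * Bounded sets in coordinates and the conclusion *)

Section BoundedSets.
Context (R : realType) (k : nat).
Hypothesis k0 : (0 < k)%N.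

Lemma bounded_coord (A : set 'rV[R]_k) : bounded_set A ->
  exists M : nat, forall x c, A x -> `|x 0 c| <= M%:R.
Proof.
move=> /pinfty_ex_gt0 [K K0 hK]; exists (Num.truncn K).+1 => x c Ax.
apply: le_trans (ltW (truncnS_gt K)); apply: le_trans (hK x Ax).
rewrite -[leRHS]/(mx_norm x) mx_normrE.
exact: (@le_bigmax _ _ _ 0 (fun ij : 'I_1 * 'I_k => `|x ij.1 ij.2|) (0, c)).
Qed.

Lemma boundary_coord (A : set 'rV[R]_k) (M : nat) : (forall x c, A x -> `|x 0 c| <= M%:R) ->
  forall x c, boundary A x -> `|x 0 c| <= M.+1%:R.
Proof.
move=> bA x c [clA _]; have [y [Ay [_ xy]]] := clA _ (nbhsx_ballx x _ (@ltr01 R)).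
have := bA y c Ay; have := xy 0 c; rewrite /ball /= -natr1 => h1 h2.
have := ler_distD (y 0 c) (x 0 c) 0; rewrite !subr0; lra.
Qed.

Lemma lebesgue_fin (A : set 'rV[R]_k) (M : nat) : (forall x c, A x -> `|x 0 c| <= M%:R) ->
  lebesgue A = (fine (lebesgue A))%:E.
Proof.
move=> bA; rewrite fineK // ge0_fin_numE.
  apply: le_lt_trans (_ : ((size (boxs k M.+1))%:R * (2 ^- 0) ^+ k)%:E < +oo)%E; last exact: ltry.
  apply: lebesgue_le_cells => // x Ax.
  exists (cidx 0 x); last exact/grid_cubeP.
  rewrite mem_boxs; apply/nrm_leP => c; have := cidx_itv 0 x c; rewrite expr0 mul1r.
  have := bA x c Ax; rewrite ler_norml => /andP[h1 h2] /andP[h3 h4].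
  have : (cidx 0 x 0 c)%:~R < (M%:Z + 1)%:~R :> R by rewrite intrD -pmulrn; lra.
  have : (- M%:Z - 1)%:~R <= (cidx 0 x 0 c)%:~R :> R by rewrite intrB rmorphN /= -pmulrn; lra.
  by rewrite ler_int ltr_int; generalize (cidx 0 x 0 c) => a; lia.
apply/ereal_infP => _ [ab _ <-]; apply: nneseries_ge0 => n _ _.
by rewrite lee_fin box_volume_ge0.
Qed.

End BoundedSets.

Theorem theorem1p2 (R : realType) (k : nat) (A B : set 'rV[R]_k)
    (k_ge1 : (1 <= k)%N)
    (bA : bounded_set A) (bB : bounded_set B)
    (mA : borel A) (mB : borel B)
    (eqAB : lebesgue A = lebesgue B) (A_gt0 : (0 < lebesgue A)%E)
    (dA : (upper_minkowski_dim (boundary A) < k%:R%:E)%E)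
    (dB : (upper_minkowski_dim (boundary B) < k%:R%:E)%E) :
  equidecomposable_borel A B.
Proof.
have [MA hMA] := bounded_coord bA; have [MB hMB] := bounded_coord bB.
pose M := maxn MA MB; pose L' := (M + 5)%N; pose L := (2 * L')%N.
have {}hMA x c : A x -> `|x 0 c| <= M%:R.
  by move=> Ax; apply: le_trans (hMA x c Ax) _; rewrite ler_nat leq_maxl.
have {}hMB x c : B x -> `|x 0 c| <= M%:R.
  by move=> Bx; apply: le_trans (hMB x c Bx) _; rewrite ler_nat leq_maxr.
have [sA hsA] := minkowski_dyadic (boundary_coord hMA) dA.
have [sB hsB] := minkowski_dyadic (boundary_coord hMB) dB.
pose s := maxn sA sB.
have [CA [CA0 bdA]] := hsA s (leq_maxl _ _); have [CB [CB0 bdB]] := hsB s (leq_maxr _ _).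
have lamA := lebesgue_fin k_ge1 hMA; pose lam := fine (lebesgue A).
have lamB : lebesgue B = lam%:E by rewrite -eqAB.
have lam0 : 0 < lam by rewrite -lte_fin -lamA.
have L'0 : (0 < L')%N by rewrite /L'; lia.
have L0 : (0 < L)%N by rewrite muln_gt0.
have L0R : 0 < L%:R :> R by rewrite ltr0n.
pose e0 := (4 * L ^ k)%N; have Le : (4 * L ^ k < 2 ^ e0)%N by exact: ltn_expl.
pose c0 : 'I_k := Ordinal k_ge1.
have [al [al_approx free]] := exists_angles R s c0 L0 Le.
have sep := rotation_separable L0 free.
have [C1 disA] := discrepancy k_ge1 (leqnn L') al_approx hMA lamA CA0 bdA.
have [C2 disB] := discrepancy k_ge1 (leqnn L') al_approx hMB lamB CB0 bdB.
pose d := (s * k + 2 + (2 * s * k + 3 + e0))%N; pose C := Num.max C1 C2.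
have P0 j : 0 <= 2 ^+ (j * d) / 4 ^+ j :> R by rewrite divr_ge0 ?exprn_ge0.
have meas_per (D : set 'rV[R]_k) : borel D -> measurable [set x : torus R k L | `[< per L D x >]].
  move=> bD; have -> : [set x : torus R k L | `[< per L D x >]] = per L D.
    by apply/seteqP; split=> x /= /asboolP.
  by apply/torus_measurable; split; [exact: borel_per | exact: periodic_per].
have [|||||||mv [N [mmv mvN mvB mv_inj mv_surj]]] := @abstract_equidecomposition d _ (torus R k L)
  (rotation L al) R (fun x => `[< per L A x >]) (fun x => `[< per L B x >]) C (lam / L%:R ^+ k).
- by rewrite /d; lia.
- exact: sep.
- by rewrite divr_gt0 // exprn_gt0.
- exact: meas_per.
- exact: meas_per.
- move=> x j; apply: le_trans (disA j x) _.
  by rewrite -!mulrA ler_wpM2r // le_max lexx.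
- move=> x j; apply: le_trans (disB j x) _.
  by rewrite -!mulrA ler_wpM2r // le_max lexx orbT.
have lt_L' (D : set 'rV[R]_k) : (forall x c, D x -> `|x 0 c| <= M%:R) ->
    forall x c, D x -> `|x 0 c| < L'%:R.
  by move=> hD x c Dx; apply: le_lt_trans (hD x c Dx) _; rewrite ltr_nat /L'; lia.
apply: (pieces_equidecompose L'0 (lt_L' _ hMA) (lt_L' _ hMB) mA mB mmv mvN (al := al)).
- by move=> x pA; apply/asboolP/mvB/asboolP.
- by move=> x n pA pA'; apply: mv_inj; apply/asboolP.
- by move=> y /asboolP /mv_surj [n [/asboolP pA hn]]; exists n.
Qed.
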